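(* Let $u:\mathbb{R}^2\to\mathbb{R}$ be continuous, let $\mathfrak{g}:\mathbb{R}^2\to\mathbb{R}$ be continuous and bounded, and let $f:\mathbb{R}\to\mathbb{R}$ be of class $C^2$. Consider the conditions: (1) $\partial_t u+\partial_x(f(u))=\mathfrak{g}$ in $\mathcal{D}'(\mathbb{R}^2)$. (2) There exists a family of characteristic curves of $u$, whose images have dense union in $\mathbb{R}^2$, along each of which $u$ is Lipschitz continuous and the classical derivative of $u$ is given by $\mathfrak{g}$, i.e. $\frac{d}{dt}u(t,\gamma(t))=\mathfrak{g}(t,\gamma(t))$ for each curve $t\mapsto(t,\gamma(t))$ in the family. Then (2) implies (1). Moreover, if the inflection points of $f$ are isolated, then (1) implies (2).
   Context: A characteristic of $u$ is a $C^1$ function $\gamma:\mathbb{R}\to\mathbb{R}$ with $\dot\gamma(t)=f'(u(t,\gamma(t)))$; the corresponding characteristic curve is $t\mapsto(t,\gamma(t))$. A point $z^*\in\mathbb{R}$ is an inflection point of $f$ if $f''(z^* )=0$ and $z^*$ is neither a local maximum nor a local minimum of $z\mapsto f(z)-f'(z^* )(z-z^* )$. *)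

(* Defs.v *)
From HB Require Import structures.
From mathcomp Require Import all_boot all_order all_algebra.
From mathcomp Require Import all_classical all_reals all_analysis.

Set Implicit Arguments.
Unset Strict Implicit.
Unset Printing Implicit Defensive.
Import Order.TTheory GRing.Theory Num.Theory numFieldNormedType.Exports.
Local Open Scope ring_scope.
Local Open Scope classical_set_scope.

(* Points of the plane are pairs z = (t, x): time first, space second. *)

Definition class_C (R : realType) (n : nat) (f : R -> R) : Prop :=
  (forall k, (k < n)%N -> forall x, derivable (derive1n k f) x 1) /\
  continuous (derive1n n f).

Definition partial_t (R : realType) (phi : R * R -> R) (z : R * R) : R :=
  derive1 (fun s => phi (s, z.2)) z.1.

Definition partial_x (R : realType) (phi : R * R -> R) (z : R * R) : R :=
  derive1 (fun y => phi (z.1, y)) z.2.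

(* The word w lists the successive differentiations, the last one performed
   at the head: true stands for d/dt, false for d/dx. *)
Fixpoint iter_partial (R : realType) (w : seq bool) (phi : R * R -> R) :
    R * R -> R :=
  match w with
  | [::] => phi
  | b :: w' =>
      if b then partial_t (iter_partial w' phi)
      else partial_x (iter_partial w' phi)
  end.

(* Since derive1 is total, the existence of the partial derivatives has to be
   required separately. *)
Definition smooth (R : realType) (phi : R * R -> R) : Prop :=
  forall w : seq bool,
    [/\ continuous (iter_partial w phi),
        forall z : R * R,
          derivable (fun s => iter_partial w phi (s, z.2)) z.1 1 &
        forall z : R * R,
          derivable (fun y => iter_partial w phi (z.1, y)) z.2 1].

Definition test_function (R : realType) (phi : R * R -> R) : Prop :=
  smooth phi /\ compact (closure [set z | phi z != 0]).

(* Distributions are represented by their action on test functions; the values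
   on other functions are never used. *)
Definition distr_of (R : realType) (h : R * R -> R) (phi : R * R -> R) : R :=
  \int[(lebesgue_measure \x lebesgue_measure)%E]_z (h z * phi z).

Definition distr_dt (R : realType) (T : (R * R -> R) -> R)
    (phi : R * R -> R) : R :=
  - T (partial_t phi).

Definition distr_dx (R : realType) (T : (R * R -> R) -> R)
    (phi : R * R -> R) : R :=
  - T (partial_x phi).

Definition distributional_solution (R : realType) (f : R -> R)
    (u g : R * R -> R) : Prop :=
  forall phi, test_function phi ->
    distr_dt (distr_of u) phi + distr_dx (distr_of (f \o u)) phi =
    distr_of g phi.

Definition characteristic (R : realType) (f : R -> R) (u : R * R -> R)
    (gamma : R -> R) : Prop :=
  class_C 1 gamma /\ forall t, derive1 gamma t = derive1 f (u (t, gamma t)).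

Definition solution_along_characteristics (R : realType) (f : R -> R)
    (u g : R * R -> R) : Prop :=
  exists Gamma : set (R -> R),
    [/\ forall gamma, Gamma gamma -> characteristic f u gamma,
        dense (\bigcup_(gamma in Gamma) range (fun t : R => (t, gamma t))),
        forall gamma, Gamma gamma ->
          lipschitz (fun t : R => u (t, gamma t)) &
        forall gamma, Gamma gamma ->
          forall t : R,
            is_derive t 1 (fun s : R => u (s, gamma s)) (g (t, gamma t))].

Definition local_max (R : realType) (h : R -> R) (a : R) : Prop :=
  \forall z \near a, h z <= h a.

Definition local_min (R : realType) (h : R -> R) (a : R) : Prop :=
  \forall z \near a, h a <= h z.

Definition inflection_point (R : realType) (f : R -> R) : set R :=
  [set a | let h := fun z => f z - derive1 f a * (z - a) in
     [/\ derive1n 2 f a = 0, ~ local_max h a & ~ local_min h a]].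

(* Main.v *)
(* Both conditions amount to the existence of functions V and M with
   V_x = u, V_t = M - f(u) and M_x = g.

   Such a V turns the weak formulation into an integration by parts. Conversely,
   if N_t = M - f(u) and V_x = u, the weak formulation says that N - V is
   annihilated by all mixed derivatives of test functions. Testing with products
   whose factors have differences of translated bumps as derivatives shows that
   the mixed second differences of N - V vanish, so V can be chosen with V_t = N_t.

   From V to characteristics: along trajectories of the speed
   (f(u) - f(s)) / (u - s), where s is an affine function of t,
   the difference of V(t, x) - s(t) x at two trajectories is controlled by M alone.
   This forces u(h, .) to come close to u(0, x0) + g h at some point
   x0 + f'(u) h + o(h). Chaining such points with step h and letting h tend to 0,
   as in Euler's scheme, produces a characteristic with u' = g through every point.

   From characteristics to V: the curves with u' = g are closed under min and max,
   so the strip between two of them is cut by finitely many others into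
   arbitrarily thin strips. Differentiating a Riemann sum of u over such a
   subdivision gives, in the limit, the balance law on the strip, and hence V. *)
Require Import Defs.
From mathcomp Require Import all_boot all_order all_algebra ring lra.
From mathcomp Require Import all_classical all_reals all_analysis.
From mathcomp Require Import measurable_realfun.
Set Implicit Arguments.
Unset Strict Implicit.
Unset Printing Implicit Defensive.
Import Order.TTheory GRing.Theory Num.Theory numFieldNormedType.Exports.
Local Open Scope ring_scope.
Local Open Scope classical_set_scope.

(** * Derivatives and primitives of real functions *)

(** Since [u] is merely continuous, neither direction can differentiate it across curves or rely on
    uniqueness of trajectories. From (1) to (2), the chord speed is used instead of f'(u) because it
    makes a cancellation exact: f(u) - f(s) equals speed times u - s, so every term containing [u]
    drops out and only [M], whose increments in x are controlled by [g], is left. From (2) to (1),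
    the obstacle is variation. The time derivative of a Riemann sum over curves contains the sum of
    u_j (f'(u_{j+1}) - f'(u_j)). Comparing it with the increment of z f'(z) - f(z) costs the local
    oscillation of f' times the variation of the u_j, and this variation may grow without bound as
    curves are added. Replacing the u_j by a unimodal sequence with the same end values bounds the
    variation by a multiple of sup |u|, so the error disappears under refinement. The replacement
    commutes with common shifts, hence still moves at a rate close to [g]. *)

Lemma eq_ler (R : numDomainType) (a b : R) : a = b -> a <= b.
Proof. by move=> ->. Qed.

(** The epsilon form of [is_derive], with the derivative as an argument and no quotient: [s = t] is
    allowed, and the estimates combine linearly, so that [lra] can close them. *)
Definition has_deriv (R : realType) (F : R -> R) (t d : R) : Prop :=
  forall e : R, 0 < e -> exists2 r : R, 0 < r &
    forall s, `|s - t| < r -> `|F s - F t - d * (s - t)| <= e * `|s - t|.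

Lemma is_derive_has_deriv (R : realType) (F : R -> R) (t d : R) :
  is_derive t 1 F d -> has_deriv F t d.
Proof.
move=> [dF <-] e e0.
move/cvgrPdist_le : dF => /(_ e e0) /nbhs_ballP[r /= r0 H].
exists r => // s st; case: (eqVneq s t) => [->|nst].
  by rewrite !subrr mulr0 subr0 normr0 mulr0.
have {H} := H (s - t); rewrite -ball_normE /= sub0r normrN subr_eq0 => /(_ st nst).
rewrite /GRing.scale /= mulr1 subrK => H.
have p : 0 < `|s - t| by rewrite normr_gt0 subr_eq0.
rewrite -ler_pdivrMr// -normf_div; apply: le_trans H; rewrite distrC /derive /=.
apply: eq_ler; congr `|_|.
by rewrite [in RHS]mulrC mulrBl mulfK ?subr_eq0.
Qed.

Lemma has_deriv_is_derive (R : realType) (F : R -> R) (t d : R) :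
  has_deriv F t d -> is_derive t 1 F d.
Proof.
move=> H.
have C : (fun h => h^-1 *: ((F \o shift t) (h *: 1) - F t)) @ 0^' --> d.
  apply/cvgrPdist_le => e /H[r r0 {}H]; apply/nbhs_ballP; exists r => //= h; rewrite -ball_normE /=.
  rewrite sub0r normrN => hr h0; rewrite /GRing.scale /= mulr1.
  have := H (h + t); rewrite addrK => /(_ hr) {}H.
  have p : 0 < `|h| by rewrite normr_gt0.
  rewrite distrC -(ler_pM2r p) -normrM; apply: le_trans H; apply: eq_ler.
  by congr `|_|; rewrite mulrBl mulrC mulrA divff// mul1r.
by split; [apply/cvg_ex; exists d | apply: cvg_lim].
Qed.

Lemma continuousP1 (R : realType) (F : R -> R) (x : R) :
  {for x, continuous F} <-> forall e : R, 0 < e -> exists2 r : R, 0 < r &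
    forall y, `|y - x| < r -> `|F y - F x| <= e.
Proof.
split.
  move=> /cvgrPdist_le H e /H /nbhs_ballP[r /= r0 {}H]; exists r => // y yx.
  by rewrite distrC; apply: H; rewrite /ball /= distrC.
move=> H; apply/cvgrPdist_le => e /H[r r0 {}H]; apply/nbhs_ballP; exists r => //= y.
by rewrite /ball /= distrC => /H; rewrite distrC.
Qed.

Lemma continuousP2 (R : realType) (F : R * R -> R) (t x : R) :
  {for (t, x), continuous F} <-> forall e : R, 0 < e -> exists2 r : R, 0 < r &
    forall s y, `|s - t| < r -> `|y - x| < r -> `|F (s, y) - F (t, x)| <= e.
Proof.
split.
  move=> /cvgrPdist_le H e /H /nbhs_ballP[r /= r0 {}H]; exists r => // s y st yx.
  by rewrite distrC; apply: H; split; rewrite /ball /= distrC.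
move=> H; apply/cvgrPdist_le => e /H[r r0 {}H].
exists (ball t r, ball x r); first by split; exact: nbhsx_ballx.
move=> [s y] [/= h1 h2]; rewrite distrC; apply: H; rewrite distrC; [exact: h1 | exact: h2].
Qed.

Lemma has_deriv_cont (R : realType) (F : R -> R) (t d : R) :
  has_deriv F t d -> {for t, continuous F}.
Proof.
move/has_deriv_is_derive => [dF _].
by apply: differentiable_continuous; apply/derivable1_diffP.
Qed.

Lemma MVT_has_deriv (R : realType) (F dF : R -> R) (a b : R) : a <= b ->
  (forall x, a <= x <= b -> has_deriv F x (dF x)) ->
  exists2 c, a <= c <= b & F b - F a = dF c * (b - a).
Proof.
move=> ab H; have [||c cab E] := @MVT_segment R F dF a b ab.
- move=> x; rewrite in_itv /= => /andP[h1 h2].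
  by apply/has_deriv_is_derive/H; rewrite !ltW.
- apply: continuous_in_subspaceT => x /set_mem; rewrite /= in_itv /= => h.
  exact: has_deriv_cont (H _ h).
by exists c => //; move: cab; rewrite in_itv.
Qed.

Lemma MVT_abs (R : realType) (F dF : R -> R) (a b C : R) :
  (forall x, (a <= x <= b) || (b <= x <= a) -> has_deriv F x (dF x)) ->
  (forall x, (a <= x <= b) || (b <= x <= a) -> `|dF x| <= C) ->
  `|F b - F a| <= C * `|b - a|.
Proof.
wlog ab : a b / a <= b.
  move=> W; have /orP[ab|ba] := le_total a b; first exact: W.
  move=> H1 H2; rewrite distrC [`|b - a|]distrC.
  by apply: W => // x; rewrite orbC; [exact: H1 | exact: H2].
move=> H1 H2; have [|c hc ->] := @MVT_has_deriv R F dF _ _ ab.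
  by move=> x hx; apply: H1; rewrite hx.
by rewrite normrM ler_wpM2r// H2// hc.
Qed.

Lemma has_derivB (R : realType) (F G : R -> R) (t a b : R) :
  has_deriv F t a -> has_deriv G t b -> has_deriv (fun s => F s - G s) t (a - b).
Proof.
move=> /has_deriv_is_derive hF /has_deriv_is_derive hG; exact: is_derive_has_deriv.

Qed.

Lemma has_derivD (R : realType) (F G : R -> R) (t a b : R) :
  has_deriv F t a -> has_deriv G t b -> has_deriv (fun s => F s + G s) t (a + b).
Proof.
move=> /has_deriv_is_derive hF /has_deriv_is_derive hG; exact: is_derive_has_deriv.

Qed.

Lemma has_derivM (R : realType) (F G : R -> R) (t a b : R) :
  has_deriv F t a -> has_deriv G t b ->
  has_deriv (fun s => F s * G s) t (a * G t + F t * b).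
Proof.
move=> /has_deriv_is_derive hF /has_deriv_is_derive hG; apply: is_derive_has_deriv.
by apply: is_derive_eq; rewrite /GRing.scale /= addrC [G t * a]mulrC.
Qed.

Lemma has_deriv_cst (R : realType) (c t : R) : has_deriv (fun=> c) t 0.
Proof. exact: is_derive_has_deriv. Qed.

Lemma has_deriv_id (R : realType) (t : R) : has_deriv id t 1.
Proof. exact: is_derive_has_deriv. Qed.

Lemma has_deriv_eq (R : realType) (F : R -> R) (t a b : R) :
  has_deriv F t a -> a = b -> has_deriv F t b.
Proof. by move=> ? <-. Qed.

Lemma has_deriv_near (R : realType) (F G : R -> R) (t a r : R) : 0 < r ->
  (forall s, `|s - t| < r -> F s = G s) -> has_deriv F t a -> has_deriv G t a.
Proof.
move=> r0 FG H e /H[r' r'0 {}H]; exists (Num.min r r'); first by rewrite lt_min r0.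
move=> s; rewrite lt_min => /andP[h1 h2].
by rewrite -!FG ?subrr ?normr0 //; exact: H.
Qed.

(** The fundamental theorem is applied to integrals from a fixed left endpoint [- a], and only to
    the right of it. Two such integrals differ by a constant where both are defined, so after
    normalisation at 0 they patch together into one primitive on the line. *)
Lemma exists_antideriv (R : realType) (F : R -> R) : continuous F ->
  exists2 P : R -> R, P 0 = 0 & forall x, has_deriv P x (F x).
Proof.
move=> cF.
pose P a x := \int[lebesgue_measure]_(t in [set` Interval (BLeft (- a)) (BRight x)]) F t.
have dP a x : - a < x -> has_deriv (P a) x (F x).
  move=> ax; apply: is_derive_has_deriv.
  have [||||h1 h2] := @continuous_FTC1 R F (BLeft (- a)) x (x + 1).
  - by rewrite ltrDl.
  - apply: continuous_compact_integrable; first exact: segment_compact.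
    exact: continuous_subspaceT.
  - exact: ax.
  - exact: cF.
  - exact: (DeriveDef h1 (etrans (esym (derive1E _ _)) h2)).
have cons a b x : `|x| < a -> `|x| < b -> P a x - P a 0 = P b x - P b 0.
  rewrite !ltr_norml => ha hb.
  have := @MVT_abs R (fun y => P a y - P b y) (fun=> 0) 0 x 0.
  rewrite mul0r => H.
  suff : P a x - P b x - (P a 0 - P b 0) == 0 by move=> /eqP; lra.
  rewrite -normr_le0; apply: H => y hy; last by rewrite normr0.
  rewrite -(subrr (F y)); apply: has_derivB; apply: dP; move: hy => /orP[] hy; lra.
exists (fun x => P (`|x| + 1) x - P (`|x| + 1) 0); first by rewrite subrr.
(* The window [|x| + 1] moves with the point; around [x] the fixed window [|x| + 2] gives the same
   values. *)
move=> x; apply: (@has_deriv_near _ (fun y => P (`|x| + 2) y - P (`|x| + 2) 0) _ _ _ 1).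
- by [].
- move=> s sx; apply: cons; last by rewrite ltrDl.
  have : s = x + (s - x) by ring.
  move=> -> ; apply: le_lt_trans (ler_normD _ _) _; lra.
- rewrite -[F x]subr0; apply: has_derivB; last exact: has_deriv_cst.
  by apply: dP; have := ler_norm (- x); rewrite normrN; lra.
Qed.

Ltac norm_lra := rewrite ?(ltr_norml, ler_norml); intros; lra.

Lemma compact_box (R : realType) (A : R) :
  compact ([set z | `|z.1| <= A /\ `|z.2| <= A] : set (R * R)).
Proof.
rewrite (_ : mkset _ = `[- A, A]%classic `*` `[- A, A]%classic).
  by apply: compact_setX; exact: segment_compact.
by apply/seteqP; split => -[t x] /=; rewrite !in_itv /= !ler_norml.
Qed.

(** Compactness enters through the filter of small radii. Only the centre [(t, x)] has to lie in the
    box, so nearby points just outside are covered too. *)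
Lemma uniform_box (R : realType) (F : R * R -> R) (A e : R) :
  continuous F -> 0 < e -> exists2 r : R, 0 < r & forall t x s y,
    `|t| <= A -> `|x| <= A -> `|s - t| < r -> `|y - x| < r ->
    `|F (s, y) - F (t, x)| <= e.
Proof.
move=> cF e0.
have /compact_near_coveringP H := @compact_box R A.
pose P (r : R) (z : R * R) := forall s y, `|s - z.1| < r -> `|y - z.2| < r ->
  `|F (s, y) - F z| <= e.
have : \forall r \near 0^'+, [set z : R * R | `|z.1| <= A /\ `|z.2| <= A] `<=` P r.
  apply: H => -[t x] _.
  have e20 : 0 < e / 2 by lra.
  have /continuousP2/(_ _ e20)[r r0 {}H] := cF (t, x).
  have r20 : 0 < r / 2 by lra.
  exists ([set z | ball t (r / 2) z.1 /\ ball x (r / 2) z.2], [set d | d < r / 2]).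
    split; last exact: nbhs_right_lt.
    by exists (ball t (r / 2), ball x (r / 2)); [split; exact: nbhsx_ballx | by []].
  move=> [[t' x'] d] /= [[]]; rewrite -!ball_normE /= => h1 h2 dr s y /= h3 h4.
  have : `|F (s, y) - F (t, x)| <= e / 2 by apply: H; move: h1 h2 h3 h4; norm_lra.
  have : `|F (t', x') - F (t, x)| <= e / 2 by apply: H; move: h1 h2 h3 h4; norm_lra.
  norm_lra.
move=> [r /= r0 {}H]; have r20 : 0 < r / 2 by lra.
exists (r / 2) => // t x s y ht hx hs hy.
apply: (H (r / 2) _ _ (t, x)) => //=; rewrite -?ball_normE /= ?sub0r ?normrN ?gtr0_norm //; lra.
Qed.

Lemma bounded_box (R : realType) (F : R * R -> R) (A : R) :
  continuous F -> exists2 C : R, 0 < C & forall t x,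
    `|t| <= A -> `|x| <= A -> `|F (t, x)| <= C.
Proof.
move=> cF.
have : compact (F @` [set z | `|z.1| <= A /\ `|z.2| <= A]).
  by apply: continuous_compact (@compact_box R A); exact: continuous_subspaceT.
move=> /compact_bounded[M [_ HM]]; exists (`|M| + 1); first by rewrite ltr_pwDr.
move=> t x ht hx; apply: HM; last by exists (t, x).
by rewrite (le_lt_trans (ler_norm M)) // ltrDl.
Qed.

Lemma continuous_slice (R : realType) (F : R * R -> R) (t : R) :
  continuous F -> continuous (fun x => F (t, x)).
Proof.
move=> cF x; apply/continuousP1 => e e0.
have /continuousP2/(_ _ e0)[r r0 H] := cF (t, x).
by exists r => // y yx; apply: H => //; rewrite subrr normr0.
Qed.

Lemma continuous_swap (R : realType) (F : R * R -> R) :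
  continuous F -> continuous (fun z => F (z.2, z.1)).
Proof.
move=> cF [t x]; apply/continuousP2 => e e0.
have /continuousP2/(_ _ e0)[r r0 H] := cF (x, t).
by exists r => // s y st yx; apply: H.
Qed.

Lemma exists_primitive_x (R : realType) (F : R * R -> R) : continuous F ->
  exists P : R * R -> R, [/\ continuous P, forall t, P (t, 0) = 0 &
    forall t x, has_deriv (fun y => P (t, y)) x (F (t, x))].
Proof.
move=> cF.
have /choice[Q HQ] : forall t, exists Q : R -> R,
    Q 0 = 0 /\ forall x, has_deriv Q x (F (t, x)).
  by move=> t; have [Q] := exists_antideriv (continuous_slice cF (t:=t)); exists Q.
exists (fun z => Q z.1 z.2); split; [|by move=> t; have [] := HQ t|
  by move=> t x; have [] := HQ t].
move=> [t x]; apply/continuousP2 => e e0 /=.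
pose A := `|t| + `|x| + 1.
have A0 : 0 < A by rewrite ltr_wpDl // addr_ge0.
have e1 : 0 < e / 2 / A by rewrite divr_gt0 //; lra.
have [r r0 H] := uniform_box A cF e1.
have e2 : 0 < e / 2 by lra.
have /continuousP1/(_ _ e2)[r1 r10 H1] := has_deriv_cont ((HQ t).2 x).
exists (Num.min 1 (Num.min r r1)); first by rewrite !lt_min ltr01 r0.
move=> s y; rewrite !lt_min => /and3P[s1 sr sr1] /and3P[y1 yr yr1].
have h2 := H1 y yr1.
(* [Q s - Q t] vanishes at 0, and its derivative [F (s, z) - F (t, z)] is uniformly small for z
   between 0 and [y], a range of length at most [A]. *)
have h3 : `|(Q s y - Q t y) - (Q s 0 - Q t 0)| <= (e / 2 / A) * `|y - 0|.
  apply: (@MVT_abs _ (fun y => Q s y - Q t y) (fun y => F (s, y) - F (t, y))) => z hz.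
    by apply: has_derivB; [exact: (HQ s).2 | exact: (HQ t).2].
  apply: H => //; last by rewrite subrr normr0.
  - by rewrite /A -addrA lerDl addr_ge0.
  - move: hz y1; rewrite /A; have := normr_ge0 t; have := ler_norm x; have := ler_norm (- x).
    rewrite normrN; norm_lra.
have h4 : (e / 2 / A) * `|y - 0| <= e / 2.
  rewrite -[leRHS](divfK (lt0r_neq0 A0)) ler_wpM2l ?(ltW e1) //.
  move: y1; rewrite /A; have := normr_ge0 t; have := ler_norm x; have := ler_norm (- x).
  rewrite normrN; norm_lra.
move: (le_trans h3 h4) h2; rewrite (HQ s).1 (HQ t).1; norm_lra.
Qed.

Lemma exists_primitive_t (R : realType) (F : R * R -> R) : continuous F ->
  exists P : R * R -> R, [/\ continuous P, forall x, P (0, x) = 0 &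
    forall t x, has_deriv (fun s => P (s, x)) t (F (t, x))].
Proof.
move=> /continuous_swap/exists_primitive_x[P [cP P0 dP]].
by exists (fun z => P (z.2, z.1)); split => [|x|t x]; [exact: continuous_swap | exact: P0 | exact: dP].
Qed.

(** An upper right Dini derivative that is nowhere positive forbids growth. With slack [e] per unit
    of time the bound holds up to a maximal time: continuity carries it to that time, and the slope
    there would extend it further. *)
Lemma right_slope_le (R : realType) (F : R -> R) (a b : R) : a <= b ->
  continuous F ->
  (forall t, a <= t < b -> forall e : R, 0 < e -> exists2 r : R, 0 < r &
     forall h : R, 0 < h < r -> F (t + h) - F t <= e * h) ->
  F b <= F a.
Proof.
move=> ab cF H; apply/ler_addgt0Pr => e0 e0_gt0.
pose e := e0 / (b - a + 1).
have e_gt0 : 0 < e by rewrite divr_gt0 //; lra.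
suff : F b - F a <= e * (b - a).
  have : e * (b - a) <= e0.
    by rewrite /e mulrAC ler_pdivrMr ?ler_pM2l //; lra.
  lra.
pose S := [set t | a <= t <= b /\ forall s, a <= s <= t -> F s - F a <= e * (s - a)].
have Sa : S a.
  split; first by lra.
  by move=> s hs; have -> : s = a; [lra | rewrite !subrr mulr0].
have supS : has_sup S by split; [exists a | exists b => t [/andP[]]].
pose c := sup S.
have ac : a <= c by exact: ub_le_sup supS.2 _ Sa.
have cb : c <= b by apply: ge_sup; [exists a | move=> t [/andP[]]].
have below s : a <= s < c -> F s - F a <= e * (s - a).
  move=> /andP[h1 h2].
  have /(sup_adherent)/(_ supS)[t [tab Ht]] : 0 < c - s by rewrite subr_gt0.
  by rewrite -/c => h3; apply: Ht; lra.
have Sc : F c - F a <= e * (c - a).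
  apply/ler_addgt0Pr => e1 e10.
  have e20 : 0 < e1 / 2 by lra.
  have e30 : 0 < e1 / 2 / e by rewrite divr_gt0.
  have /continuousP1/(_ _ e20)[r r0 Hr] := cF c.
  have [->|nac] := eqVneq c a; first by rewrite !subrr mulr0 add0r ltW.
  pose s := Num.max a (c - r / 2).
  have sc : a <= s < c.
    by rewrite /s le_max lexx /= gt_max; apply/andP; split; [rewrite lt_neqAle eq_sym nac | lra].
  have : `|F s - F c| <= e1 / 2.
    by apply: Hr; have : c - r / 2 <= s; [rewrite le_max lexx orbT | move: sc; norm_lra].
  have := below _ sc; have : e * (s - a) <= e * (c - a) by rewrite ler_wpM2l ?(ltW e_gt0) //; lra.
  norm_lra.
have [<-//|cneb] := eqVneq c b.
have cltb : c < b by rewrite lt_neqAle cneb.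
have [|r r0 Hr] := H c _ _ e_gt0; first by rewrite ac.
pose d := Num.min (r / 2) (b - c).
have d0 : 0 < d by rewrite lt_min; apply/andP; split; lra.
have dr : d <= r / 2 by rewrite ge_min lexx.
have dbc : d <= b - c by rewrite ge_min lexx orbT.
suff : S (c + d) by move=> /(ub_le_sup supS.2); rewrite -/c; lra.
split; first by lra.
move=> s hs; have [h1|h1] := ltP s c; first by apply: below; lra.
have [->//|h2] := eqVneq s c.
have h3 : c < s by rewrite lt_neqAle eq_sym h2.
have := Hr (s - c); have -> : c + (s - c) = s by ring.
move=> h4.
have : F s - F c <= e * (s - c) by apply: h4; lra.
have -> : e * (s - a) = e * (s - c) + e * (c - a) by ring.
lra.
Qed.

(** * Limits of polygonal approximations *)

(* An ultrafilter gives a cluster function valid at any two times simultaneously,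
   without equicontinuity. *)
Lemma exists_pointwise_cluster (R : realType) (Y : nat -> R -> R) :
  (forall t : R, 0 <= t -> exists (B : R) N, forall n, (N <= n)%N -> `|Y n t| <= B) ->
  exists gam : R -> R, forall (s t e : R) N, 0 <= s -> 0 <= t -> 0 < e ->
    exists n, [/\ (N <= n)%N, `|Y n s - gam s| < e & `|Y n t - gam t| < e].
Proof.
move=> HB.
have [U [UU sU]] := @ultraFilterLemma nat \oo _.
have /choice[gam Hg] : forall t : R, exists p : R, 0 <= t ->
    forall e : R, 0 < e -> U [set n | `|Y n t - p| < e].
  move=> t; have [t0|] := boolP (0 <= t); last by exists 0.
  have [B [N HN]] := HB t t0.
  have [|p [_ pl]] := @segment_compact R (- B) B (fmap (Y ^~ t) U) _.
    apply: sU; exists N => // n Nn; rewrite /= in_itv /= -ler_norml; exact: HN.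
  exists p => _ e e0.
  have [//|Un] := in_ultra_setVsetC [set n | `|Y n t - p| < e] UU.
  have [|y [/= h1]] := pl (fun y => ~ `|y - p| < e) (ball p e) _ (nbhsx_ballx p e e0).
    exact: Un.
  by rewrite -ball_normE /= distrC.
exists gam => s t e N s0 t0 e0.
have H := filterI (filterI (Hg s s0 e e0) (Hg t t0 e e0)) (sU _ (nbhs_infty_ge N)).
by have [n [[h1 h2] h3]] := filter_ex (H _ _); exists n.
Qed.

Lemma telescope_le (R : realType) (a : nat -> R) (c d h : R) (i j : nat) :
  (i <= j)%N -> (forall k, (i <= k < j)%N -> `|a k.+1 - a k - c * h| <= d * h) ->
  `|a j - a i - c * (j%:R * h - i%:R * h)| <= d * (j%:R * h - i%:R * h).
Proof.
move=> ij; rewrite -(subnKC ij); elim: (j - i)%N => [|m IH] H.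
  by rewrite addn0 !subrr mulr0 subrr normr0 mulr0.
have {}IH := IH (fun k hk => H k (ltac:(by move: hk => /andP[-> /ltn_trans]; apply; rewrite addnS))).
have := H (i + m)%N; rewrite leq_addr addnS ltnSn => /(_ isT).
move: IH; rewrite -natr1.
have -> : ((i + m)%:R + 1) * h - i%:R * h = ((i + m)%:R * h - i%:R * h) + h by ring.
rewrite !mulrDr; norm_lra.
Qed.

(** The two bounds have to be proved together: the speed [c] is bounded only while [u] stays near
    its initial value, and the control of [u] comes from the chain itself. The extra 1 in [C + 1]
    and [G + 1] absorbs the error [h] of each step. *)
Lemma euler_apriori (R : realType) (c u g : R * R -> R) (G C T h x0 : R)
    (y : nat -> R) :
  0 < h -> (forall z, `|g z| <= G) -> y 0%N = x0 ->
  (forall t x, 0 <= t <= T -> `|u (t, x) - u (0, x0)| <= (G + 1) * T ->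
     `|c (t, x)| <= C) ->
  (forall k, k%:R * h <= T -> `|y k - x0| <= (C + 1) * T ->
     `|y k.+1 - y k - c (k%:R * h, y k) * h| <= h /\
     `|u (k.+1%:R * h, y k.+1) - u (k%:R * h, y k) - g (k%:R * h, y k) * h|
        <= h) ->
  forall k, k%:R * h <= T ->
    `|y k - x0| <= (C + 1) * (k%:R * h) /\
    `|u (k%:R * h, y k) - u (0, x0)| <= (G + 1) * (k%:R * h).
Proof.
move=> h0 HG y0 HC Hs; elim=> [|k IH]; rewrite ?mul0r ?mulr0.
  by rewrite y0 !subrr normr0.
rewrite -natr1 mulrDl mul1r => hk.
have kh0 : 0 <= k%:R * h by rewrite mulr_ge0 // ltW.
have [IH1 IH2] := IH (ltac:(lra)).
have G0 : 0 <= G by apply: le_trans (HG (0, 0)).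
have T0 : 0 <= T by lra.
have C0 : 0 <= C.
  apply: le_trans (HC 0 x0 _ _); rewrite ?subrr ?normr0 ?lexx //.
  by rewrite mulr_ge0 // addr_ge0.
have [||S1 S2] := Hs k; first by lra.
  by apply: le_trans IH1 _; rewrite ler_wpM2l; lra.
have cC : `|c (k%:R * h, y k)| <= C.
  apply: HC; first by lra.
  by apply: le_trans IH2 _; rewrite ler_wpM2l; lra.
have cCh : `|c (k%:R * h, y k) * h| <= C * h.
  by rewrite normrM (gtr0_norm h0) ler_wpM2r // ltW.
have gGh : `|g (k%:R * h, y k) * h| <= G * h.
  by rewrite normrM (gtr0_norm h0) ler_wpM2r // ltW.
rewrite -natr1 mulrDl mul1r in S2 *.
move: IH1 IH2 S1 S2 cCh gGh; split.
  move: IH1 S1 cCh; norm_lra.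
move: IH2 S2 gGh; norm_lra.
Qed.

Ltac only_lra := clear; norm_lra.

(** The claim compares the limit at two times only, so a cluster function valid at pairs of times
    suffices: a polygon close to [gam] at both times satisfies the estimate by telescoping over its
    steps, up to an arbitrarily small error. *)
Lemma euler_limit (R : realType) (c u g : R * R -> R) (G x0 : R) :
  continuous c -> continuous u -> continuous g -> (forall z, `|g z| <= G) ->
  (forall T, 0 <= T -> exists C : R, forall t x, 0 <= t <= T ->
     `|u (t, x) - u (0, x0)| <= (G + 1) * T -> `|c (t, x)| <= C) ->
  (forall A e : R, 0 < e -> exists2 h0 : R, 0 < h0 & forall h, 0 < h <= h0 ->
     forall t x, 0 <= t <= A -> `|x - x0| <= A -> exists x',
       `|x' - x - c (t, x) * h| <= e * h /\
       `|u (t + h, x') - u (t, x) - g (t, x) * h| <= e * h) ->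
  exists gam : R -> R, gam 0 = x0 /\ forall t, 0 <= t -> forall e : R, 0 < e ->
    exists2 r : R, 0 < r & forall s, 0 <= s -> `|s - t| < r ->
      `|gam s - gam t - c (t, gam t) * (s - t)| <= e * `|s - t| /\
      `|u (s, gam s) - u (t, gam t) - g (t, gam t) * (s - t)| <= e * `|s - t|.
Proof.
move=> cc cu cg HG HT Hstep.
have /choice[C HC] : forall T : R, exists C : R, 0 <= T -> forall t x, 0 <= t <= T ->
     `|u (t, x) - u (0, x0)| <= (G + 1) * T -> `|c (t, x)| <= C.
  move=> T; have [T0|] := boolP (0 <= T); last by exists 0.
  by have [C HC] := HT T T0; exists C.
pose ee (n : nat) : R := n.+1%:R^-1.
have ee0 n : 0 < ee n by rewrite invr_gt0 ltr0n.
have ee1 n : ee n <= 1 by rewrite invf_le1 ?ltr0n // ler1n.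
(* The mesh is at most [ee n], and one-step accuracy is required up to time [n] and as far in space
   as the a priori bound lets a polygon travel by then. *)
have /choice[hh Hhh] : forall n : nat, exists h, [/\ 0 < h, h <= ee n &
   forall t x, 0 <= t <= n%:R -> `|x - x0| <= (C n%:R + 1) * n%:R -> exists x',
       `|x' - x - c (t, x) * h| <= ee n * h /\
       `|u (t + h, x') - u (t, x) - g (t, x) * h| <= ee n * h].
  move=> n; have [h0 h00 H] := Hstep (n%:R + `|C n%:R + 1| * n%:R) _ (ee0 n).
  exists (Num.min h0 (ee n)); split.
  - by rewrite lt_min h00 ee0.
  - by rewrite ge_min lexx orbT.
  - have P0 : 0 <= `|C n%:R + 1| * n%:R by rewrite mulr_ge0.
    have n0 : 0 <= n%:R :> R by [].
    move=> t x ht hx; apply: H; rewrite ?lt_min ?h00 ?ee0 ?ge_min ?lexx //; first by lra.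
    apply: le_trans hx _; apply: le_trans (_ : `|C n%:R + 1| * n%:R <= _); last by lra.
    by rewrite ler_wpM2r // ler_norm.
have hh0 n : 0 < hh n by have [] := Hhh n.
have hhe n : hh n <= ee n by have [] := Hhh n.
have /choice[y Hy] : forall n : nat, exists y : nat -> R, y 0%N = x0 /\
    forall k, k%:R * hh n <= n%:R -> `|y k - x0| <= (C n%:R + 1) * n%:R ->
     `|y k.+1 - y k - c (k%:R * hh n, y k) * hh n| <= ee n * hh n /\
     `|u (k.+1%:R * hh n, y k.+1) - u (k%:R * hh n, y k)
        - g (k%:R * hh n, y k) * hh n| <= ee n * hh n.
  move=> n.
  have /choice[nx Hnx] : forall p : nat * R, exists x', p.1%:R * hh n <= n%:R ->
     `|p.2 - x0| <= (C n%:R + 1) * n%:R ->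
     `|x' - p.2 - c (p.1%:R * hh n, p.2) * hh n| <= ee n * hh n /\
     `|u (p.1.+1%:R * hh n, x') - u (p.1%:R * hh n, p.2)
        - g (p.1%:R * hh n, p.2) * hh n| <= ee n * hh n.
    move=> [k x] /=.
    have [h1|] := boolP (k%:R * hh n <= n%:R); last by exists 0.
    have [h2|] := boolP (`|x - x0| <= (C n%:R + 1) * n%:R); last by exists 0.
    have [_ _ H] := Hhh n.
    have [|x' Hx'] := H (k%:R * hh n) x _ h2.
      by rewrite h1 andbT mulr_ge0 // ltW.
    by exists x' => _ _; rewrite -natr1 mulrDl mul1r.
  exists (nat_rect (fun _ => R) x0 (fun k x => nx (k, x))); split=> // k h1 h2.
  exact: (Hnx (k, _)).
have eeh n : ee n * hh n <= hh n by rewrite ler_piMl // ltW.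
have St n k : k%:R * hh n <= n%:R ->
     `|y n k.+1 - y n k - c (k%:R * hh n, y n k) * hh n| <= ee n * hh n /\
     `|u (k.+1%:R * hh n, y n k.+1) - u (k%:R * hh n, y n k)
        - g (k%:R * hh n, y n k) * hh n| <= ee n * hh n.
  move=> hk; have [y0 H] := Hy n; apply: (H) => //.
  have [||//|h1 _] := @euler_apriori R c u g G (C n%:R) n%:R (hh n) x0 (y n) (hh0 n) HG y0 _ _ k.
  - exact: HC.
  - by move=> {hk}k hk h1; have [h2 h3] := H k hk h1; split; [apply: le_trans h2 _|apply: le_trans h3 _].
  - apply: le_trans h1 _; rewrite ler_wpM2l // addr_ge0 //.
    apply: le_trans (HC n%:R _ 0 x0 _ _) => //; rewrite ?subrr ?normr0 ?lexx //=.
    by rewrite mulr_ge0 // addr_ge0 // (le_trans _ (HG (0, 0))).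
(* On a fixed horizon [T] the constant [C T] replaces [C n%:R], which makes the bounds uniform in
   [n]. *)
have Bd T n k : 0 <= T -> T <= n%:R -> k%:R * hh n <= T ->
    `|y n k - x0| <= (C T + 1) * (k%:R * hh n) /\
    `|u (k%:R * hh n, y n k) - u (0, x0)| <= (G + 1) * (k%:R * hh n).
  move=> T0 Tn; apply: euler_apriori => //; first by have [] := Hy n.
    exact: HC.
  move=> {}k hk _; have [|h2 h3] := St n k; first exact: le_trans Tn.
  by split; [apply: le_trans h2 _|apply: le_trans h3 _].

pose kk n t := Num.truncn (t / hh n).
have kkP n t : 0 <= t -> (kk n t)%:R * hh n <= t < (kk n t)%:R * hh n + hh n.
  move=> t0; have /truncn_itv : 0 <= t / hh n by rewrite divr_ge0 // ltW.
  by rewrite -/(kk n t) -natr1 ler_pdivlMr // ltr_pdivrMr // mulrDl mul1r.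
pose Y n t := y n (kk n t).
have [|gam Hgam] := @exists_pointwise_cluster R Y.
  move=> t t0; exists (`|x0| + (C t + 1) * ((C t + 1) * 0 + t)), (Num.truncn t).+1.
  move=> n tn; have /andP[k1 k2] := kkP n t t0.
  have tn' : t <= n%:R.
    by apply/ltW/(lt_le_trans (truncnS_gt t)); rewrite ler_nat.
  have [h1 _] := Bd t n (kk n t) t0 tn' k1.
  have C1 : 0 <= C t + 1.
    rewrite addr_ge0 //; apply: le_trans (HC t t0 0 x0 _ _) => //; rewrite ?subrr ?normr0 ?lexx //.
    by rewrite mulr_ge0 // addr_ge0 // (le_trans _ (HG (0, 0))).
  have : (C t + 1) * ((kk n t)%:R * hh n) <= (C t + 1) * t by rewrite ler_wpM2l.
  rewrite mulr0 add0r; have := ler_norm x0; have := ler_norm (- x0); rewrite normrN.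
  move: h1; rewrite -/(Y n t); only_lra.
exists gam; split.
  apply/eqP; rewrite -subr_eq0 -normr_le0; apply/ler_addgt0Pr => e e0.
  have [n [_ h1 _]] := Hgam 0 0 e 0%N (lexx _) (lexx _) e0.
  have y00 : Y n 0 = x0 by rewrite /Y /kk mul0r truncn0; have [] := Hy n.
  by rewrite add0r distrC -y00 ltW.
move=> t t0 e e0.
have t1 : 0 <= t + 1 by lra.
pose p := gam t; pose c0 := c (t, p); pose g0 := g (t, p).
have e2 : 0 < e / 2 by lra.
have /continuousP2/(_ _ e2)[rc rc0 Hc] := cc (t, p).
have /continuousP2/(_ _ e2)[rg rg0 Hg] := cg (t, p).
pose rho := Num.min rc rg; have rho0 : 0 < rho by rewrite lt_min rc0.
have rhoc : rho <= rc by rewrite ge_min lexx.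
have rhog : rho <= rg by rewrite ge_min lexx orbT.
pose L := C (t + 1) + 1.
have G0 : 0 <= G by apply: le_trans (HG (0, 0)).
have L1 : 1 <= L.
  rewrite lerDr; apply: le_trans (HC (t + 1) t1 0 x0 _ _) => //; rewrite ?subrr ?normr0 ?lexx //.
  by rewrite mulr_ge0 // addr_ge0.
have L0 : 0 < L by lra.
have rL0 : 0 < rho / (4 * L) by rewrite divr_gt0 // mulr_gt0.
have rLL : rho / (4 * L) * L = rho / 4 by field; rewrite gt_eqF.
(* The 1 keeps [s] below [t + 1], where polygons have speed at most [L]. The other term limits their
   travel during [r] to [rho / 4], which leaves room inside [rho] for the mesh and for the distance
   to the cluster function. *)
pose r := Num.min 1 (rho / (4 * L)).
have r0 : 0 < r by rewrite lt_min ltr01.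
have r1 : r <= 1 by rewrite ge_min lexx.
have rrL : r <= rho / (4 * L) by rewrite ge_min lexx orbT.
have rL4 : rho / (4 * L) <= rho / 4.
  by rewrite -rLL ler_peMr // ltW.
exists r => // s s0 st.
(* [r] depends on [t] and [e] only. The polygon is chosen after [s], at the price of a separate
   error [eta] that is then sent to 0. *)
suff main (eta : R) : 0 < eta ->
    `|gam s - gam t - c (t, gam t) * (s - t)| <= e * `|s - t| + eta /\
    `|u (s, gam s) - u (t, gam t) - g (t, gam t) * (s - t)| <= e * `|s - t| + eta.
  by split; apply/ler_addgt0Pr => eta /main[].
rewrite -/p -/c0 -/g0 => eta0.
have eta8 : 0 < eta / 8 by rewrite divr_gt0.
have /continuousP2/(_ _ eta8)[rs rs0 Hus] := cu (s, gam s).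
have /continuousP2/(_ _ eta8)[rt rt0 Hut] := cu (t, p).
(* Collects the coefficients of the mesh in the final estimate, where grid times stand in for [s]
   and [t]. *)
pose K := `|c0| + `|g0| + e + 1.
have K0 : 0 < K by rewrite ltr_wpDl // addr_ge0 ?addr_ge0 // ltW.
have eK0 : 0 < eta / (8 * K) by rewrite divr_gt0 // mulr_gt0.
pose mu := Num.min (Num.min (rho / 4) (eta / 8)) (Num.min rs rt).
have mu0 : 0 < mu by rewrite !lt_min eta8 rs0 rt0 !andbT divr_gt0.
have [mu1 mu2 mu3 mu4] : [/\ mu <= rho / 4, mu <= eta / 8, mu <= rs & mu <= rt].
  by rewrite /mu !ge_min !lexx !orbT.
clearbody mu.
pose nu := Num.min (Num.min (e / 2) (rho / (4 * L))) (Num.min (eta / (8 * K)) mu).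
have nu0 : 0 < nu by rewrite lt_min lt_min e2 rL0 lt_min eK0 mu0.
have [nu1 nu2 nu3 nu4] : [/\ nu <= e / 2, nu <= rho / (4 * L), nu <= eta / (8 * K) & nu <= mu].
  by rewrite /nu !ge_min !lexx !orbT.
pose N := maxn (Num.truncn (t + 1)).+1 (Num.truncn (nu^-1)).+1.
have [n [Nn ns nt]] := Hgam s t mu N s0 t0 mu0.
have tn : t + 1 <= n%:R.
  apply/ltW/(lt_le_trans (truncnS_gt (t + 1))); rewrite ler_nat.
  by apply: leq_trans Nn; rewrite leq_maxl.
have een : ee n <= nu.
  rewrite -[nu]invrK lef_pV2 ?posrE ?ltr0n ?invr_gt0 //.
  apply/ltW/(lt_le_trans (truncnS_gt _)); rewrite ler_nat.
  by apply: (leq_trans _ (leqW Nn)); rewrite leq_maxr.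
have hn : hh n <= nu by apply: le_trans een.
have h0 := hh0 n.
pose h := hh n; rewrite -/h in hn h0.
have /andP[ks1 ks2] := kkP n s s0; have /andP[kt1 kt2] := kkP n t t0.
pose i_s := kk n s; pose i_t := kk n t; rewrite -/i_s -/i_t -/h in ks1 ks2 kt1 kt2.
have lip i j : (i <= j)%N -> j%:R * h <= t + 1 ->
    `|y n j - y n i| <= L * (j%:R * h - i%:R * h).
  move=> ij hj; rewrite -[X in `|X|]subr0 -[X in `|_ - X|](mul0r (j%:R * h - i%:R * h)).
  apply: telescope_le => // k /andP[_ kj].
  have hk : k%:R * h <= t + 1.
    by apply: le_trans hj; rewrite ler_wpM2r ?ler_nat ?(ltW h0) // ltnW.
  have [S1 _] := St n k (le_trans hk tn).
  have [_ B2] := Bd (t + 1) n k t1 tn hk.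
  have cC : `|c (k%:R * h, y n k)| <= C (t + 1).
    apply: HC => //; first by rewrite hk andbT mulr_ge0 // ltW.
    by apply: le_trans B2 _; rewrite ler_wpM2l // addr_ge0.
  have : `|c (k%:R * h, y n k) * h| <= C (t + 1) * h.
    by rewrite normrM (gtr0_norm h0) ler_wpM2r // ltW.
  have : ee n * h <= h := eeh n.
  move: S1; rewrite -/h mul0r /L mulrDl mul1r; only_lra.
have tel i j : (i <= j)%N ->
   (forall k, (i <= k < j)%N -> [/\ k%:R * h <= n%:R, `|k%:R * h - t| < rho & `|y n k - p| < rho]) ->
   `|y n j - y n i - c0 * (j%:R * h - i%:R * h)| <= e * (j%:R * h - i%:R * h) /\
   `|u (j%:R * h, y n j) - u (i%:R * h, y n i) - g0 * (j%:R * h - i%:R * h)|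
      <= e * (j%:R * h - i%:R * h).
  move=> ij Hk; split.
    apply: telescope_le => // k /Hk[k1 k2 k3].
    have [S1 _] := St n k k1.
    have : `|(c (k%:R * h, y n k) - c0) * h| <= e / 2 * h.
      rewrite normrM (gtr0_norm h0); apply: ler_wpM2r; first exact: ltW.
      by apply: Hc; exact: lt_le_trans rhoc.
    have : ee n * h <= e / 2 * h by rewrite ler_wpM2r ?(ltW h0) // (le_trans een).
    have -> : e * h = e / 2 * h + e / 2 * h by field.
    move: S1; rewrite -/h mulrBl; only_lra.
  apply: (@telescope_le _ (fun k => u (k%:R * h, y n k))) => // k /Hk[k1 k2 k3].
  have [_ S1] := St n k k1.
  have : `|(g (k%:R * h, y n k) - g0) * h| <= e / 2 * h.
    rewrite normrM (gtr0_norm h0); apply: ler_wpM2r; first exact: ltW.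
      by apply: Hg; exact: lt_le_trans rhog.
  have : ee n * h <= e / 2 * h by rewrite ler_wpM2r ?(ltW h0) // (le_trans een).
  have -> : e * h = e / 2 * h + e / 2 * h by field.
    move: S1; rewrite -/h mulrBl; only_lra.
have tst : s <= t + 1 by move: st r1; only_lra.
have near k : (minn i_s i_t <= k <= maxn i_s i_t)%N ->
    [/\ k%:R * h <= n%:R, `|k%:R * h - t| < rho & `|y n k - p| < rho].
  move=> /andP[k1 k2].
  have kb : Num.min (i_s%:R * h) (i_t%:R * h) <= k%:R * h <= Num.max (i_s%:R * h) (i_t%:R * h).
    rewrite ge_min le_max !ler_pM2r // !ler_nat; move: k1 k2; rewrite geq_min leq_max => -> ->; exact: isT.
  have kht : `|k%:R * h - t| <= r + h.
    move: kb st ks1 ks2 kt1 kt2; rewrite ge_min le_max => /andP[/orP[]+ /orP[]+]; only_lra.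
  have kl : k%:R * h <= t + 1.
    move: kb ks1 kt1 tst; rewrite le_max => /andP[_ /orP[]]; only_lra.
  have kit : `|y n k - y n i_t| <= L * `|k%:R * h - i_t%:R * h|.
    have [/[dup] ki|/ltnW/[dup] ki] := leqP k i_t.
      rewrite -(ler_nat R) -(ler_pM2r h0) => ki'.
      rewrite distrC [`|k%:R * h - _|]distrC [X in _ <= _ * X]ger0_norm ?subr_ge0 //.
      apply: lip => //; by apply: (le_trans kt1); rewrite lerDl.
    rewrite -(ler_nat R) -(ler_pM2r h0) => ki'.
    by rewrite [X in _ <= _ * X]ger0_norm ?subr_ge0 //; apply: lip.
  have b1 : L * `|k%:R * h - i_t%:R * h| <= L * (r + h).
    apply: ler_wpM2l; first exact: ltW.
    move: kb st ks1 ks2 kt1 kt2; rewrite ge_min le_max => /andP[/orP[]+ /orP[]+]; only_lra.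
  have b2 : L * (r + h) <= rho / 4 + rho / 4.
    by rewrite mulrDr -rLL ![L * _]mulrC lerD // ler_wpM2r ?(ltW L0) // (le_trans hn).
  split; [exact: le_trans kl tn | move: kht rrL rL4 nu2 hn rho0; only_lra |].
  move: kit b1 b2 nt mu1; rewrite /Y -/i_t -/p; only_lra.
have both : `|y n i_s - y n i_t - c0 * (i_s%:R * h - i_t%:R * h)| <= e * `|i_s%:R * h - i_t%:R * h| /\
   `|u (i_s%:R * h, y n i_s) - u (i_t%:R * h, y n i_t) - g0 * (i_s%:R * h - i_t%:R * h)|
      <= e * `|i_s%:R * h - i_t%:R * h|.
  have [/[dup] ki|/ltnW/[dup] ki] := leqP i_t i_s.
    rewrite -(ler_nat R) -(ler_pM2r h0) => ki'.
    rewrite (@ger0_norm _ (i_s%:R * h - i_t%:R * h)) ?subr_ge0 //; apply: tel => // k /andP[k1 k2]; apply: near.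
    by rewrite geq_min leq_max k1 orbT (ltnW k2).
  rewrite -(ler_nat R) -(ler_pM2r h0) => ki'.
  rewrite (@ler0_norm _ (i_s%:R * h - i_t%:R * h)) ?subr_le0 //.
  have [|T1 T2] := tel i_s i_t ki.
    by move=> k /andP[k1 k2]; apply: near; rewrite geq_min leq_max k1 (ltnW k2) orbT.
  split; [move: T1 | move: T2]; rewrite !mulrBr; only_lra.
have hst : `|(i_s%:R * h - i_t%:R * h) - (s - t)| <= h by move: ks1 ks2 kt1 kt2; only_lra.
have ch : `|c0 * ((i_s%:R * h - i_t%:R * h) - (s - t))| <= `|c0| * h.
  by rewrite normrM ler_wpM2l.
have gh : `|g0 * ((i_s%:R * h - i_t%:R * h) - (s - t))| <= `|g0| * h.
  by rewrite normrM ler_wpM2l.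
have eh : e * `|i_s%:R * h - i_t%:R * h| <= e * `|s - t| + e * h.
  rewrite -mulrDr; apply: ler_wpM2l; first exact: ltW.
  have -> : i_s%:R * h - i_t%:R * h = (s - t) + ((i_s%:R * h - i_t%:R * h) - (s - t)) by ring.
  by apply: le_trans (ler_normD _ _) _; rewrite lerD2l.
have Kh : K * h <= eta / 8.
  apply: le_trans (_ : K * (eta / (8 * K)) <= _).
    by rewrite ler_wpM2l ?(ltW K0) // (le_trans hn).
  by rewrite le_eqVlt; apply/orP; left; apply/eqP; field; rewrite gt_eqF.
have KE : K * h = `|c0| * h + `|g0| * h + e * h + h by rewrite /K; ring.
have ch0 : 0 <= `|c0| * h by rewrite mulr_ge0 // ltW.
have gh0 : 0 <= `|g0| * h by rewrite mulr_ge0 // ltW.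
have eh0 : 0 <= e * h by rewrite mulr_ge0 // ltW.
have us : `|u (i_s%:R * h, y n i_s) - u (s, gam s)| <= eta / 8.
  by apply: Hus; [move: ks1 ks2 hn nu4 mu3 h0; only_lra | exact: lt_le_trans mu3].
have ut : `|u (i_t%:R * h, y n i_t) - u (t, p)| <= eta / 8.
  by apply: Hut; [move: kt1 kt2 hn nu4 mu4 h0; only_lra | exact: lt_le_trans mu4].
case: both => b1 b2; split.
  move: b1 ch ns nt; rewrite /Y -/i_s -/i_t -/p !mulrBr.
  move: eh KE Kh ch0 gh0 eh0 mu2 h0; only_lra.
move: b2 gh us ut; rewrite !mulrBr.
move: eh KE Kh ch0 gh0 eh0 h0 eta0; only_lra.
Qed.

(** * Trajectories of a continuous speed, and calculus along them *)

Lemma has_deriv_glue (R : realType) (F1 F2 : R -> R) (t : R) (d1 d2 : R -> R) :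
  (forall t, 0 <= t -> forall e : R, 0 < e -> exists2 r : R, 0 < r & forall s,
     0 <= s -> `|s - t| < r -> `|F1 s - F1 t - d1 t * (s - t)| <= e * `|s - t|) ->
  (forall t, 0 <= t -> forall e : R, 0 < e -> exists2 r : R, 0 < r & forall s,
     0 <= s -> `|s - t| < r -> `|F2 s - F2 t - d2 t * (s - t)| <= e * `|s - t|) ->
  F1 0 = F2 0 -> d1 0 = - d2 0 ->
  has_deriv (fun s => if 0 <= s then F1 s else F2 (- s)) t
            (if 0 <= t then d1 t else - d2 (- t)).
Proof.
move=> H1 H2 E D e e0; case: ifPn => [t0|]; last first.
  rewrite -ltNge => t0; have [|r r0 {}H2] := H2 (- t) _ e e0; first by lra.
  exists (Num.min r (- t)); first by rewrite lt_min r0; lra.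
  move=> s; rewrite lt_min => /andP[h1 h2].
  have s0 : s < 0 by move: h2; norm_lra.
  rewrite [0 <= s]leNgt s0 /=; have := H2 (- s).
  have -> : - s - - t = - (s - t) by ring.
  by rewrite normrN mulrN mulNr; apply => //; lra.
have [r r0 {}H1] := H1 t t0 e e0.
have [tE|t1] := eqVneq t 0.
  have [r2 r20 {}H2] := H2 0 (lexx _) e e0.
  exists (Num.min r r2); first by rewrite lt_min r0.
  move=> s; rewrite lt_min => /andP[h1 h2]; case: ifPn => s0; first exact: H1.
  have := H2 (- s); rewrite tE E D !subr0 normrN mulrN mulNr in h2 *.
  by apply => //; lra.
exists (Num.min r t); first by rewrite lt_min r0 lt_neqAle eq_sym t1.
move=> s; rewrite lt_min => /andP[h1 h2].
have s0 : 0 <= s by move: h2; norm_lra.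
by rewrite s0; exact: H1.
Qed.

(** With [u] and [g] replaced by 0, the polygon construction merely follows the speed, and
    boundedness makes the trajectory global. A straight line of slope [a (0, x0)] is attached for
    negative times, so that the derivative at 0 is two-sided. *)
Lemma peano (R : realType) (a : R * R -> R) (C x0 : R) :
  continuous a -> (forall z, `|a z| <= C) ->
  exists X : R -> R, [/\ X 0 = x0, continuous X &
    forall t, 0 <= t -> has_deriv X t (a (t, X t))].
Proof.
move=> ca aC.
have c0 : continuous (fun _ : R * R => 0 : R) by move=> z; exact: cvg_cst.
have [|||X [X0 HX]] := @euler_limit R a (fun=> 0) (fun=> 0) 0 x0 ca c0 c0.
- by move=> z; rewrite normr0.
- by move=> T T0; exists C.
- move=> A e e0; exists 1 => // h /andP[h0 _] t x _ _; exists (x + a (t, x) * h).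
  have -> : x + a (t, x) * h - x - a (t, x) * h = 0 by ring.
  by rewrite mul0r !subr0 normr0 mulr_ge0 // ltW.
pose F2 s := x0 - a (0, x0) * s.
pose F s := if 0 <= s then X s else F2 (- s).
have dF t : has_deriv F t (if 0 <= t then a (t, X t) else - - a (0, x0)).
  apply: (@has_deriv_glue R X F2 t (fun t => a (t, X t)) (fun=> - a (0, x0))).
  - by move=> {}t t0 e e0; have [r r0 H] := HX t t0 e e0; exists r => // s s0 /(H s s0)[].
  - move=> {}t t0 e e0; exists 1 => // s s0 _.
    have -> : F2 s - F2 t - - a (0, x0) * (s - t) = 0 by rewrite /F2; ring.
    by rewrite normr0 mulr_ge0 // ltW.
  - by rewrite X0 /F2 mulr0 subr0.
  - by rewrite X0 opprK.
exists F; split.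
- by rewrite /F lexx.
- by move=> t; exact: has_deriv_cont (dF t).
- move=> t t0; have -> : F t = X t by rewrite /F ifT.
  by have := dF t; rewrite ifT.
Qed.

Lemma first_zero (R : realType) (F : R -> R) (b : R) :
  continuous F -> 0 <= b -> 0 < F 0 -> F b <= 0 ->
  exists t, [/\ 0 < t <= b, F t = 0 & forall s, 0 <= s < t -> 0 < F s].
Proof.
move=> cF b0 F0 Fb.
pose S := [set t | 0 <= t <= b /\ forall s, 0 <= s <= t -> 0 < F s].
have S0 : S 0 by split; [lra | move=> s hs; have -> : s = 0 by lra].
have supS : has_sup S by split; [exists 0 | exists b => t [/andP[]]].
pose c := sup S.
have c0 : 0 <= c by exact: ub_le_sup supS.2 _ S0.
have cb : c <= b by apply: ge_sup; [exists 0 | move=> t [/andP[]]].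
have below s : 0 <= s < c -> 0 < F s.
  move=> /andP[h1 h2].
  have /(sup_adherent)/(_ supS)[t [tab Ht]] : 0 < c - s by rewrite subr_gt0.
  by rewrite -/c => h3; apply: Ht; lra.
have Fc0 : F c <= 0.
  rewrite leNgt; apply/negP => Fc.
  have Fc2 : 0 < F c / 2 by lra.
  have /continuousP1/(_ _ Fc2)[r r0 Hr] := cF c.
  have cltb : c < b.
    by rewrite lt_neqAle cb andbT; apply/eqP => E; rewrite E in Fc; lra.
  pose d := Num.min (r / 2) (b - c).
  have d0 : 0 < d by rewrite lt_min; apply/andP; split; lra.
  have dr : d <= r / 2 by rewrite ge_min lexx.
  have dbc : d <= b - c by rewrite ge_min lexx orbT.
  suff : S (c + d) by move=> /(ub_le_sup supS.2); rewrite -/c; lra.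
  split; first by lra.
  move=> s hs; have [h1|h1] := ltP s c; first by apply: below; lra.
  have : `|F s - F c| <= F c / 2 by apply: Hr; rewrite ltr_norml; lra.
  move: Fc; only_lra.
have cgt0 : 0 < c.
  by rewrite lt_neqAle c0 andbT; apply/eqP => E; rewrite -E in Fc0; lra.
exists c; split => //; first by rewrite cgt0.
apply/eqP; rewrite eq_le Fc0 /= leNgt; apply/negP => Fc.
have Fc2 : 0 < - F c / 2 by lra.
have /continuousP1/(_ _ Fc2)[r r0 Hr] := cF c.
pose s := Num.max 0 (c - r / 2).
have hs : 0 <= s < c by rewrite le_max lexx /= gt_max; apply/andP; split; lra.
have : c - r / 2 <= s by rewrite le_max lexx orbT.
move=> hs'; have : `|F s - F c| <= - F c / 2 by apply: Hr; rewrite ltr_norml; lra.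
have := below s hs; move: Fc; only_lra.
Qed.

(** The increment is split at the corner [(s, X t)]: first time at the fixed abscissa [X t], then
    space at time [s], where continuity of [u] makes the spatial increment linear to first order
    with slope [u (t, X t)]. *)
Lemma chain_rule2 (R : realType) (V u : R * R -> R) (X : R -> R) (t w x' : R) :
  (forall s x, has_deriv (fun y => V (s, y)) x (u (s, x))) -> continuous u ->
  has_deriv (fun s => V (s, X t)) t w -> has_deriv X t x' ->
  has_deriv (fun s => V (s, X s)) t (w + u (t, X t) * x').
Proof.
move=> Vx cu Vt dX e e0.
set p := X t in Vt *; set z := u (t, p).
(* [d * K] is the total error rate: [|x'| + 1] from the spatial increment, [|z|] from linearising
   [X], and 1 from the time increment. *)
pose K := `|x'| + `|z| + 2.
have K0 : 0 < K by rewrite ltr_wpDl // addr_ge0.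
have K2 : 2 <= K by rewrite lerDr addr_ge0.
pose d := Num.min 1 (e / (3 * K)).
have eK0 : 0 < e / (3 * K) by rewrite divr_gt0 // mulr_gt0.
have d0 : 0 < d by rewrite lt_min ltr01.
have d1 : d <= 1 by rewrite ge_min lexx.
have dK : d * K <= e / 3.
  apply: le_trans (_ : e / (3 * K) * K <= _).
    by apply: ler_wpM2r; [exact: ltW | rewrite ge_min lexx orbT].
  by rewrite le_eqVlt; apply/orP; left; apply/eqP; field; rewrite gt_eqF.
have [r1 r10 H1] := Vt d d0.
have [r2 r20 H2] := dX d d0.
have /continuousP2/(_ _ d0)[r3 r30 H3] := cu (t, p).
pose r := Num.min (Num.min r1 r2) (Num.min r3 (r3 / K)).
have r0 : 0 < r by rewrite !lt_min r10 r20 r30 divr_gt0.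
exists r => // s; rewrite !lt_min => /andP[/andP[s1 s2] /andP[s3 s4]].
have Xs : `|X s - p| <= (`|x'| + 1) * `|s - t|.
  have h := H2 s s2.
  have -> : X s - p = (X s - X t - x' * (s - t)) + x' * (s - t) by rewrite /p; ring.
  apply: le_trans (ler_normD _ _) _; rewrite mulrDl addrC [`|x' * _|]normrM lerD //.
  by apply: le_trans h _; apply: ler_wpM2r.
have Xs3 : `|X s - p| < r3.
  apply: (le_lt_trans Xs); apply: (@le_lt_trans _ _ (K * `|s - t|)).
    by apply: ler_wpM2r => //; rewrite /K; have := normr_ge0 z; lra.
  by rewrite mulrC -ltr_pdivlMr.
have h1 := H1 s s1.
have h2 : `|(V (s, X s) - z * X s) - (V (s, p) - z * p)| <= d * `|X s - p|.
  apply: (@MVT_abs _ (fun y => V (s, y) - z * y) (fun y => u (s, y) - z)) => x hx.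
    apply: has_derivB; first exact: Vx.
    by apply: (has_deriv_eq (has_derivM (has_deriv_cst z _) (has_deriv_id _))); rewrite mul0r add0r mulr1.
  by apply: H3 => //; move: hx Xs3 => /orP[]; only_lra.
have h3 : `|z * (X s - X t - x' * (s - t))| <= `|z| * (d * `|s - t|).
  by rewrite normrM; apply: ler_wpM2l => //; exact: H2.
have h4 : d * `|X s - p| <= d * ((`|x'| + 1) * `|s - t|).
  by apply: ler_wpM2l Xs; exact: ltW.
have h5 : d * ((`|x'| + 1) * `|s - t|) + `|z| * (d * `|s - t|) + d * `|s - t| <= e * `|s - t|.
  have -> : d * ((`|x'| + 1) * `|s - t|) + `|z| * (d * `|s - t|) + d * `|s - t| = (d * K) * `|s - t|.
    by rewrite /K; ring.
  by apply: ler_wpM2r => //; move: dK e0; only_lra.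
move: h1 h2 h3 h4 h5; rewrite -/p.
have -> : V (s, X s) - V (t, p) - (w + z * x') * (s - t) =
  (V (s, p) - V (t, p) - w * (s - t)) + (V (s, X s) - z * X s - (V (s, p) - z * p)) +
  z * (X s - p - x' * (s - t)) by ring.
only_lra.
Qed.

(** Each difference quotient is a value of [f'] at an intermediate point, so extending it by [f'] on
    the diagonal keeps it continuous. The same fact transfers bounds on [f'] to [Q]. *)
Lemma divided_difference (R : realType) (f f' : R -> R) :
  (forall x, has_deriv f x (f' x)) -> continuous f' ->
  exists Q : R * R -> R, [/\ continuous Q,
    forall x y, f x - f y = Q (x, y) * (x - y) &
    forall x y, exists2 z, (x <= z <= y) || (y <= z <= x) & Q (x, y) = f' z].
Proof.
move=> df cf'.
pose Q (z : R * R) := if z.1 == z.2 then f' z.1 else (f z.1 - f z.2) / (z.1 - z.2).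
have QM x y : exists2 z, (x <= z <= y) || (y <= z <= x) & Q (x, y) = f' z.
  rewrite /Q /=; case: eqVneq => [<-|xy]; first by exists x => //; rewrite lexx.
  have /orP[le|le] := le_total x y.
    have [z hz E] := MVT_has_deriv le (fun t _ => df t).
    exists z; first by rewrite hz.
    by rewrite -[f x - f y]opprB E -mulrN opprB mulfK // subr_eq0.
  have [z hz E] := MVT_has_deriv le (fun t _ => df t).
  by exists z; [rewrite hz orbT | rewrite E mulfK // subr_eq0].
exists Q; split => //; last first.
  move=> x y; rewrite /Q /=; case: eqVneq => [->|xy]; first by rewrite !subrr mulr0.
  by rewrite divfK // subr_eq0.
have cf x : {for x, continuous f} by exact: has_deriv_cont (df x).
move=> [x y]; apply/continuousP2 => e e0; have [xy|xy] := eqVneq x y.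
  have /continuousP1/(_ _ e0)[r r0 H] := cf' x.
  exists r => // s t; rewrite -xy => sx tx.
  have [z hz ->] := QM s t; have -> : Q (x, x) = f' x by rewrite /Q /= eqxx.
  apply: H; move: hz sx tx => /orP[]; only_lra.
have : {for (x, y), continuous (fun z : R * R => (f z.1 - f z.2) / (z.1 - z.2))}.
  apply: cvgM; last first.
    apply: cvgV; first by rewrite subr_eq0.
    by apply: cvgB; [exact: cvg_fst | exact: cvg_snd].
  have c1 : {for (x, y), continuous (fun z : R * R => f z.1)}.
    apply/continuousP2 => e1 e10; have /continuousP1/(_ _ e10)[r r0 H] := cf x.
    by exists r => // s t sx _; exact: H.
  have c2 : {for (x, y), continuous (fun z : R * R => f z.2)}.
    apply/continuousP2 => e1 e10; have /continuousP1/(_ _ e10)[r r0 H] := cf y.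
    by exists r => // s t _ ty; exact: H.
  exact: cvgB c1 c2.
move/continuousP2 => /(_ _ e0)[r r0 H].
(* Within this radius of an off-diagonal point the diagonal is not reached, so the quotient formula
   persists. *)
have d0 : 0 < `|x - y| / 2 by rewrite divr_gt0 // normr_gt0 subr_eq0.
exists (Num.min r (`|x - y| / 2)); first by rewrite lt_min r0.
move=> s t; rewrite !lt_min => /andP[s1 s2] /andP[t1 t2].
rewrite /Q /= (negbTE xy) ifF; first exact: H.
apply/negbTE/eqP => st; rewrite st in s2.
have : `|x - y| <= `|t - x| + `|t - y| by rewrite distrC [`|t - y|]distrC; move: (ler_distD t x y);
  rewrite [`|y - x|]distrC [`|y - t|]distrC [`|x - t|]distrC.
lra.
Qed.

(** * From a potential to characteristics *)

Definition potential (R : realType) (f : R -> R) (u g V M : R * R -> R) : Prop :=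
  [/\ forall t x, has_deriv (fun y => V (t, y)) x (u (t, x)),
      forall t x, has_deriv (fun s => V (s, x)) t (M (t, x) - f (u (t, x))) &
      forall t x, has_deriv (fun y => M (t, y)) x (g (t, x))].

Definition clamp (R : realType) (a b x : R) : R := Num.max a (Num.min b x).

Lemma clamp_itv (R : realType) (a b x : R) : a <= b -> a <= clamp a b x <= b.
Proof. by move=> ab; rewrite /clamp le_max lexx /= ge_max ab ge_min lexx. Qed.

Lemma clamp_id (R : realType) (a b x : R) : a <= x <= b -> clamp a b x = x.
Proof.
by move=> /andP[ax xb]; rewrite /clamp (min_idPr xb) (max_idPr ax).
Qed.

Lemma clamp_lipschitz (R : realType) (a b x y : R) :
  `|clamp a b x - clamp a b y| <= `|x - y|.
Proof.
rewrite /clamp !maxElt !minElt.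
have := ler_norm (x - y); have := ler_norm (y - x); rewrite [`|y - x|]distrC.
by do ?[case: ifPn]; rewrite -?leNgt; only_lra.
Qed.

Lemma continuous_clamp (R : realType) (F : R * R -> R) (a b : R) :
  continuous F -> continuous (fun z => clamp a b (F z)).
Proof.
move=> cF [t x]; apply/continuousP2 => e e0.
have /continuousP2/(_ _ e0)[r r0 H] := cF (t, x).
by exists r => // s y st yx; apply: le_trans (clamp_lipschitz _ _ _ _) (H s y st yx).
Qed.

Lemma continuous_comp2 (R : realType) (Q F1 F2 : R * R -> R) :
  continuous Q -> continuous F1 -> continuous F2 ->
  continuous (fun z => Q (F1 z, F2 z)).
Proof.
move=> cQ c1 c2 [t x]; apply/continuousP2 => e e0.
have /continuousP2/(_ _ e0)[r r0 H] := cQ (F1 (t, x), F2 (t, x)).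
have r20 : 0 < r / 2 by lra.
have /continuousP2/(_ _ r20)[r1 r10 H1] := c1 (t, x).
have /continuousP2/(_ _ r20)[r2 r20' H2] := c2 (t, x).
exists (Num.min r1 r2); first by rewrite lt_min r10.
move=> s y; rewrite !lt_min => /andP[s1 s2] /andP[y1 y2].
apply: H; [apply: le_lt_trans (H1 _ _ s1 y1) _ | apply: le_lt_trans (H2 _ _ s2 y2) _]; lra.
Qed.

(* Were the conclusion false, two trajectories X1 < X2 of the speed
   (f(u) - f(s)) / (u - s), with s t = z0 + e h / 2 + (g0 + e / 2) t, would have
   D t = [V(t, x) - s t * x] between x = X1 t and x = X2 t nonincreasing while D 0 < 0 < D h.
   They cannot meet, since D would vanish there. *)
Lemma no_overshoot (R : realType) (f f' : R -> R) (u g V M : R * R -> R)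
    (x0 h e eta : R) :
  (forall x, has_deriv f x (f' x)) -> continuous f' -> continuous u ->
  potential f u g V M ->
  0 < h -> 0 < e -> let z0 := u (0, x0) in
  (forall t x, 0 <= t <= h -> `|x - x0| <= (`|f' z0| + e) * h ->
     `|u (t, x) - z0| <= eta /\ `|g (t, x) - g (0, x0)| <= e / 2) ->
  (forall z, `|z - z0| <= eta -> `|f' z - f' z0| <= e / 2) ->
  (`|g (0, x0)| + e) * h <= eta ->
  exists2 x', `|x' - x0 - f' z0 * h| <= e * h &
    u (h, x') <= z0 + (g (0, x0) + e) * h.
Proof.
move=> df cf' cu [Vx Vt Mx] h0 e0 z0 Hbox Hf Heta.
set c0 := f' z0 in Hbox Hf *; set g0 := g (0, x0) in Hbox Heta *.
apply: contrapT => Hno.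
have over x : `|x - x0 - c0 * h| <= e * h -> z0 + (g0 + e) * h < u (h, x).
  by move=> hx; rewrite ltNge; apply/negP => hu; apply: Hno; exists x.
have eh0 : 0 < e * h by rewrite mulr_gt0.
pose s t := z0 + e * h / 2 + (g0 + e / 2) * t.
have eh4 : 0 < e * h / 4 by lra.
have /continuousP2/(_ _ eh4)[r r0 Hr] := cu (0, x0).
(* [r / 2] keeps [u (0, x)] below [s 0] between the two starting points, so that [D] starts negative
   there. [e * h / 2], added to a drift error of at most the same size, keeps both trajectories
   within [e * h] of [x0 + c0 * h] at time [h]. *)
pose rho := Num.min (r / 2) (e * h / 2).
have rho0 : 0 < rho by rewrite lt_min; apply/andP; split; lra.
have rhor : rho <= r / 2 by rewrite ge_min lexx.
have rhoe : rho <= e * h / 2 by rewrite ge_min lexx orbT.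
have eta0 : 0 <= eta by apply: le_trans Heta; rewrite mulr_ge0 ?addr_ge0 // ltW.
have [Q [cQ QE QM]] := divided_difference df cf'.
have z0E : z0 - eta <= z0 + eta by lra.
pose cl := clamp (z0 - eta) (z0 + eta).
(* Clamping bounds the speed on the whole plane, as [peano] requires. Along the trajectories up to
   time [h] both arguments lie in the clamping interval, so there it is the true chord speed. *)
pose a (z : R * R) := Q (cl (u z), cl (s z.1)).
have cs : continuous (fun z : R * R => s z.1).
  move=> z; apply: cvgD; first exact: cvg_cst.
  by apply: cvgM; [exact: cvg_cst | exact: cvg_fst].
have ca : continuous a.
  by apply: continuous_comp2 => //; [exact: continuous_clamp | exact: (continuous_clamp cs)].
have ac0 z : `|a z - c0| <= e / 2.
  rewrite /a; have [w hw ->] := QM (cl (u z)) (cl (s z.1)); apply: Hf.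
  have := clamp_itv (u z) z0E; have := clamp_itv (s z.1) z0E.
  by rewrite -!/(cl _); move: hw => /orP[]; only_lra.
have aC z : `|a z| <= `|c0| + e.
  have -> : a z = c0 + (a z - c0) by ring.
  by apply: le_trans (ler_normD _ _) _; have := ac0 z; lra.
have [X1 [X10 cX1 dX1]] := peano (x0 - rho) ca aC.
have [X2 [X20 cX2 dX2]] := peano (x0 + rho) ca aC.
have drift X y : X 0 = y -> (forall t, 0 <= t -> has_deriv X t (a (t, X t))) ->
    forall t, 0 <= t -> `|X t - y - c0 * t| <= e / 2 * t.
  move=> Xy dX t t0.
  have : `|(X t - c0 * t) - (X 0 - c0 * 0)| <= e / 2 * `|t - 0|.
    apply: (@MVT_abs _ (fun t => X t - c0 * t) (fun t => a (t, X t) - c0)) => v hv.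
      apply: has_derivB; first by apply: dX; lra.
      by apply: (has_deriv_eq (has_derivM (has_deriv_cst c0 _) (has_deriv_id _))); rewrite mul0r add0r mulr1.
    exact: ac0.
  rewrite subr0 (ger0_norm t0) Xy mulr0 subr0.
  by have -> : X t - c0 * t - y = X t - y - c0 * t by ring.
have dr1 := drift X1 _ X10 dX1; have dr2 := drift X2 _ X20 dX2.
have e2t t : 0 <= t <= h -> 0 <= e / 2 * t <= e * h / 2.
  move=> /andP[t0 th]; have -> : e * h / 2 = e / 2 * h by field.
  have e20 : 0 <= e / 2 by lra.
  by rewrite mulr_ge0 //= ler_wpM2l.
have inbox X y t : `|y - x0| <= rho -> 0 <= t <= h -> `|X t - y - c0 * t| <= e / 2 * t ->
    `|X t - x0| <= (`|c0| + e) * h.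
  move=> hy ht hX; have : `|c0 * t| <= `|c0| * h.
    by move: ht => /andP[t0 th]; rewrite normrM (ger0_norm t0) ler_wpM2l.
  by move: hy hX (e2t t ht) rhoe; only_lra.
have r1 : `|x0 - rho - x0| <= rho by rewrite ler_norml; lra.
have r2 : `|x0 + rho - x0| <= rho by rewrite ler_norml; lra.
have sz t : 0 <= t <= h -> `|s t - z0| <= eta.
  move=> ht; have : `|g0 * t| <= `|g0| * h.
    by move: ht => /andP[t0 th]; rewrite normrM (ger0_norm t0) ler_wpM2l.
  by move: (e2t t ht) Heta; rewrite /s; only_lra.
pose D X t := V (t, X t) - s t * X t.
have dD X t : 0 <= t <= h -> `|X t - x0| <= (`|c0| + e) * h -> has_deriv X t (a (t, X t)) ->
    has_deriv (D X) t (M (t, X t) - f (s t) - (g0 + e / 2) * X t).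
  move=> ht hX dX; have ds : has_deriv s t (g0 + e / 2).
    rewrite /s;
      apply: (has_deriv_eq (has_derivD (has_deriv_cst _ _) (has_derivM (has_deriv_cst _ _) (has_deriv_id _)))).
    by rewrite mul0r !add0r mulr1.
  apply: (has_deriv_eq (has_derivB (chain_rule2 Vx cu (Vt _ _) dX) (has_derivM ds dX))).
  have [ub _] := Hbox t (X t) ht hX.
  (* The chord identity: it removes [u] from the derivative of [D], in which only [M], [s] and [X]
     remain. *)
  have aE : f (u (t, X t)) - f (s t) = a (t, X t) * (u (t, X t) - s t).
    rewrite QE /a /= /cl !clamp_id //; first by move: (sz t ht); clear; rewrite ler_norml; lra.
    by move: ub; clear; rewrite ler_norml; lra.
  by move/eqP: aE; rewrite subr_eq => /eqP ->; ring.
pose Delta t := D X2 t - D X1 t.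
have D0 : Delta 0 < 0.
  have le : X1 0 <= X2 0 by rewrite X10 X20; move: rho0; clear; lra.
  have [w hw E] := MVT_has_deriv le (fun t _ => Vx 0 t).
  have -> : Delta 0 = (u (0, w) - s 0) * (X2 0 - X1 0) by rewrite /Delta /D mulrBl -E; ring.
  have uw : `|u (0, w) - u (0, x0)| <= e * h / 4.
    apply: Hr; first by rewrite subrr normr0.
    by move: hw rhor r0; rewrite X10 X20; only_lra.
  rewrite nmulr_rlt0; first by rewrite X10 X20; move: rho0; clear; lra.
  by move: uw eh0; rewrite /s -/z0; only_lra.
have dDelta t : 0 <= t <= h -> has_deriv Delta t
   (M (t, X2 t) - M (t, X1 t) - (g0 + e / 2) * (X2 t - X1 t)).
  move=> ht; have /andP[t0 _] := ht.
  apply: (has_deriv_eq (has_derivB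
    (dD X2 t ht (inbox X2 _ t r2 ht (dr2 t t0)) (dX2 t t0))
    (dD X1 t ht (inbox X1 _ t r1 ht (dr1 t t0)) (dX1 t t0)))).
  by ring.
have decr t : 0 <= t <= h -> X1 t <= X2 t ->
    M (t, X2 t) - M (t, X1 t) - (g0 + e / 2) * (X2 t - X1 t) <= 0.
  move=> ht le; have /andP[t0 _] := ht.
  have [w hw E] := MVT_has_deriv le (fun x _ => Mx t x).
  rewrite E -mulrBl mulr_le0_ge0 ?subr_ge0 //.
  have [|_] := Hbox t w ht; last by rewrite -/g0; only_lra.
  have i1 := inbox X1 _ t r1 ht (dr1 t t0); have i2 := inbox X2 _ t r2 ht (dr2 t t0).
  by move: i1 i2 hw; only_lra.
have Delta_le t : 0 <= t <= h -> (forall v, 0 <= v <= t -> X1 v <= X2 v) -> Delta t < 0.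
  move=> ht Hle; have /andP[t0 _] := ht.
  have [w hw E] := @MVT_has_deriv _ Delta (fun t => M (t, X2 t) - M (t, X1 t) - (g0 + e / 2) *
    (X2 t - X1 t)) 0 t t0 (fun v hv => dDelta v (ltac:(move: hv ht; clear; lra))).
  have : Delta t - Delta 0 <= 0.
    by rewrite E mulr_le0_ge0 ?subr0 //; apply: decr; [move: hw ht; clear; lra | exact: Hle].
  by move: D0; clear; lra.
have ord t : 0 <= t <= h -> X1 t < X2 t.
  move=> ht; rewrite ltNge; apply/negP => le.
  have /andP[t0 th] := ht.
  have [|||v [vt E Hv]] := @first_zero R (fun v => X2 v - X1 v) t _ t0.
  - by move=> v; apply: cvgB; [exact: cX2 | exact: cX1].
  - by rewrite X10 X20; move: rho0; clear; lra.
  - by rewrite subr_le0.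
  have : Delta v < 0.
    apply: Delta_le; first by move: vt th; clear; lra.
    move=> w hw; have [wv|wv] := ltP w v.
      by have := Hv w; rewrite subr_gt0 => H; apply/ltW/H; move: hw wv; clear; lra.
    have -> : w = v by move: hw wv; only_lra.
    by rewrite -subr_ge0 E.
  have EX : X1 v = X2 v by move: E; only_lra.
  by rewrite /Delta /D EX subrr ltxx.
have hh : 0 <= h <= h by rewrite lexx ltW.
have : Delta h < 0 by apply: Delta_le => // v hv; exact/ltW/ord.
have h00 := ltW h0; have lt := ord h hh.
have [w hw E] := MVT_has_deriv (ltW lt) (fun t _ => Vx h t).
have -> : Delta h = (u (h, w) - s h) * (X2 h - X1 h) by rewrite /Delta /D mulrBl -E; ring.
rewrite ltNge mulr_ge0 //; last by rewrite subr_ge0 ltW.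
(* [s h] is exactly the value that [u] was assumed to exceed near the target point. *)
have := over w; rewrite /s => H; rewrite subr_ge0.
have -> : z0 + e * h / 2 + (g0 + e / 2) * h = z0 + (g0 + e) * h by field.
apply/ltW/H.
move: (dr1 h h00) (dr2 h h00) (e2t h hh) hw rhoe; only_lra.
Qed.

Lemma has_derivN (R : realType) (F : R -> R) (t a : R) :
  has_deriv F t a -> has_deriv (fun s => - F s) t (- a).
Proof.
move=> /has_derivM/(_ (has_deriv_cst (- 1) t)) H.
rewrite (_ : (fun s => - F s) = (fun s => F s * -1)); last by apply/funext => s; rewrite mulrN1.
by apply: (has_deriv_eq H); rewrite mulrN1 mulr0 addr0.
Qed.

Lemma has_deriv_comp (R : realType) (F G : R -> R) (t a b : R) :
  has_deriv F (G t) a -> has_deriv G t b -> has_deriv (fun s => F (G s)) t (a * b).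
Proof.
move=> /has_deriv_is_derive hF /has_deriv_is_derive hG; exact: is_derive_has_deriv.
Qed.

Lemma has_deriv_affine (R : realType) (a b t : R) : has_deriv (fun s => a + b * s) t b.
Proof.
apply: (has_deriv_eq (has_derivD (has_deriv_cst _ _) (has_derivM (has_deriv_cst _ _) (has_deriv_id _)))).
by rewrite mul0r !add0r mulr1.
Qed.

(** This symmetry turns the upper estimate of [no_overshoot] into a lower one. *)
Lemma potential_opp (R : realType) (f : R -> R) (u g V M : R * R -> R) :
  potential f u g V M ->
  potential (fun z => - f (- z)) (fun z => - u z) (fun z => - g z)
    (fun z => - V z) (fun z => - M z).
Proof.
move=> [Vx Vt Mx]; split=> t x; try exact: has_derivN.
by apply: (has_deriv_eq (has_derivN (Vt t x))); rewrite opprK opprB opprK addrC.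
Qed.

(** [sg = 1] moves the origin of time to [t0]; [sg = -1] also reverses time, which is how curves are
    continued backwards. *)
Lemma potential_shift (R : realType) (f : R -> R) (u g V M : R * R -> R) (t0 sg : R) :
  potential f u g V M ->
  potential (fun z => sg * f z) (fun z => u (t0 + sg * z.1, z.2))
    (fun z => sg * g (t0 + sg * z.1, z.2)) (fun z => V (t0 + sg * z.1, z.2))
    (fun z => sg * M (t0 + sg * z.1, z.2)).
Proof.
move=> [Vx Vt Mx]; split=> t x /=; first exact: Vx.
  apply: (has_deriv_eq (has_deriv_comp (F := fun s => V (s, x)) (Vt _ _) (has_deriv_affine t0 sg t))).
  by ring.
apply: (has_deriv_eq (has_derivM (has_deriv_cst sg _) (Mx _ _))).
by rewrite mul0r add0r.
Qed.

Lemma continuous_shift (R : realType) (F : R * R -> R) (t0 sg : R) :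
  continuous F -> continuous (fun z => F (t0 + sg * z.1, z.2)).
Proof.
move=> cF; apply: (@continuous_comp2 _ F) => //; last by move=> z; exact: cvg_snd.
move=> z; apply: cvgD; first exact: cvg_cst.
by apply: cvgM; [exact: cvg_cst | exact: cvg_fst].
Qed.

(** [no_overshoot] and its mirror image give two points near the Euler target, one where [u] is not
    too large and one where it is not too small. Either one of them is already good, or the
    intermediate value theorem supplies a point between them. Uniform continuity on a box makes the
    admissible steps independent of the starting point. *)
Lemma characteristic_step (R : realType) (f f' : R -> R) (u g V M : R * R -> R)
    (x0 A e : R) :
  (forall x, has_deriv f x (f' x)) -> continuous f' -> continuous u ->
  continuous g -> potential f u g V M -> 0 < e ->
  exists2 h0 : R, 0 < h0 & forall h, 0 < h <= h0 -> forall t x, 0 <= t <= A ->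
    `|x - x0| <= A -> exists x',
       `|x' - x - f' (u (t, x)) * h| <= e * h /\
       `|u (t + h, x') - u (t, x) - g (t, x) * h| <= e * h.
Proof.
move=> df cf' cu cg pot e0.
pose B := `|A| + `|x0|.
have [Cu Cu0 HCu] := bounded_box B cu.
have [Cg Cg0 HCg] := bounded_box B cg.
have cf2 : continuous (fun z : R * R => f' z.1).
  by move=> z; apply: (@continuous_comp _ _ _ fst f'); [exact: cvg_fst | exact: cf'].
have [Cf Cf0 HCf] := bounded_box Cu cf2.
have e20 : 0 < e / 2 by lra.
have [rf rf0 Hrf] := uniform_box Cu cf2 e20.
pose eta := rf / 2; have eta0 : 0 < eta by rewrite divr_gt0.
have [ru ru0 Hru] := uniform_box B cu eta0.
have [rg rg0 Hrg] := uniform_box B cg e20.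
pose r := Num.min ru rg; have r0 : 0 < r by rewrite lt_min ru0.
have rru : r <= ru by rewrite ge_min lexx.
have rrg : r <= rg by rewrite ge_min lexx orbT.
(* One step needs room [(Cf + e) * h] in space, [h] in time and [(Cg + e) * h] in the values of [u];
   [K * h] dominates all three. *)
pose K := Cf + Cg + e + 1; have K0 : 0 < K by rewrite /K; lra.
pose h0 := Num.min (r / (2 * K)) (eta / K).
have K20 : 0 < 2 * K by lra.
exists h0; first by rewrite lt_min !divr_gt0.
move=> h /andP[hp]; rewrite le_min => /andP[hr he] t x ht hx.
have hr' : h * (2 * K) <= r by rewrite -ler_pdivlMr.
have he' : h * K <= eta by rewrite -ler_pdivlMr.
have tB : `|t| <= B.
  rewrite /B; have := ler_norm A; have := normr_ge0 x0; move: ht; only_lra.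
have xB : `|x| <= B.
  rewrite /B; have := ler_norm A; have := ler_norm x0; have := ler_norm (- x0).
  by rewrite normrN; move: hx; only_lra.
set z0 := u (t, x); have z0C : `|z0| <= Cu by exact: HCu.
have c0C : `|f' z0| <= Cf by apply: (HCf z0 0) => //; rewrite normr0 ltW.
have g0C : `|g (t, x)| <= Cg by exact: HCg.
have KE : h * K = Cf * h + Cg * h + e * h + h by rewrite /K; ring.
have [Cfh Cgh eh] : [/\ 0 <= Cf * h, 0 <= Cg * h & 0 <= e * h] by rewrite !mulr_ge0 // ltW.
have hrK : Cf * h + Cg * h + e * h + h <= r / 2.
  by rewrite -KE ler_pdivlMr //; move: hr'; rewrite mulrCA mulrC.
have near s y : 0 <= s <= h -> `|y - x| <= (`|f' z0| + e) * h ->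
    `|u (t + s, y) - z0| <= eta /\ `|g (t + s, y) - g (t, x)| <= e / 2.
  move=> hs hy; have hy' : (`|f' z0| + e) * h <= Cf * h + e * h.
    by rewrite mulrDl lerD2r; apply: ler_wpM2r; [exact: ltW | exact: c0C].
  have st : `|t + s - t| < r by move: hs hrK hp Cfh Cgh eh; only_lra.
  have yx : `|y - x| < r by move: hy hy' hrK hp Cfh Cgh eh; only_lra.
  by split; [apply: Hru | apply: Hrg] => //;
    [exact: lt_le_trans rru | exact: lt_le_trans rru | exact: lt_le_trans rrg | exact: lt_le_trans rrg].
have fnear z : `|z - z0| <= eta -> `|f' z - f' z0| <= e / 2.
  move=> hz; apply: (Hrf z0 0 z 0) => //; rewrite ?normr0 ?subrr ?normr0 //; first exact: ltW.
  by move: hz rf0; rewrite /eta; only_lra.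
have gnear : (`|g (t, x)| + e) * h <= eta.
  apply: (@le_trans _ _ (Cg * h + e * h)); last by move: he' KE hp Cfh; only_lra.
  by rewrite mulrDl lerD2r; apply: ler_wpM2r; [exact: ltW | exact: g0C].
have pot1 : potential f (fun z => u (t + 1 * z.1, z.2)) (fun z => g (t + 1 * z.1, z.2))
    (fun z => V (t + 1 * z.1, z.2)) (fun z => M (t + 1 * z.1, z.2)).
  have := potential_shift t 1 pot; congr potential; apply/funext => z; exact: mul1r.
have cu1 := continuous_shift (t0 := t) (sg := 1) cu.
have sE s : t + 1 * s = t + s by rewrite mul1r.
have [|||x1] := @no_overshoot R f f' _ _ _ _ x h e eta df cf' cu1 pot1 hp e0;
  rewrite /= ?mulr0 ?addr0 ?sE -?/z0 //.
  by move=> s y hs hy; rewrite sE; apply: near.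
move=> x1h x1u.
have df2 z : has_deriv (fun z => - f (- z)) z (f' (- z)).
  apply: (has_deriv_eq (has_derivN (has_deriv_comp (df _) (has_derivN (has_deriv_id z))))).
  by rewrite mulrN1 opprK.
have cf2' : continuous (fun z => f' (- z)).
  by move=> z; apply: (@continuous_comp _ _ _ -%R f'); [exact: opp_continuous | exact: cf'].
have cu2 : continuous (fun z : R * R => - u (t + 1 * z.1, z.2)) by move=> z; apply: cvgN; exact: cu1.
have [|||x2] := @no_overshoot R _ _ _ _ _ _ x h e eta df2 cf2' cu2 (potential_opp pot1) hp e0;
  rewrite /= ?mulr0 ?addr0 ?opprK ?normrN ?sE -?/z0 //.
- move=> s y hs hy; rewrite sE; have [n1 n2] := near s y hs hy.
  by split; [move: n1 | move: n2]; only_lra.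
- by move=> z hz; apply: fnear; move: hz; only_lra.
move=> x2h x2u.
have [d1|d1] := leP (z0 + g (t, x) * h - e * h) (u (t + h, x1)).
  by exists x1; split=> //; move: x1u d1; rewrite mulrDl; only_lra.
have [d2|d2] := leP (u (t + h, x2)) (z0 + g (t, x) * h + e * h).
  by exists x2; split=> //; move: x2u d2; rewrite mulrDl mulNr; only_lra.
have cuh : continuous (fun y => u (t + h, y)) by exact: continuous_slice.
have [y hy yE] : exists2 y, (x1 <= y <= x2) || (x2 <= y <= x1) & u (t + h, y) = z0 + g (t, x) * h.
  have /orP[le|le] := le_total x1 x2.
    have [||y yi yE] := @IVT R (fun y => u (t + h, y)) x1 x2 (z0 + g (t, x) * h) le.
    - exact: continuous_subspaceT.
    - rewrite ge_min le_max; apply/andP; split; apply/orP; [left | right]; move: d1 d2 eh; only_lra.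
    - by exists y => //; move: yi; rewrite in_itv /= => ->.
  have [||y yi yE] := @IVT R (fun y => u (t + h, y)) x2 x1 (z0 + g (t, x) * h) le.
  - exact: continuous_subspaceT.
  - rewrite ge_min le_max; apply/andP; split; apply/orP; [right | left]; move: d1 d2 eh; only_lra.
  - by exists y => //; move: yi; rewrite in_itv /= => ->; rewrite orbT.
exists y; split; first by move: hy x1h x2h => /orP[]; only_lra.
by rewrite yE; move: eh; rewrite -/z0; only_lra.
Qed.

Lemma characteristic_half (R : realType) (f f' : R -> R) (u g V M : R * R -> R)
    (G x0 : R) :
  (forall x, has_deriv f x (f' x)) -> continuous f' -> continuous u ->
  continuous g -> (forall z, `|g z| <= G) -> potential f u g V M ->
  exists gam : R -> R, gam 0 = x0 /\ forall t, 0 <= t -> forall e : R, 0 < e ->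
    exists2 r : R, 0 < r & forall s, 0 <= s -> `|s - t| < r ->
      `|gam s - gam t - f' (u (t, gam t)) * (s - t)| <= e * `|s - t| /\
      `|u (s, gam s) - u (t, gam t) - g (t, gam t) * (s - t)| <= e * `|s - t|.
Proof.
move=> df cf' cu cg HG pot.
apply: (@euler_limit R (fun z => f' (u z)) u g G x0) => //.
- by move=> z; apply: continuous_comp; [exact: cu | exact: cf'].
(* The values of [u] in question stay in a bounded range, where [f'] is bounded; this prevents
   blow-up of the curve. *)
- move=> T T0; pose A := `|u (0, x0)| + (G + 1) * T.
  have cf2 : continuous (fun z : R * R => f' z.1).
    by move=> z; apply: (@continuous_comp _ _ _ fst f'); [exact: cvg_fst | exact: cf'].
  have [C C0 HC] := bounded_box A cf2.
  exists C => t x _ hu.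
  have uA : `|u (t, x)| <= A by move: hu; rewrite /A; have := ler_norm (u (0, x0));
    have := ler_norm (- u (0, x0)); rewrite normrN; only_lra.
  by apply: (HC _ (u (t, x))).
- by move=> A e e0; apply: characteristic_step df cf' cu cg pot e0.
Qed.

(** A forward half-curve and a time-reversed one are glued at [(t0, x0)]. Their derivatives match
    there, both being determined by [u] and [g] at that point. *)
Lemma characteristic_through (R : realType) (f f' : R -> R) (u g V M : R * R -> R)
    (G t0 x0 : R) :
  (forall x, has_deriv f x (f' x)) -> continuous f' -> continuous u ->
  continuous g -> (forall z, `|g z| <= G) -> potential f u g V M ->
  exists gam : R -> R, [/\ gam t0 = x0,
    forall t, has_deriv gam t (f' (u (t, gam t))) &
    forall t, has_deriv (fun s => u (s, gam s)) t (g (t, gam t))].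
Proof.
move=> df cf' cu cg HG pot.
have half sg : `|sg| = 1 -> exists gam : R -> R, gam 0 = x0 /\
    forall t, 0 <= t -> forall e : R, 0 < e ->
    exists2 r : R, 0 < r & forall s, 0 <= s -> `|s - t| < r ->
      `|gam s - gam t - sg * f' (u (t0 + sg * t, gam t)) * (s - t)| <= e * `|s - t| /\
      `|u (t0 + sg * s, gam s) - u (t0 + sg * t, gam t) -
         sg * g (t0 + sg * t, gam t) * (s - t)| <= e * `|s - t|.
  move=> sg1.
  have := @characteristic_half R (fun z => sg * f z) (fun z => sg * f' z) _ _ _ _ G x0
    _ _ (continuous_shift (t0 := t0) (sg := sg) cu) _ _ (potential_shift t0 sg pot).
  apply.
  - by move=> x; apply: (has_deriv_eq (has_derivM (has_deriv_cst sg _) (df x))); rewrite mul0r add0r.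
  - by move=> z; apply: cvgM; [exact: cvg_cst | exact: cf'].
  - by move=> z; apply: cvgM; [exact: cvg_cst | exact: continuous_shift].
  - by move=> z; rewrite normrM sg1 mul1r.
have [g1 [g10 H1]] := half 1 (normr1 _).
have [g2 [g20 H2]] := half (-1) (normrN1 _).
pose Gam s := if 0 <= s then g1 s else g2 (- s).
have Gamn s : ~~ (0 <= s) -> t0 + -1 * - s = t0 + s by move=> _; ring.
have dG s : has_deriv Gam s (f' (u (t0 + s, Gam s))).
  have H := @has_deriv_glue R g1 g2 s (fun t => 1 * f' (u (t0 + 1 * t, g1 t)))
    (fun t => -1 * f' (u (t0 + -1 * t, g2 t))).
  apply: has_deriv_eq (H _ _ _ _) _.
  - by move=> t ht e e0; have [r r0 K] := H1 t ht e e0; exists r => // v v0 /(K v v0)[].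
  - by move=> t ht e e0; have [r r0 K] := H2 t ht e e0; exists r => // v v0 /(K v v0)[].
  - by rewrite g10 g20.
  - by rewrite g10 g20 !mulr0 addr0; ring.
  - rewrite /Gam; case: ifPn => s0; first by rewrite !mul1r.
    by rewrite Gamn // mulN1r opprK.
have dU s : has_deriv (fun s => u (t0 + s, Gam s)) s (g (t0 + s, Gam s)).
  have H := @has_deriv_glue R (fun t => u (t0 + 1 * t, g1 t)) (fun t => u (t0 + -1 * t, g2 t)) s
    (fun t => 1 * g (t0 + 1 * t, g1 t)) (fun t => -1 * g (t0 + -1 * t, g2 t)).
  have {}H : has_deriv (fun s => u (t0 + s, Gam s)) s
      (if 0 <= s then 1 * g (t0 + 1 * s, g1 s) else - (-1 * g (t0 + -1 * - s, g2 (- s)))).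
    have -> : (fun s => u (t0 + s, Gam s)) =
      (fun s => if 0 <= s then u (t0 + 1 * s, g1 s) else u (t0 + -1 * - s, g2 (- s))).
      apply/funext => v; rewrite /Gam; case: ifPn => v0; first by rewrite mul1r.
      by rewrite Gamn.
    apply: H.
    - by move=> t ht e e0; have [r r0 K] := H1 t ht e e0; exists r => // v v0 /(K v v0)[].
    - by move=> t ht e e0; have [r r0 K] := H2 t ht e e0; exists r => // v v0 /(K v v0)[].
    - by rewrite g10 g20 !mulr0.
    - by rewrite g10 g20 !mulr0 addr0; ring.
  apply: (has_deriv_eq H); rewrite /Gam; case: ifPn => s0; first by rewrite !mul1r.
  by rewrite Gamn // mulN1r opprK.
have dsh t : has_deriv (fun s => s - t0) t 1.
  by apply: (has_deriv_eq (has_derivB (has_deriv_id t) (has_deriv_cst t0 t))); rewrite subr0.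
have tE t : t0 + (t - t0) = t by ring.
exists (fun t => Gam (t - t0)); split.
- by rewrite subrr /Gam lexx.
- move=> t; apply: (has_deriv_eq (has_deriv_comp (G := fun s => s - t0) (dG _) (dsh t))).
  by rewrite tE mulr1.
- move=> t; have := has_deriv_comp (G := fun s => s - t0) (dU _) (dsh t).
  by rewrite tE mulr1; congr has_deriv; apply/funext => s; rewrite tE.
Qed.

(** * Families of characteristics carrying the source *)

Definition carries (R : realType) (f' : R -> R) (u g : R * R -> R) (gam : R -> R) : Prop :=
  forall t, has_deriv gam t (f' (u (t, gam t))) /\
            has_deriv (fun s => u (s, gam s)) t (g (t, gam t)).

Lemma has_deriv_pick (R : realType) (F1 F2 F : R -> R) (t d : R) :
  (forall s, F s = F1 s \/ F s = F2 s) -> F1 t = F2 t ->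
  has_deriv F1 t d -> has_deriv F2 t d -> has_deriv F t d.
Proof.
move=> HF E H1 H2 e e0.
have [r1 r10 {}H1] := H1 e e0; have [r2 r20 {}H2] := H2 e e0.
exists (Num.min r1 r2); first by rewrite lt_min r10.
move=> s; rewrite lt_min => /andP[s1 s2].
have -> : F t = F1 t by case: (HF t) => ->.
by case: (HF s) => ->; [exact: H1 | rewrite E; exact: H2].
Qed.

(* Two carrying curves that meet are tangent there, so any continuous selection of them is again one. *)
Lemma carries_pick (R : realType) (f' : R -> R) (u g : R * R -> R) (g1 g2 gam : R -> R) :
  carries f' u g g1 -> carries f' u g g2 -> continuous gam ->
  (forall s, gam s = g1 s \/ gam s = g2 s) -> carries f' u g gam.
Proof.
move=> c1 c2 cg Hg t.
have [E|N] := eqVneq (g1 t) (g2 t).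
  have gE : gam t = g1 t by case: (Hg t) => ->.
  split; rewrite gE.
    by apply: (has_deriv_pick Hg E); [exact: (c1 t).1 | rewrite E; exact: (c2 t).1].
  apply: (@has_deriv_pick R (fun s => u (s, g1 s)) (fun s => u (s, g2 s))).
  - by move=> s; case: (Hg s) => ->; [left | right].
  - by rewrite E.
  - exact: (c1 t).2.
  - by rewrite E; exact: (c2 t).2.
have main a b : carries f' u g a -> carries f' u g b -> a t != b t -> gam t = a t ->
    (forall s, gam s = a s \/ gam s = b s) ->
    has_deriv gam t (f' (u (t, gam t))) /\ has_deriv (fun s => u (s, gam s)) t (g (t, gam t)).
  move=> ca cb ab E H.
  have d0 : 0 < `|a t - b t| / 2 by rewrite divr_gt0 // normr_gt0 subr_eq0.
  have /continuousP1/(_ _ d0)[r1 r10 H1] := cg t.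
  have d40 : 0 < `|a t - b t| / 4 by rewrite divr_gt0 // normr_gt0 subr_eq0.
  have /continuousP1/(_ _ d40)[r2 r20 H2] := has_deriv_cont (cb t).1.
  have r0 : 0 < Num.min r1 r2 by rewrite lt_min r10.
  have gE s : `|s - t| < Num.min r1 r2 -> a s = gam s.
    rewrite lt_min => /andP[s1 s2]; case: (H s) => // Es.
    have := H1 s s1; have := H2 s s2; rewrite Es E => h2 h1.
    have : `|a t - b t| <= `|b s - b t| + `|b s - a t|.
      have -> : a t - b t = (b s - b t) - (b s - a t) by ring.
      exact: ler_normB.
    by move: h1 h2 d0; lra.
  rewrite E; split; first exact: has_deriv_near r0 gE (ca t).1.
  by apply: (has_deriv_near r0 _ (ca t).2) => s /gE ->.
case: (Hg t) => E; first exact: main c1 c2 N E Hg.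
by apply: (main g2 g1) => //; [rewrite eq_sym | move=> s; case: (Hg s) => ->; [right | left]].
Qed.

(** The minimum commutes with the shift by [c] and is nonexpansive, so minima of quantities moving
    at a common rate move at that rate as well. *)
Lemma min_drift (R : realType) (a b a' b' c d : R) :
  `|a' - a - c| <= d -> `|b' - b - c| <= d ->
  `|Num.min a' b' - Num.min a b - c| <= d.
Proof. by rewrite !minElt; do 2 ?[case: ifPn]; rewrite -?leNgt; only_lra. Qed.

Lemma max_drift (R : realType) (a b a' b' c d : R) :
  `|a' - a - c| <= d -> `|b' - b - c| <= d ->
  `|Num.max a' b' - Num.max a b - c| <= d.
Proof. by rewrite !maxElt; do 2 ?[case: ifPn]; rewrite -?leNgt; only_lra. Qed.

Lemma carries_cont (R : realType) (f' : R -> R) (u g : R * R -> R) (gam : R -> R) :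
  carries f' u g gam -> continuous gam.
Proof. by move=> c t; exact: has_deriv_cont (c t).1. Qed.

Lemma carries_min (R : realType) (f' : R -> R) (u g : R * R -> R) (g1 g2 : R -> R) :
  carries f' u g g1 -> carries f' u g g2 -> carries f' u g (fun s => Num.min (g1 s) (g2 s)).
Proof.
move=> c1 c2; apply: (carries_pick c1 c2).
  move=> t; apply/continuousP1 => e e0.
  have /continuousP1/(_ _ e0)[r1 r10 H1] := @carries_cont _ _ _ _ _ c1 t.
  have /continuousP1/(_ _ e0)[r2 r20 H2] := @carries_cont _ _ _ _ _ c2 t.
  exists (Num.min r1 r2); first by rewrite lt_min r10.
  move=> s; rewrite lt_min => /andP[s1 s2]; rewrite -[X in `|X|]subr0.
  by apply: min_drift; rewrite subr0; [exact: H1 | exact: H2].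
by move=> s; rewrite minElt; case: ifP => _; [left | right].
Qed.

Lemma carries_max (R : realType) (f' : R -> R) (u g : R * R -> R) (g1 g2 : R -> R) :
  carries f' u g g1 -> carries f' u g g2 -> carries f' u g (fun s => Num.max (g1 s) (g2 s)).
Proof.
move=> c1 c2; apply: (carries_pick c1 c2).
  move=> t; apply/continuousP1 => e e0.
  have /continuousP1/(_ _ e0)[r1 r10 H1] := @carries_cont _ _ _ _ _ c1 t.
  have /continuousP1/(_ _ e0)[r2 r20 H2] := @carries_cont _ _ _ _ _ c2 t.
  exists (Num.min r1 r2); first by rewrite lt_min r10.
  move=> s; rewrite lt_min => /andP[s1 s2]; rewrite -[X in `|X|]subr0.
  by apply: max_drift; rewrite subr0; [exact: H1 | exact: H2].
by move=> s; rewrite maxElt; case: ifP => _; [right | left].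
Qed.

(** Along a carrying curve [u] changes by at most [G] in unit time, so [f'] is evaluated only on
    [[- (C + G), C + G]]. Hence one [L] serves all curves. *)
Lemma carries_speed (R : realType) (f' : R -> R) (u g : R * R -> R) (G C : R) :
  continuous f' -> (forall z, `|g z| <= G) ->
  exists2 L : R, 0 < L & forall gam s t, carries f' u g gam ->
    `|u (s, gam s)| <= C -> `|t - s| <= 1 ->
    `|gam t - gam s| <= L * `|t - s|.
Proof.
move=> cf' HG.
have cf2 : continuous (fun z : R * R => f' z.1).
  by move=> z; apply: (@continuous_comp _ _ _ fst f'); [exact: cvg_fst | exact: cf'].
have [L L0 HL] := bounded_box (C + G) cf2.
exists L => // gam s t cg hu ts.
apply: (@MVT_abs R gam (fun t => f' (u (t, gam t)))) => v hv; first exact: (cg v).1.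
have vs : `|v - s| <= 1 by move: hv ts => /orP[]; only_lra.
have : `|u (v, gam v) - u (s, gam s)| <= G * `|v - s|.
  by apply: (@MVT_abs R (fun t => u (t, gam t)) (fun t => g (t, gam t))) => w hw; [exact: (cg w).2 | exact: HG].
have G0 : 0 <= G by apply: le_trans (HG (0, 0)).
have : G * `|v - s| <= G by rewrite ler_piMr.
move=> h1 h2; have h3 : `|u (v, gam v)| <= C + G by move: h1 h2 hu; only_lra.
exact: (HL (u (v, gam v)) (u (v, gam v))).
Qed.

(** Upgrades density in the plane to density on each line of constant time: a curve that comes near
    [(t0, x0)] at some nearby time is followed to [t0], and the uniform speed bound limits the
    displacement. *)
Lemma carries_dense (R : realType) (f' : R -> R) (u g : R * R -> R) (G : R)
    (Gam : set (R -> R)) :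
  continuous f' -> continuous u -> (forall z, `|g z| <= G) ->
  (forall gam, Gam gam -> carries f' u g gam) ->
  dense (\bigcup_(gam in Gam) range (fun t : R => (t, gam t))) ->
  forall t0 x0 rho : R, 0 < rho ->
    exists2 gam, carries f' u g gam & `|gam t0 - x0| < rho.
Proof.
move=> cf' cu HG Hc Hd t0 x0 rho rho0.
have /continuousP2/(_ _ ltr01)[r r0 Hr] := cu (t0, x0).
pose C := `|u (t0, x0)| + 1.
have [L L0 HL] := carries_speed u C cf' HG.
pose d := Num.min (Num.min r 1) (Num.min (rho / 2) (rho / 2 / L)).
have d0 : 0 < d by rewrite !lt_min r0 ltr01 !divr_gt0.
have [d1 d2 d3 d4] : [/\ d <= r, d <= 1, d <= rho / 2 & d <= rho / 2 / L].
  by rewrite /d !ge_min !lexx !orbT.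
have [|z [Hb [gam Gg [s _ zE]]]] := Hd (interior (ball ((t0, x0) : R * R) d)) _ (open_interior _).
  by exists (t0, x0); exact: nbhsx_ballx.
move: (interior_subset Hb) => {Hb}; rewrite -zE => -[/=]; rewrite -!ball_normE /= => hs hg.
exists gam; first exact: Hc.
have : `|gam t0 - gam s| <= L * `|t0 - s|.
  apply: HL; [exact: Hc | | by apply: le_trans d2; exact: ltW].
  have := Hr s (gam s); rewrite distrC => /(_ (lt_le_trans hs d1)).
  rewrite distrC => /(_ (lt_le_trans hg d1)) h.
  rewrite /C -[u (s, _)](subrK (u (t0, x0))) addrC.
  by apply: (le_trans (ler_normD _ _)); rewrite lerD2l.
have : L * `|t0 - s| <= rho / 2.
  by rewrite mulrC -ler_pdivlMr //; apply: le_trans d4; exact: ltW.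
move: hg d3; rewrite [`|x0 - _|]distrC; only_lra.
Qed.

(** A curve passing close to one point of the box stays close to the points of a neighbourhood, and
    compactness leaves finitely many curves. *)
Lemma finite_curve_net (R : realType) (S : (R -> R) -> Prop) (A rho : R) :
  (forall gam, S gam -> continuous gam) ->
  (forall t0 x0 rho : R, 0 < rho -> exists2 gam, S gam & `|gam t0 - x0| < rho) ->
  0 < rho ->
  exists (N : nat) (c : nat -> R -> R), (forall i, S (c i)) /\
    forall t x, `|t| <= A -> `|x| <= A -> exists2 i, (i < N)%N & `|c i t - x| < rho.
Proof.
move=> Sc Sd rho0.
have /choice[gm Hgm] : forall z : R * R, exists gam, S gam /\ `|gam z.1 - z.2| < rho.
  by move=> [t x]; have [gam] := Sd t x rho rho0; exists gam.
(* The covering form of compactness needs a filter; finite lists of points, directed by inclusion,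
   turn it into the extraction of a finite subcover. *)
pose F : set_system (seq (R * R)) := 
  fun P => exists s0 : seq (R * R), forall s : seq (R * R), {subset s0 <= s} -> P s.
have FF : Filter F.
  split; first by exists [::].
    move=> P Q [s1 H1] [s2 H2]; exists (s1 ++ s2) => s Hs; split.
      by apply: H1 => x xs; apply: Hs; rewrite mem_cat xs.
    by apply: H2 => x xs; apply: Hs; rewrite mem_cat xs orbT.
  by move=> P Q PQ [s1 H1]; exists s1 => s /H1/PQ.
have /compact_near_coveringP H := @compact_box R A.
have [|D HD] := H _ F (fun s w => exists2 z, z \in s & `|gm z w.1 - w.2| < rho) FF.
  move=> [t x] _; have h := (Hgm (t, x)).2; rewrite /= in h.
  have d0 : 0 < (rho - `|gm (t, x) t - x|) / 2 by lra.
  have /continuousP1/(_ _ d0)[r r0 Hr] := @Sc _ (Hgm (t, x)).1 t.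
  exists ([set w | ball t r w.1 /\ ball x ((rho - `|gm (t, x) t - x|) / 2) w.2],
          [set s : seq (R * R) | ((t, x) : R * R) \in s]).
    split; last by exists [:: (t, x)] => s; apply; rewrite mem_head.
    by exists (ball t r, ball x ((rho - `|gm (t, x) t - x|) / 2)); [split; exact: nbhsx_ballx | by []].
  move=> [[t' x'] s] /= [[h1 h2] hs]; exists (t, x) => //.
  move: h1 h2; rewrite -!ball_normE /= [`|t - _|]distrC => /Hr h1 h2.
  have : `|gm (t, x) t' - x'| <= `|gm (t, x) t - x| + (`|gm (t, x) t' - gm (t, x) t| + `|x - x'|).
    have -> : gm (t, x) t' - x' = (gm (t, x) t - x) + ((gm (t, x) t' - gm (t, x) t) + (x - x')) by ring.
    by apply: le_trans (ler_normD _ _) _; rewrite lerD2l ler_normD.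
  by move: h1 h2; lra.
exists (size D), (fun i => gm (nth (0, 0) D i)); split; first by move=> i; have [] := Hgm (nth (0, 0) D i).
move=> t x ht hx; have [|z zD hz] := HD D (fun _ => id) (t, x); first by [].
exists (index z D); first by rewrite index_mem.
by rewrite nth_index.
Qed.

Definition curve_chain (R : realType) (S : (R -> R) -> Prop) (eta : nat -> R -> R)
    (K : nat) (g1 g2 : R -> R) : Prop :=
  [/\ eta 0%N = g1, eta K = g2, forall j, S (eta j) &
      forall j t, (j < K)%N -> eta j t <= eta j.+1 t].

Lemma curve_chain_between (R : realType) (S : (R -> R) -> Prop) (eta : nat -> R -> R)
    (K : nat) (g1 g2 : R -> R) (j : nat) (t : R) :
  curve_chain S eta K g1 g2 -> (j <= K)%N -> g1 t <= eta j t <= g2 t.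
Proof.
move=> [e0 eK _ ele] jK; apply/andP; split.
  rewrite -e0; elim: j jK => // j IHj jK; apply: le_trans (ele j t jK); exact/IHj/ltnW.
rewrite -eK -(subKn jK); elim: (K - j)%N => [|d IHd]; first by rewrite subn0.
apply: le_trans IHd; have [dK|] := ltnP d K; last first.
  by rewrite -subn_eq0 => /eqP E; rewrite subnS E.
rewrite -(subnSK dK); apply: ele; rewrite ltn_subrL; exact: leq_ltn_trans dK.
Qed.

(* The curves c i are inserted one after the other, clipped to the strip by min and max. *)
Lemma curve_chain_refine (R : realType) (S : (R -> R) -> Prop) (c : nat -> R -> R) :
  (forall g1 g2, S g1 -> S g2 -> S (fun s => Num.min (g1 s) (g2 s))) ->
  (forall g1 g2, S g1 -> S g2 -> S (fun s => Num.max (g1 s) (g2 s))) ->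
  (forall i, S (c i)) ->
  forall N g1 g2, S g1 -> S g2 -> (forall t, g1 t <= g2 t) ->
  exists K eta, curve_chain S eta K g1 g2 /\
    forall j t i, (j < K)%N -> (i < N)%N -> ~~ (eta j t < c i t < eta j.+1 t).
Proof.
move=> Smin Smax Sc; elim=> [|N IH] g1 g2 S1 S2 le12.
  exists 1%N, (fun j => if j is 0%N then g1 else g2); split=> //.
  split=> //; first by case.
  by move=> [|j] t.
pose m t := Num.min (Num.max (c N t) (g1 t)) (g2 t).
have Sm : S m by apply: Smin => //; exact: Smax.
have m1 t : g1 t <= m t by rewrite le_min le_max lexx orbT le12.
have m2 t : m t <= g2 t by rewrite ge_min lexx orbT.
have [K1 [e1 [[e10 e1K e1S e1le] e1c]]] := IH g1 m S1 Sm m1.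
have [K2 [e2 [[e20 e2K e2S e2le] e2c]]] := IH m g2 Sm S2 m2.
have up1 j t : (j <= K1)%N -> g1 t <= e1 j t <= m t.
  by apply: (@curve_chain_between _ S e1 K1 g1 m).
have up2 j t : (j <= K2)%N -> m t <= e2 j t <= g2 t.
  by apply: (@curve_chain_between _ S e2 K2 m g2).
pose eta j := if (j < K1)%N then e1 j else e2 (j - K1)%N.
have eta1 j : (j <= K1)%N -> eta j = e1 j.
  rewrite leq_eqVlt => /orP[/eqP ->|jK]; last by rewrite /eta jK.
  by rewrite /eta ltnn subnn e20 e1K.
have eta2 j : (K1 <= j)%N -> eta j = e2 (j - K1)%N by move=> h; rewrite /eta ltnNge h.
exists (K1 + K2)%N, eta; split.
  split.
  - by rewrite eta1.
  - by rewrite eta2 ?leq_addr // addKn.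
  - by move=> j; rewrite /eta; case: ifP.
  - move=> j t jK; have [h|h] := ltnP j K1.
      by rewrite !eta1 //; [exact: e1le | exact: ltnW].
    rewrite !eta2 //; last exact: leqW.
    by rewrite subSn //; apply: e2le; rewrite ltn_subLR.
move=> j t i jK; rewrite ltnS leq_eqVlt => iN; have [h|h] := ltnP j K1.
  rewrite !eta1 //; last exact: ltnW.
  case/orP: iN => [/eqP ->|]; last exact: e1c.
  have := up1 j t (ltnW h); have := up1 j.+1 t h; rewrite /m.
  by rewrite minElt maxElt; do 2 ?[case: ifPn]; rewrite -?leNgt; intros; apply/negP; lra.
rewrite !eta2 //; last exact: leqW.
have h2 : (j - K1 < K2)%N by rewrite ltn_subLR.
rewrite subSn //; case/orP: iN => [/eqP ->|]; last exact: e2c.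
have := up2 _ t (ltnW h2); have := up2 (j - K1).+1 t h2; rewrite /m.
by rewrite minElt maxElt; do 2 ?[case: ifPn]; rewrite -?leNgt; intros; apply/negP; lra.
Qed.

(** The facts on which the subdivision of a strip rests. The approximation is asked at each fixed
    time, not just somewhere nearby in the plane. *)
Definition lattice_of_curves (R : realType) (S : (R -> R) -> Prop) : Prop :=
  [/\ forall gam, S gam -> continuous gam,
      forall g1 g2, S g1 -> S g2 -> S (fun s => Num.min (g1 s) (g2 s)),
      forall g1 g2, S g1 -> S g2 -> S (fun s => Num.max (g1 s) (g2 s)) &
      forall t0 x0 rho : R, 0 < rho -> exists2 gam, S gam & `|gam t0 - x0| < rho].

(** * The balance law on a strip *)

Fixpoint running_max (R : realType) (p : nat -> R) (j : nat) : R :=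
  if j is j'.+1 then Num.max (running_max p j') (p j) else p 0%N.

(* A unimodal modification of p: its variation is bounded independently of K, while it only
   jumps between values lying between neighbouring values of p. *)
Definition unimodal_hull (R : realType) (p : nat -> R) (K j : nat) : R :=
  Num.min (running_max p j) (running_max (fun i => p (K - i)%N) (K - j)).

Lemma running_max_ge (R : realType) (p : nat -> R) (j : nat) : p j <= running_max p j.
Proof. by case: j => [|j] /=; rewrite ?le_max lexx ?orbT. Qed.

Lemma running_max_nondecr (R : realType) (p : nat -> R) (j : nat) :
  running_max p j <= running_max p j.+1.
Proof. by rewrite /= le_max lexx. Qed.

Lemma running_max_near (R : realType) (p : nat -> R) (x d : R) (j : nat) :
  (forall i, (i <= j)%N -> `|p i - x| <= d) -> `|running_max p j - x| <= d.
Proof.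
elim: j => [|j IH] H /=; first exact: H.
have := IH (fun i ij => H i (leqW ij)); have := H j.+1 (leqnn _).
by rewrite maxElt; case: ifPn.
Qed.

Lemma running_max_drift (R : realType) (p p' : nat -> R) (c d : R) (j : nat) :
  (forall i, (i <= j)%N -> `|p' i - p i - c| <= d) ->
  `|running_max p' j - running_max p j - c| <= d.
Proof.
elim: j => [|j IH] H /=; first exact: H.
by apply: max_drift; [apply: IH => i ij; apply: H; exact: leqW | exact: H].
Qed.

Lemma unimodal_hull_near (R : realType) (p : nat -> R) (x d : R) (K j : nat) :
  (j <= K)%N -> (forall i, (i <= K)%N -> `|p i - x| <= d) -> `|unimodal_hull p K j - x| <= d.
Proof.
move=> jK H; rewrite /unimodal_hull.
have h1 : `|running_max p j - x| <= d.
  by apply: running_max_near => i ij; apply: H; exact: leq_trans jK.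
have h2 : `|running_max (fun i => p (K - i)%N) (K - j) - x| <= d.
  by apply: running_max_near => i ij; apply: H; exact: leq_subr.
by rewrite minElt; case: ifPn.
Qed.

Lemma unimodal_hull_drift (R : realType) (p p' : nat -> R) (c d : R) (K j : nat) :
  (j <= K)%N -> (forall i, (i <= K)%N -> `|p' i - p i - c| <= d) ->
  `|unimodal_hull p' K j - unimodal_hull p K j - c| <= d.
Proof.
move=> jK H; apply: min_drift; apply: running_max_drift => i ij; apply: H.
  exact: leq_trans jK.
exact: leq_subr.
Qed.

Lemma unimodal_hull0 (R : realType) (p : nat -> R) (K : nat) : unimodal_hull p K 0 = p 0%N.
Proof.
rewrite /unimodal_hull /= subn0; apply/min_idPl.
by have := running_max_ge (fun i => p (K - i)%N) K; rewrite subnn.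
Qed.

Lemma unimodal_hullK (R : realType) (p : nat -> R) (K : nat) : unimodal_hull p K K = p K.
Proof.
rewrite /unimodal_hull /= subnn /= subn0; apply/min_idPr; exact: running_max_ge.
Qed.

(** Let A be the maximum up to [j] and B the one from [j.+1] on. The two hull values are min(A,
    max(B, [p j])) and min(max(A, [p j.+1]), B). They agree when A >= [p j.+1] and B >= [p j].
    Otherwise one of them is an endpoint of the jump of [p], and the other is A or B, which then
    lies between the endpoints. *)
Lemma unimodal_hull_jump (R : realType) (p : nat -> R) (K j : nat) : (j < K)%N ->
  unimodal_hull p K j.+1 = unimodal_hull p K j \/
  [/\ Num.min (p j) (p j.+1) <= unimodal_hull p K j.+1 <= Num.max (p j) (p j.+1) &
      Num.min (p j) (p j.+1) <= unimodal_hull p K j <= Num.max (p j) (p j.+1)].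
Proof.
move=> jK; rewrite /unimodal_hull -(subnSK jK) /= (subnSK jK) (subKn (ltnW jK)).
have := running_max_ge p j.
have := running_max_ge (fun i => p (K - i)%N) (K - j.+1); rewrite subKn //.
move: (running_max p j) (running_max _ _) (p j) (p j.+1) => A B a b hB hA.
rewrite !minElt !maxElt; do !case: ifPn; rewrite -?leNgt => *;
  by [left | left; lra | right; split; lra].
Qed.

(** The hull is the minimum of a nondecreasing [a] and a nonincreasing [b], so its increments are
    dominated by those of [a - b], which telescope. The four boundary values give the constant 4. *)
Lemma unimodal_hull_variation (R : realType) (p : nat -> R) (B : R) (K : nat) :
  (forall i, (i <= K)%N -> `|p i| <= B) ->
  \sum_(j < K) `|unimodal_hull p K j.+1 - unimodal_hull p K j| <= 4 * B.
Proof.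
move=> H; pose a j := running_max p j; pose b j := running_max (fun i => p (K - i)%N) (K - j).
have tel : \sum_(j < K) `|unimodal_hull p K j.+1 - unimodal_hull p K j| <=
    \sum_(j < K) ((a j.+1 - b j.+1) - (a j - b j)).
  apply: ler_sum => -[j jK] _ /=; rewrite /unimodal_hull -/(a j) -/(b j) -/(a j.+1) -/(b j.+1).
  have h1 : a j <= a j.+1 := running_max_nondecr p j.
  have h2 : b j.+1 <= b j.
    by rewrite /b -(subnSK jK); exact: (running_max_nondecr (fun i => p (K - i)%N)).
  by rewrite !minElt; do 2 ?[case: ifPn]; rewrite -?leNgt ler_norml => *; lra.
apply: le_trans tel _.
rewrite -(big_mkord xpredT (fun j => (a j.+1 - b j.+1) - (a j - b j))) telescope_sumr //.
have near q j x : (j <= K)%N -> (forall i, (i <= K)%N -> `|q i| <= B) ->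
    x = running_max q j -> `|x| <= B.
  move=> jK Hq ->; rewrite -[running_max _ _]subr0; apply: running_max_near => i ij.
  by rewrite subr0; apply: Hq; exact: leq_trans jK.
have hq i : (i <= K)%N -> `|p (K - i)%N| <= B by move=> _; apply: H; exact: leq_subr.
have := near p K (a K) (leqnn _) H erefl.
have := near p 0%N (a 0%N) (leq0n _) H erefl.
have := near _ (K - K)%N (b K) (leq_subr _ _) hq erefl.
have := near _ (K - 0)%N (b 0%N) (leq_subr _ _) hq erefl.
by only_lra.
Qed.

(** A discrete form of d(z f'(z) - f(z)) = z df'(z). The hull [q] has the same end values as [p], so
    [T] telescopes to the exact increment. The error of each term is an increment of s |-> f(s) -
    f'([p j.+1]) s between two hull values, where its slope is at most [th]; the variation bound
    then sums these errors. *)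
Lemma unimodal_hull_flux (R : realType) (f f' : R -> R) (p : nat -> R) (B th : R) (K : nat) :
  (forall x, has_deriv f x (f' x)) -> 0 <= th ->
  (forall i, (i <= K)%N -> `|p i| <= B) ->
  (forall j s, (j < K)%N -> Num.min (p j) (p j.+1) <= s <= Num.max (p j) (p j.+1) ->
     `|f' s - f' (p j.+1)| <= th) ->
  `|\sum_(j < K) unimodal_hull p K j * (f' (p j.+1) - f' (p j)) -
    ((p K * f' (p K) - f (p K)) - (p 0%N * f' (p 0%N) - f (p 0%N)))| <= th * (4 * B).
Proof.
move=> df th0 pB Hth; pose q j := unimodal_hull p K j; pose T j := q j * f' (p j) - f (q j).
have TE : (p K * f' (p K) - f (p K)) - (p 0%N * f' (p 0%N) - f (p 0%N)) =
    \sum_(j < K) (T j.+1 - T j).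
  rewrite -(big_mkord xpredT (fun j => T j.+1 - T j)) telescope_sumr //.
  by rewrite /T /q unimodal_hull0 unimodal_hullK.
rewrite TE -sumrB; apply: le_trans (ler_norm_sum _ _ _) _.
apply: (@le_trans _ _ (\sum_(j < K) th * `|q j.+1 - q j|)); last first.
  by rewrite -mulr_sumr ler_wpM2l // unimodal_hull_variation.
apply: ler_sum => -[j jK] _ /=; rewrite -/(q j).
have -> : q j * (f' (p j.+1) - f' (p j)) - (T j.+1 - T j) =
  (f (q j.+1) - f' (p j.+1) * q j.+1) - (f (q j) - f' (p j.+1) * q j) by rewrite /T; ring.
have [E|[h1 h2]] := unimodal_hull_jump p jK.
  by rewrite /q E !subrr normr0 mulr0.
apply: (@MVT_abs _ (fun s => f s - f' (p j.+1) * s) (fun s => f' s - f' (p j.+1))) => s hs.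
  apply: has_derivB => //.
  by apply: (has_deriv_eq (has_derivM (has_deriv_cst _ _) (has_deriv_id _))); rewrite mul0r add0r mulr1.
apply: Hth => //; move: h1 h2; rewrite -/(q j) -/(q j.+1).
by case/orP: hs => /andP[s1 s2] /andP[h1 h2] /andP[h3 h4]; apply/andP; split;
  [exact: le_trans h3 s1 | exact: le_trans s2 h2 | exact: le_trans h1 s1 | exact: le_trans s2 h4].
Qed.

Lemma common_radius (R : realType) (P : nat -> R -> Prop) (K : nat) :
  (forall i, (i <= K)%N -> exists2 r : R, 0 < r & forall h, 0 < h < r -> P i h) ->
  exists2 r : R, 0 < r & forall h, 0 < h < r -> forall i, (i <= K)%N -> P i h.
Proof.
elim: K => [|K IH] H.
  by have [r r0 Hr] := H 0%N (leqnn _); exists r => // h hr i; rewrite leqn0 => /eqP ->; exact: Hr.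
have [r r0 Hr] := IH (fun i iK => H i (leqW iK)); have [r2 r20 Hr2] := H K.+1 (leqnn _).
exists (Num.min r r2); first by rewrite lt_min r0.
move=> h; rewrite lt_min => /and3P[h0 h1 h2] i; rewrite leq_eqVlt => /orP[/eqP ->|].
  by apply: Hr2; rewrite h0.
by rewrite ltnS => iK; apply: Hr => //; rewrite h0.
Qed.

(* The rate of change of Pu(t, gam t) along a carrying curve, when Pu_t = Pg - f(u) and Pu_x = u. *)
Definition flux_along (R : realType) (f f' : R -> R) (u Pg : R * R -> R) (gam : R -> R) (t : R) : R :=
  u (t, gam t) * f' (u (t, gam t)) - f (u (t, gam t)) + Pg (t, gam t).

(* Its integrand has bounded variation along the chain, unlike u itself, so that the
   errors made on the individual strips can be summed. *)
Definition step_integral (R : realType) (u : R * R -> R) (eta : nat -> R -> R) (K : nat) (s : R) : R :=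
  \sum_(j < K) unimodal_hull (fun i => u (s, eta i s)) K j * (eta j.+1 s - eta j s).

Lemma curve_chain_width (R : realType) (S : (R -> R) -> Prop) (eta : nat -> R -> R)
    (K : nat) (g1 g2 : R -> R) (t : R) : curve_chain S eta K g1 g2 ->
  \sum_(j < K) (eta j.+1 t - eta j t) = g2 t - g1 t.
Proof.
move=> [e0 eK _ _]; rewrite -(big_mkord xpredT (fun j => eta j.+1 t - eta j t)).
by rewrite (telescope_sumr (fun j => eta j t)) // e0 eK.
Qed.

(** The increment consists of the drift of the hull values, the motion of the strip widths at the
    speeds [c j], and the flux sum of [unimodal_hull_flux]. The drift, about [g0] times the total
    width, matches the increment of [Pg] up to [eps] times that width. *)
Lemma step_integral_slope (R : realType) (f f' : R -> R) (u g Pg : R * R -> R)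
    (eta : nat -> R -> R) (K : nat) (g1 g2 : R -> R) (t eps th B : R) :
  (forall x, has_deriv f x (f' x)) ->
  (forall x, has_deriv (fun y => Pg (t, y)) x (g (t, x))) ->
  curve_chain (carries f' u g) eta K g1 g2 ->
  0 <= eps -> 0 <= th ->
  (forall x, g1 t <= x <= g2 t -> `|g (t, x) - g (t, g1 t)| <= eps) ->
  (forall i, (i <= K)%N -> `|u (t, eta i t)| <= B) ->
  (forall j s, (j < K)%N ->
     Num.min (u (t, eta j t)) (u (t, eta j.+1 t)) <= s <=
       Num.max (u (t, eta j t)) (u (t, eta j.+1 t)) ->
     `|f' s - f' (u (t, eta j.+1 t))| <= th) ->
  forall e : R, 0 < e -> exists2 r : R, 0 < r & forall h, 0 < h < r ->
    `|step_integral u eta K (t + h) - step_integral u eta K t -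
      (flux_along f f' u Pg g2 t - flux_along f f' u Pg g1 t) * h|
    <= (2 * eps * (g2 t - g1 t) + th * (4 * B) + e) * h.
Proof.
move=> df dPg ch eps0 th0 Hg HB Hth e e0.
have [E0 EK ES Ele] := ch.
pose p i := u (t, eta i t); pose c i := f' (p i); pose g0 := g (t, g1 t).
pose q j := unimodal_hull p K j.
pose W := g2 t - g1 t; have W0 : 0 <= W.
  by rewrite /W -(curve_chain_width t ch) sumr_ge0 // => -[j jK] _; rewrite subr_ge0 Ele.
have B0 : 0 <= B by apply: le_trans (HB 0%N (leq0n _)).
pose D := `|c K| + `|c 0%N| + 2; have D0 : 0 < D by rewrite ltr_wpDl // addr_ge0.
(* [Z] grows with [K], as the differentiation errors of all curves are added up; this is harmless
   because [h] is restricted after the chain is fixed. *)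
pose Z := W + 2 * K%:R * B + 1; have Z0 : 0 < Z by rewrite ltr_wpDl // addr_ge0 // !mulr_ge0.
pose e' := Num.min 1 (e / (2 * Z)).
have e'0 : 0 < e' by rewrite lt_min ltr01 divr_gt0 // mulr_gt0.
have e'1 : e' <= 1 by rewrite ge_min lexx.
have e'Z : e' * Z <= e / 2.
  have : e' <= e / (2 * Z) by rewrite ge_min lexx orbT.
  by rewrite ler_pdivlMr ?mulr_gt0 // mulrCA => h; rewrite ler_pdivlMr // mulrC.
pose Y := D * (eps + 1 + `|g0|).
have Y0 : 0 < Y by rewrite mulr_gt0 // ltr_wpDr // ltr_wpDl.
have [i _|r r0 Hr] := @common_radius R (fun i h =>
   `|u (t + h, eta i (t + h)) - p i - g (t, eta i t) * h| <= e' * h /\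
   `|eta i (t + h) - eta i t - c i * h| <= e' * h) K.
  have [d1 d2] := ES i t.
  have [r1 r10 H1] := d1 e' e'0; have [r2 r20 H2] := d2 e' e'0.
  exists (Num.min r1 r2); first by rewrite lt_min r10.
  move=> h; rewrite lt_min => /and3P[h0 h1 h2].
  have sh : t + h - t = h by ring.
  have := H1 (t + h); have := H2 (t + h); rewrite sh (gtr0_norm h0) => a b.
  by split; [exact: a | exact: b].
exists (Num.min r (e / (2 * Y))); first by rewrite lt_min r0 divr_gt0 // mulr_gt0.
move=> h; rewrite lt_min => /and3P[h0 hr hY].
have {}Hr := Hr h; rewrite h0 hr in Hr; have {}Hr := Hr isT.
have hYe : Y * h <= e / 2.
  have Y2 : 0 < 2 * Y by apply: mulr_gt0.
  move: hY; rewrite (ltr_pdivlMr _ _ Y2) (_ : h * (2 * Y) = 2 * (Y * h)); last by ring.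
  by only_lra.
pose p' i := u (t + h, eta i (t + h)); pose q' j := unimodal_hull p' K j.
pose w j := eta j.+1 t - eta j t; pose w' j := eta j.+1 (t + h) - eta j (t + h).
have w'0 j : (j < K)%N -> 0 <= w' j by move=> jK; rewrite subr_ge0 Ele.
pose W' := g2 (t + h) - g1 (t + h).
have W'E : \sum_(j < K) w' j = W' := curve_chain_width (t + h) ch.
have W'W : `|W' - W| <= D * h.
  have [_ a] := Hr K (leqnn _); have [_ b] := Hr 0%N (leq0n _).
  have eh : e' * h <= h by rewrite ler_piMl // ltW.
  have : `|c K * h| <= `|c K| * h by rewrite normrM (gtr0_norm h0).
  have : `|c 0%N * h| <= `|c 0%N| * h by rewrite normrM (gtr0_norm h0).
  move: a b eh; rewrite /D /W /W' -E0 -EK !mulrDl; only_lra.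
have qB j : (j <= K)%N -> `|q j| <= B.
  move=> jK; rewrite -[q j]subr0; apply: unimodal_hull_near => // i iK.
  by rewrite subr0; exact: HB.
(* The hull commutes with common shifts, so it follows the drift [g0 * h] shared by all the
   curves. *)
have q'q j : (j <= K)%N -> `|q' j - q j - g0 * h| <= (eps + e') * h.
  move=> jK; apply: unimodal_hull_drift => // i iK; have [a _] := Hr i iK.
  have : `|(g (t, eta i t) - g0) * h| <= eps * h.
    rewrite normrM (gtr0_norm h0); apply: ler_wpM2r; first exact: ltW.
    by apply: Hg; exact: curve_chain_between t ch iK.
  by move: a; rewrite /p' mulrBl mulrDl; only_lra.
have S1 : `|\sum_(j < K) (q' j - q j - g0 * h) * w' j| <= (eps + e') * h * W'.
  rewrite -W'E mulr_sumr; apply: le_trans (ler_norm_sum _ _ _) _; apply: ler_sum => -[j jK] _ /=.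
  by rewrite normrM (ger0_norm (w'0 j jK)) ler_wpM2r ?w'0 // q'q // ltnW.
have S2 : `|\sum_(j < K) q j * (w' j - w j - (c j.+1 - c j) * h)| <= K%:R * (B * (2 * e' * h)).
  apply: le_trans (ler_norm_sum _ _ _) _.
  rewrite -[K in K%:R]card_ord mulr_natl -sumr_const; apply: ler_sum => -[j jK] _ /=.
  rewrite normrM ler_pM ?qB ?(ltnW jK) //.
  have [_ a] := Hr j.+1 jK; have [_ b] := Hr j (ltnW jK).
  by move: a b; rewrite /w /w'; only_lra.
have S3 : `|(\sum_(j < K) q j * (c j.+1 - c j) -
   ((p K * f' (p K) - f (p K)) - (p 0%N * f' (p 0%N) - f (p 0%N)))) * h| <= th * (4 * B) * h.
  rewrite normrM (gtr0_norm h0); apply: ler_wpM2r; first exact: ltW.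
  exact: unimodal_hull_flux.
have FE : step_integral u eta K (t + h) - step_integral u eta K t =
   \sum_(j < K) (q' j - q j - g0 * h) * w' j + g0 * h * W' +
   \sum_(j < K) q j * (w' j - w j - (c j.+1 - c j) * h) +
   (\sum_(j < K) q j * (c j.+1 - c j)) * h.
  rewrite /step_integral -/p -/p' -W'E mulr_suml mulr_sumr -sumrB -!big_split /=.
  by apply: eq_bigr => j _; rewrite -/(q j) -/(q' j) -/(w j) -/(w' j); ring.
have S4 : `|(Pg (t, g2 t) - Pg (t, g1 t) - g0 * W) * h| <= eps * W * h.
  rewrite normrM (gtr0_norm h0); apply: ler_wpM2r; first exact: ltW.
  have -> : Pg (t, g2 t) - Pg (t, g1 t) - g0 * W =
    (Pg (t, g2 t) - g0 * g2 t) - (Pg (t, g1 t) - g0 * g1 t) by rewrite /W; ring.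
  rewrite -(ger0_norm W0).
  apply: (@MVT_abs _ (fun y => Pg (t, y) - g0 * y) (fun y => g (t, y) - g0)) => y hy.
    apply: has_derivB => //.
    by apply: (has_deriv_eq (has_derivM (has_deriv_cst _ _) (has_deriv_id _))); rewrite mul0r add0r mulr1.
  by apply: Hg; move: W0 hy; rewrite /W => W0 /orP[]; lra.
have S5 : `|g0 * h * (W' - W)| <= `|g0| * h * (D * h).
  by rewrite normrM (normrM g0 h) (gtr0_norm h0); apply: ler_wpM2l => //; rewrite mulr_ge0 // ltW.
have S6 : (eps + e') * h * W' <= (eps + e') * h * (W + D * h).
  apply: ler_wpM2l; first by rewrite mulr_ge0 ?addr_ge0 // ltW.
  by move: W'W; only_lra.
have S7 : (eps + e') * h * (W + D * h) + K%:R * (B * (2 * e' * h)) + `|g0| * h * (D * h) + eps * W * h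
    <= (2 * eps * W + e) * h.
  have -> : (eps + e') * h * (W + D * h) + K%:R * (B * (2 * e' * h)) + `|g0| * h * (D * h) + eps * W * h =
    (2 * eps * W + (e' * Z - e') + (Y * h - D * (1 - e') * h)) * h by rewrite /Z /Y; ring.
  apply: ler_wpM2r; first exact: ltW.
  have : 0 <= D * (1 - e') * h by rewrite !mulr_ge0 ?subr_ge0 // ltW.
  by move: e'Z hYe e'0; only_lra.
have -> : (2 * eps * (g2 t - g1 t) + th * (4 * B) + e) * h =
  (2 * eps * W + e) * h + th * (4 * B) * h by rewrite /W; ring.
rewrite FE /flux_along; rewrite -E0 -EK in S4 *; rewrite -/(p 0%N) -/(p K).
move: S1 S2 S3 S4 S5 S6 S7; set A1 := \sum_(j < K) _ * w' j; set A2 := \sum_(j < K) q j * (_ - _ * h).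
set A3 := \sum_(j < K) _; set dP := Pg (t, eta K t) - Pg (t, eta 0%N t) - g0 * W.
have -> : A1 + g0 * h * W' + A2 + A3 * h - (p K * f' (p K) - f (p K) + Pg (t, eta K t) -
     (p 0%N * f' (p 0%N) - f (p 0%N) + Pg (t, eta 0%N t))) * h =
  A1 + A2 + (A3 - (p K * f' (p K) - f (p K) - (p 0%N * f' (p 0%N) - f (p 0%N)))) * h +
  g0 * h * (W' - W) - dP * h by rewrite /dP; ring.
only_lra.
Qed.

Lemma mean_value_inequality (R : realType) (F H H' N N' : R -> R) (a b : R) :
  a <= b -> continuous F -> (forall t, has_deriv H t (H' t)) ->
  (forall t, has_deriv N t (N' t)) ->
  (forall t, a <= t < b -> forall e : R, 0 < e -> exists2 r : R, 0 < r &
     forall h : R, 0 < h < r -> `|F (t + h) - F t - H' t * h| <= (N' t + e) * h) ->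
  `|F b - F a - (H b - H a)| <= N b - N a.
Proof.
move=> ab cF dH dN Hs.
(* Both signs are needed: [right_slope_le] is applied to [F - H - N] and to [H - F - N]. *)
have side sg : `|sg| = 1 -> sg * (F b - F a - (H b - H a)) <= N b - N a.
  move=> sg1.
  have := @right_slope_le R (fun t => sg * (F t - H t) - N t) a b ab.
  suff S : (forall t, a <= t < b -> forall e : R, 0 < e -> exists2 r : R, 0 < r &
     forall h : R, 0 < h < r ->
       sg * (F (t + h) - H (t + h)) - N (t + h) - (sg * (F t - H t) - N t) <= e * h).
    move=> /(_ _ S) K; suff : sg * (F b - H b) - N b <= sg * (F a - H a) - N a.
      by rewrite !mulrBr; only_lra.
    apply: K => t; apply: cvgB; last exact: has_deriv_cont (dN t).
    apply: cvgM; first exact: cvg_cst.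
    by apply: cvgB; [exact: cF | exact: has_deriv_cont (dH t)].
  move=> t ht e e0; have e3 : 0 < e / 3 by rewrite divr_gt0.
  have [r1 r10 H1] := Hs t ht _ e3.
  have [r2 r20 H2] := dH t _ e3; have [r3 r30 H3] := dN t _ e3.
  exists (Num.min r1 (Num.min r2 r3)); first by rewrite !lt_min r10 r20.
  move=> h; rewrite !lt_min => /and4P[h0 h1 h2 h3].
  have sh : t + h - t = h by ring.
  have := H1 h; rewrite h0 h1 => /(_ isT) a1.
  have := H2 (t + h); rewrite sh (gtr0_norm h0) => /(_ h2) a2.
  have := H3 (t + h); rewrite sh (gtr0_norm h0) => /(_ h3) a3.
  have -> : sg * (F (t + h) - H (t + h)) - N (t + h) - (sg * (F t - H t) - N t) =
    sg * (F (t + h) - F t - H' t * h) - sg * (H (t + h) - H t - H' t * h) -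
    (N (t + h) - N t - N' t * h) - N' t * h by ring.
  have sgn X Y : `|X| <= Y -> `|sg * X| <= Y by rewrite normrM sg1 mul1r.
  move: (sgn _ _ a1) (sgn _ _ a2) a3; rewrite mulrDl; have -> : e * h = e / 3 * h + e / 3 * h + e / 3 * h by field.
  by only_lra.
have := side 1 (normr1 _); have := side (-1) (normrN1 _).
by rewrite mul1r mulN1r; only_lra.
Qed.

Lemma step_integral_continuous (R : realType) (u : R * R -> R) (eta : nat -> R -> R) (K : nat) :
  continuous u -> (forall i, continuous (eta i)) -> continuous (step_integral u eta K).
Proof.
move=> cu ce t; rewrite /step_integral.
pose q j s := unimodal_hull (fun i => u (s, eta i s)) K j * (eta j.+1 s - eta j s).
have cq j : (j <= K)%N -> {for t, continuous (q j)}.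
  move=> jK.
  suff ch : {for t, continuous (fun s => unimodal_hull (fun i => u (s, eta i s)) K j)}.
    by apply: cvgM; [exact: ch | apply: cvgB; exact: ce].
  apply/continuousP1 => e e0.
  have [i iK|r r0 Hr] := @common_radius R (fun i h => forall s, `|s - t| < h ->
      `|u (s, eta i s) - u (t, eta i t)| <= e) K.
    have /continuousP2/(_ _ e0)[r1 r10 H1] := cu (t, eta i t).
    have r120 : 0 < r1 / 2 by lra.
    have /continuousP1/(_ _ r120)[r2 r20 H2] := ce i t.
    exists (Num.min r1 r2); first by rewrite lt_min r10.
    move=> h; rewrite lt_min => /and3P[_ h1 h2] s hs.
    apply: H1; first exact: lt_trans h1.
    by apply: le_lt_trans (H2 s (lt_trans hs h2)) _; lra.
  exists (r / 2); first by rewrite divr_gt0.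
  move=> s hs; rewrite -[X in `|X|]subr0; apply: unimodal_hull_drift => // i iK.
  rewrite subr0; apply: (Hr (r / 2)) => //; lra.
suff : forall k, (k <= K)%N -> {for t, continuous (fun s => \sum_(j < k) q j s)}.
  by apply.
elim=> [|k IH] kK.
  rewrite (_ : (fun s => _) = (fun=> 0)); first exact: cvg_cst.
  by apply/funext => s; rewrite big_ord0.
rewrite (_ : (fun s => _) = (fun s => \sum_(j < k) q j s + q k s)); last first.
  by apply/funext => s; rewrite big_ord_recr.
by apply: cvgD; [apply: IH; exact: ltnW | apply: cq; exact: ltnW].
Qed.

(** The hull values and [u] itself lie within [del] of [u (t, g1 t)] on the strip, hence the factor
    2 against the exact integral. *)
Lemma step_integral_near (R : realType) (u Pu : R * R -> R) (S : (R -> R) -> Prop)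
    (eta : nat -> R -> R) (K : nat) (g1 g2 : R -> R) (t del : R) :
  (forall x, has_deriv (fun y => Pu (t, y)) x (u (t, x))) ->
  curve_chain S eta K g1 g2 ->
  (forall x, g1 t <= x <= g2 t -> `|u (t, x) - u (t, g1 t)| <= del) ->
  `|step_integral u eta K t - (Pu (t, g2 t) - Pu (t, g1 t))| <= 2 * del * (g2 t - g1 t).
Proof.
move=> dP ch Hu; have [e0 eK _ ele] := ch.
have -> : Pu (t, g2 t) - Pu (t, g1 t) = \sum_(j < K) (Pu (t, eta j.+1 t) - Pu (t, eta j t)).
  rewrite -(big_mkord xpredT (fun j => Pu (t, eta j.+1 t) - Pu (t, eta j t))).
  by rewrite (telescope_sumr (fun j => Pu (t, eta j t))) // e0 eK.
rewrite -(curve_chain_width t ch) mulr_sumr -sumrB.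
apply: le_trans (ler_norm_sum _ _ _) _; apply: ler_sum => -[j jK] _ /=.
set q := unimodal_hull _ _ _.
have hq : `|q - u (t, g1 t)| <= del.
  apply: unimodal_hull_near; first exact: ltnW.
  by move=> i iK; apply: Hu; exact: curve_chain_between t ch iK.
have le : eta j t <= eta j.+1 t by exact: ele.
rewrite distrC (_ : _ - _ = (Pu (t, eta j.+1 t) - q * eta j.+1 t) - (Pu (t, eta j t) - q * eta j t)); last by ring.
have le0 : 0 <= eta j.+1 t - eta j t by rewrite subr_ge0.
rewrite -[X in _ <= _ * X](ger0_norm le0).
apply: (@MVT_abs _ (fun y => Pu (t, y) - q * y) (fun y => u (t, y) - q)) => y hy.
  apply: has_derivB => //.
  by apply: (has_deriv_eq (has_derivM (has_deriv_cst _ _) (has_deriv_id _))); rewrite mul0r add0r mulr1.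
have := Hu y; have /andP[a1 a2] := curve_chain_between t ch (ltnW jK).
have /andP[b1 b2] := curve_chain_between t ch jK.
have h : g1 t <= y <= g2 t by case/orP: hy => /andP[c1 c2]; apply/andP; split; lra.
by move=> /(_ h); move: hq; only_lra.
Qed.

(** If a gap were wider than [rho], some curve of a [rho / 2] net would pass near its midpoint,
    hence strictly inside it, which [curve_chain_refine] excludes. *)
Lemma fine_curve_chain (R : realType) (S : (R -> R) -> Prop) (g1 g2 : R -> R) (T A rho : R) :
  lattice_of_curves S -> S g1 -> S g2 -> (forall t, g1 t <= g2 t) ->
  (forall t, `|t| <= T -> `|g1 t| <= A /\ `|g2 t| <= A) -> 0 < rho ->
  exists K eta, curve_chain S eta K g1 g2 /\
    forall j t, (j < K)%N -> `|t| <= T -> eta j.+1 t - eta j t <= rho.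
Proof.
move=> [Sc Smin Smax Sd] S1 S2 le12 gA rho0.
have r20 : 0 < rho / 2 by lra.
have [N [c [cS Hc]]] := finite_curve_net (Num.max T A) Sc Sd r20.
have [K [eta [ch He]]] := curve_chain_refine Smin Smax cS N S1 S2 le12.
exists K, eta; split=> // j t jK tT; rewrite leNgt; apply/negP => gap.
have [a1 a2] := gA t tT.
have := curve_chain_between t ch (ltnW jK); have := curve_chain_between t ch jK => b2 b1.
have [||i iN hi] := Hc t ((eta j t + eta j.+1 t) / 2).
- by rewrite le_max tT.
- by rewrite le_max; apply/orP; right; move: a1 a2 b1 b2; only_lra.
by have /negP := He j t i jK iN; apply; move: hi gap; only_lra.
Qed.

Lemma curve_bound (R : realType) (gam : R -> R) (T : R) : continuous gam ->
  exists2 A : R, 0 < A & forall t, `|t| <= T -> `|gam t| <= A.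
Proof.
move=> cg; have c2 : continuous (fun z : R * R => gam z.1).
  by move=> z; apply: (@continuous_comp _ _ _ fst gam); [exact: cvg_fst | exact: cg].
by have [A A0 HA] := bounded_box T c2; exists A => // t tT; apply: (HA t t).
Qed.

(** Refining the chain removes the error coming from [f']. What remains is proportional to the
    widths and to the area of the strip, so it can be added over neighbouring strips. *)
Lemma thin_strip (R : realType) (f f' : R -> R) (u g Pu Pg : R * R -> R)
    (g1 g2 J1 J2 A1 A2 : R -> R) (t1 t2 eps del : R) :
  (forall x, has_deriv f x (f' x)) -> continuous f' -> continuous u ->
  (forall t x, has_deriv (fun y => Pu (t, y)) x (u (t, x))) ->
  (forall t x, has_deriv (fun y => Pg (t, y)) x (g (t, x))) ->
  lattice_of_curves (carries f' u g) ->
  carries f' u g g1 -> carries f' u g g2 -> (forall t, g1 t <= g2 t) ->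
  t1 <= t2 -> 0 <= eps ->
  (forall t x, t1 <= t <= t2 -> g1 t <= x <= g2 t ->
     `|g (t, x) - g (t, g1 t)| <= eps /\ `|u (t, x) - u (t, g1 t)| <= del) ->
  (forall t, has_deriv J1 t (flux_along f f' u Pg g1 t)) ->
  (forall t, has_deriv J2 t (flux_along f f' u Pg g2 t)) ->
  (forall t, has_deriv A1 t (g1 t)) -> (forall t, has_deriv A2 t (g2 t)) ->
  `|(Pu (t2, g2 t2) - Pu (t2, g1 t2)) - (Pu (t1, g2 t1) - Pu (t1, g1 t1))
    - ((J2 t2 - J1 t2) - (J2 t1 - J1 t1))| <=
  2 * del * ((g2 t1 - g1 t1) + (g2 t2 - g1 t2)) +
  2 * eps * ((A2 t2 - A1 t2) - (A2 t1 - A1 t1)).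
Proof.
move=> df cf' cu dPu dPg lat c1 c2 le12 t12 eps0 Hosc dJ1 dJ2 dA1 dA2.
pose T := Num.max `|t1| `|t2|.
have tT t : t1 <= t <= t2 -> `|t| <= T.
  have h1 : `|t1| <= T by rewrite le_max lexx.
  have h2 : `|t2| <= T by rewrite le_max lexx orbT.
  by move: h1 h2; only_lra.
have [B1 B10 HB1] := curve_bound T (carries_cont c1).
have [B2 B20 HB2] := curve_bound T (carries_cont c2).
pose A := B1 + B2.
have gA t : `|t| <= T -> `|g1 t| <= A /\ `|g2 t| <= A.
  by move=> h; rewrite /A; split; [apply: le_trans (HB1 t h) _ | apply: le_trans (HB2 t h) _]; lra.
pose X := Num.max T A.
have TX : T <= X by rewrite le_max lexx.
have AX : A <= X by rewrite le_max lexx orbT.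
have [B B0 HB] := bounded_box X cu.
apply/ler_addgt0Pr => eta0 eta00.
(* The flux error has rate [th * (4 * B)] during [t2 - t1]; with [th = eta0 / L] its total is at
   most [eta0]. *)
pose L := 4 * B * (t2 - t1) + 1; have L0 : 0 < L.
  by rewrite ltr_wpDl // !mulr_ge0 ?subr_ge0 // ltW.
pose th := eta0 / L; have th0 : 0 < th by rewrite divr_gt0.
have cf2 : continuous (fun z : R * R => f' z.1).
  by move=> z; apply: (@continuous_comp _ _ _ fst f'); [exact: cvg_fst | exact: cf'].
have [rf rf0 Hrf] := uniform_box B cf2 th0.
have rf20 : 0 < rf / 2 by lra.
have [ru ru0 Hru] := uniform_box X cu rf20.
have ru20 : 0 < ru / 2 by lra.
have [K [eta [ch Hgap]]] := fine_curve_chain lat c1 c2 le12 gA ru20.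
have [e0 eK eS ele] := ch.
have etaX t i : `|t| <= T -> (i <= K)%N -> `|eta i t| <= X.
  move=> h iK; have [a1 a2] := gA t h; apply: le_trans AX.
  by have := curve_chain_between t ch iK; move: a1 a2; only_lra.
pose N t := 2 * eps * (A2 t - A1 t) + th * (4 * B) * t.
have cF : continuous (step_integral u eta K).
  by apply: step_integral_continuous => // i; exact: carries_cont (eS i).
have := @mean_value_inequality R (step_integral u eta K) (fun t => J2 t - J1 t)
  (fun t => flux_along f f' u Pg g2 t - flux_along f f' u Pg g1 t) N
  (fun t => 2 * eps * (g2 t - g1 t) + th * (4 * B)) t1 t2 t12 cF.
move=> MV.
have {MV}MV : `|step_integral u eta K t2 - step_integral u eta K t1 -
    ((J2 t2 - J1 t2) - (J2 t1 - J1 t1))| <= N t2 - N t1.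
  apply: MV.
  - by move=> t; apply: has_derivB.
  - move=> t; rewrite /N; apply: (has_deriv_eq (has_derivD
      (has_derivM (has_deriv_cst (2 * eps) _) (has_derivB (dA2 t) (dA1 t)))
      (has_derivM (has_deriv_cst (th * (4 * B)) _) (has_deriv_id _)))).
    by ring.
  - move=> t ht e e0'.
    have ht' : t1 <= t <= t2 by case/andP: ht => -> /ltW ->.
    have tt := tT t ht'.
    apply: (@step_integral_slope R f f' u g Pg eta K g1 g2 t eps th B) => //.
    + exact: ltW.
    + by move=> x hx; exact: (Hosc t x ht' hx).1.
    + by move=> i iK; apply: HB; [exact: le_trans TX | exact: etaX].
    + move=> j s jK hs.
      have d : `|u (t, eta j.+1 t) - u (t, eta j t)| <= rf / 2.
        apply: Hru; [exact: le_trans TX | exact: etaX tt (ltnW jK) | by rewrite subrr normr0 |].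
        have := Hgap j t jK tt; have := ele j t jK.
        rewrite ltr_norml => h1 h2; lra.
      apply: (Hrf _ 0 s 0); rewrite ?subrr ?normr0 //; last 2 first.
      * by exact: ltW.
      * move: hs d rf0; rewrite minElt maxElt; do 2 ?[case: ifPn]; rewrite -?leNgt; only_lra.
      * by apply: HB; [exact: le_trans TX | exact: etaX].
have n1 := @step_integral_near R u Pu _ eta K g1 g2 t1 del (dPu t1) ch
  (fun x hx => (Hosc t1 x (ltac:(lra)) hx).2).
have n2 := @step_integral_near R u Pu _ eta K g1 g2 t2 del (dPu t2) ch
  (fun x hx => (Hosc t2 x (ltac:(lra)) hx).2).
have thL : th * (4 * B) * (t2 - t1) <= eta0.
  have -> : th * (4 * B) * (t2 - t1) = th * L - th by rewrite /L; ring.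
  by rewrite /th divfK ?gt_eqF // lerBlDr lerDl ltW.
move: MV n1 n2 thL; rewrite /N; only_lra.
Qed.

Lemma antideriv_unique (R : realType) (J1 J2 d : R -> R) (a b : R) :
  (forall t, has_deriv J1 t (d t)) -> (forall t, has_deriv J2 t (d t)) ->
  J1 b - J1 a = J2 b - J2 a.
Proof.
move=> h1 h2; have : `|(J1 b - J2 b) - (J1 a - J2 a)| <= 0 * `|b - a|.
  apply: (@MVT_abs _ (fun t => J1 t - J2 t) (fun=> 0)) => t _; last by rewrite normr0.
  by apply: (has_deriv_eq (has_derivB (h1 t) (h2 t))); rewrite subrr.
by rewrite mul0r; only_lra.
Qed.

Lemma continuous_along (R : realType) (F : R * R -> R) (gam : R -> R) :
  continuous F -> continuous gam -> continuous (fun t => F (t, gam t)).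
Proof.
move=> cF cg t; apply/continuousP1 => e e0.
have /continuousP2/(_ _ e0)[r r0 H] := cF (t, gam t).
have /continuousP1 cgt := cg t.
have r20 : 0 < r / 2 by lra.
have [r2 r20' H2] := cgt _ r20.
exists (Num.min r r2); first by rewrite lt_min r0.
move=> s; rewrite lt_min => /andP[s1 s2]; apply: H => //.
by apply: le_lt_trans (H2 s s2) _; lra.
Qed.

Lemma flux_along_continuous (R : realType) (f f' : R -> R) (u Pg : R * R -> R) (gam : R -> R) :
  (forall x, has_deriv f x (f' x)) -> continuous f' -> continuous u -> continuous Pg ->
  continuous gam -> continuous (flux_along f f' u Pg gam).
Proof.
move=> df cf' cu cP cg.
have cug := continuous_along cu cg; have cPg := continuous_along cP cg.
move=> t; apply: cvgD; last exact: cPg.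
apply: cvgB; last first.
  by apply: (@continuous_comp _ _ _ (fun t => u (t, gam t)) f); [exact: cug | exact: has_deriv_cont (df _)].
apply: cvgM; first exact: cug.
by apply: (@continuous_comp _ _ _ (fun t => u (t, gam t)) f'); [exact: cug | exact: cf'].
Qed.

(** A second subdivision makes [u] and [g] oscillate by at most [e] across each thin strip. The
    errors of [thin_strip] telescope to [e] times the total widths and area, and [e] is
    arbitrary. *)
Lemma strip_balance (R : realType) (f f' : R -> R) (u g Pu Pg : R * R -> R)
    (g1 g2 J1 J2 : R -> R) (t1 t2 : R) :
  (forall x, has_deriv f x (f' x)) -> continuous f' -> continuous u -> continuous g ->
  continuous Pg ->
  (forall t x, has_deriv (fun y => Pu (t, y)) x (u (t, x))) ->
  (forall t x, has_deriv (fun y => Pg (t, y)) x (g (t, x))) ->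
  lattice_of_curves (carries f' u g) ->
  carries f' u g g1 -> carries f' u g g2 -> (forall t, g1 t <= g2 t) -> t1 <= t2 ->
  (forall t, has_deriv J1 t (flux_along f f' u Pg g1 t)) ->
  (forall t, has_deriv J2 t (flux_along f f' u Pg g2 t)) ->
  Pu (t2, g2 t2) - Pu (t1, g2 t1) - (J2 t2 - J2 t1) =
  Pu (t2, g1 t2) - Pu (t1, g1 t1) - (J1 t2 - J1 t1).
Proof.
move=> df cf' cu cg cPg dPu dPg lat c1 c2 le12 t12 dJ1 dJ2.
pose T := Num.max `|t1| `|t2|.
have tT t : t1 <= t <= t2 -> `|t| <= T.
  have h1 : `|t1| <= T by rewrite le_max lexx.
  have h2 : `|t2| <= T by rewrite le_max lexx orbT.
  by move: h1 h2; only_lra.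
have [B1 B10 HB1] := curve_bound T (carries_cont c1).
have [B2 B20 HB2] := curve_bound T (carries_cont c2).
pose A := B1 + B2.
have gA t : `|t| <= T -> `|g1 t| <= A /\ `|g2 t| <= A.
  by move=> h; rewrite /A; split; [apply: le_trans (HB1 t h) _ | apply: le_trans (HB2 t h) _]; lra.
pose X := Num.max T A.
have TX : T <= X by rewrite le_max lexx.
have AX : A <= X by rewrite le_max lexx orbT.
have [D1 _ dD1] := exists_antideriv (carries_cont c1).
have [D2 _ dD2] := exists_antideriv (carries_cont c2).
pose Z := (g2 t1 - g1 t1) + (g2 t2 - g1 t2) + ((D2 t2 - D1 t2) - (D2 t1 - D1 t1)).
apply/eqP; rewrite -subr_eq0 -normr_le0; apply/ler_addgt0Pr => eta0 eta00; rewrite add0r.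
pose e := eta0 / (2 * (`|Z| + 1)).
have Z1 : 0 < 2 * (`|Z| + 1) by rewrite mulr_gt0 // ltr_wpDl.
have e0 : 0 < e by rewrite divr_gt0.
have eZ : 2 * e * Z <= eta0.
  have E : e * (2 * (`|Z| + 1)) = eta0 by rewrite /e divfK // gt_eqF.
  have : e * Z <= e * `|Z| by rewrite ler_wpM2l ?(ltW e0) // ler_norm.
  by move: E e0; lra.
have [ru ru0 Hru] := uniform_box X cu e0.
have [rg rg0 Hrg] := uniform_box X cg e0.
pose rho := Num.min ru rg / 2.
have rho0 : 0 < rho by rewrite divr_gt0 // lt_min ru0.
have rho2 : rho + rho = Num.min ru rg by rewrite /rho; field.
have rhou : rho + rho <= ru by rewrite rho2 ge_min lexx.
have rhog : rho + rho <= rg by rewrite rho2 ge_min lexx orbT.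
have [K [eta [ch Hgap]]] := fine_curve_chain lat c1 c2 le12 gA rho0.
have [h0 hK hS hle] := ch.
have /choice[J dJ] : forall i, exists J : R -> R, forall t, has_deriv J t (flux_along f f' u Pg (eta i) t).
  move=> i; have [|J _ dJ] := @exists_antideriv R (flux_along f f' u Pg (eta i)); last by exists J.
  exact: flux_along_continuous (carries_cont (hS i)).
have /choice[D dD] : forall i, exists D : R -> R, forall t, has_deriv D t (eta i t).
  move=> i; have [D _ dD] := exists_antideriv (carries_cont (hS i)); by exists D.
pose E i := Pu (t2, eta i t2) - Pu (t1, eta i t1) - (J i t2 - J i t1).
pose Y i := 2 * e * (eta i t1 + eta i t2 + (D i t2 - D i t1)).
have strip i : (i < K)%N -> `|E i.+1 - E i| <= Y i.+1 - Y i.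
  move=> iK.
  have := @thin_strip R f f' u g Pu Pg (eta i) (eta i.+1) (J i) (J i.+1) (D i) (D i.+1) t1 t2 e e
    df cf' cu dPu dPg lat (hS i) (hS i.+1) (fun t => hle i t iK) t12 (ltW e0) _ (dJ i) (dJ i.+1) (dD i) (dD i.+1).
  move=> H; suff {}/H : forall t x, t1 <= t <= t2 -> eta i t <= x <= eta i.+1 t ->
      `|g (t, x) - g (t, eta i t)| <= e /\ `|u (t, x) - u (t, eta i t)| <= e.
    by rewrite /E /Y; only_lra.
  move=> t x /tT tt hx; have [a1 a2] := gA t tt.
  have tX : `|t| <= X by exact: le_trans TX.
  have eX : `|eta i t| <= X.
    apply: le_trans AX; have := curve_chain_between t ch (ltnW iK); move: a1 a2; only_lra.
  have xr : `|x - eta i t| <= rho.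
    have := Hgap i t iK tt; move: hx; only_lra.
  have xr2 : `|x - eta i t| < rho + rho by lra.
  by split; [apply: Hrg | apply: Hru]; rewrite ?subrr ?normr0 //; exact: lt_le_trans xr2 _.
have total : `|E K - E 0%N| <= Y K - Y 0%N.
  rewrite -(telescope_sumr E (leq0n K)) -(telescope_sumr Y (leq0n K)).
  rewrite !big_mkord; apply: le_trans (ler_norm_sum _ _ _) _.
  by apply: ler_sum => -[i iK] _; exact: strip.
have EK : E K = Pu (t2, g2 t2) - Pu (t1, g2 t1) - (J2 t2 - J2 t1).
  rewrite /E hK; congr (_ - _); apply: antideriv_unique dJ2.
  by move=> t; have := dJ K t; rewrite hK.
have E0 : E 0%N = Pu (t2, g1 t2) - Pu (t1, g1 t1) - (J1 t2 - J1 t1).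
  rewrite /E h0; congr (_ - _); apply: antideriv_unique dJ1.
  by move=> t; have := dJ 0%N t; rewrite h0.
rewrite -EK -E0; apply: le_trans total _; apply: le_trans eZ.
have dKD : D K t2 - D K t1 = D2 t2 - D2 t1.
  by apply: antideriv_unique dD2 => t; have := dD K t; rewrite hK.
have d0D : D 0%N t2 - D 0%N t1 = D1 t2 - D1 t1.
  by apply: antideriv_unique dD1 => t; have := dD 0%N t; rewrite h0.
apply: eq_ler; rewrite /Y dKD d0D hK h0 /Z; ring.
Qed.

(** Curves that cross are compared through their minimum, which is itself a carrying curve below
    both. *)
Lemma curve_balance (R : realType) (f f' : R -> R) (u g Pu Pg : R * R -> R)
    (g1 g2 J1 J2 : R -> R) (t1 t2 : R) :
  (forall x, has_deriv f x (f' x)) -> continuous f' -> continuous u -> continuous g ->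
  continuous Pg ->
  (forall t x, has_deriv (fun y => Pu (t, y)) x (u (t, x))) ->
  (forall t x, has_deriv (fun y => Pg (t, y)) x (g (t, x))) ->
  lattice_of_curves (carries f' u g) ->
  carries f' u g g1 -> carries f' u g g2 ->
  (forall t, has_deriv J1 t (flux_along f f' u Pg g1 t)) ->
  (forall t, has_deriv J2 t (flux_along f f' u Pg g2 t)) ->
  Pu (t2, g2 t2) - Pu (t1, g2 t1) - (J2 t2 - J2 t1) =
  Pu (t2, g1 t2) - Pu (t1, g1 t1) - (J1 t2 - J1 t1).
Proof.
move=> df cf' cu cg cPg dPu dPg lat c1 c2 dJ1 dJ2.
wlog t12 : t1 t2 / t1 <= t2.
  move=> W; have /orP[h|h] := le_total t1 t2; first exact: W.
  by have := W _ _ h; only_lra.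
have c0 := carries_min c1 c2.
have [|J0 _ dJ0] := @exists_antideriv R (flux_along f f' u Pg (fun s => Num.min (g1 s) (g2 s))).
  exact: flux_along_continuous (carries_cont c0).
have m1 t : Num.min (g1 t) (g2 t) <= g1 t by rewrite ge_min lexx.
have m2 t : Num.min (g1 t) (g2 t) <= g2 t by rewrite ge_min lexx orbT.
rewrite (strip_balance df cf' cu cg cPg dPu dPg lat c0 c1 m1 t12 dJ0 dJ1).
by rewrite (strip_balance df cf' cu cg cPg dPu dPg lat c0 c2 m2 t12 dJ0 dJ2).
Qed.

(** By [curve_balance], [V] changes along every carrying curve by the integral of [flux_along]. The
    time derivative at a point is obtained by moving along a nearby curve, with short detours at
    constant time at both ends. After subtraction of [U * x], with [U] the value of [u] at the
    point, these detours are negligible. *)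
Lemma potential_of_curves (R : realType) (f f' : R -> R) (u g : R * R -> R) (G : R) :
  (forall x, has_deriv f x (f' x)) -> continuous f' -> continuous u -> continuous g ->
  (forall z, `|g z| <= G) -> lattice_of_curves (carries f' u g) ->
  exists V M : R * R -> R, [/\ potential f u g V M, continuous V & continuous M].
Proof.
move=> df cf' cu cg HG lat.
have [Pu [cPu _ dPu]] := exists_primitive_x cu.
have [Pg [cPg _ dPg]] := exists_primitive_x cg.
have [_ _ _ /(_ 0 0 1 ltr01)[g0 c0 _]] := lat.
have fc gam : carries f' u g gam -> continuous (flux_along f f' u Pg gam).
  by move=> c; exact: flux_along_continuous (carries_cont c).
have [J0 _ dJ0] := exists_antideriv (fc _ c0).
pose V (z : R * R) := Pu z - Pu (z.1, g0 z.1) + J0 z.1.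
have cV : continuous V.
  move=> [t x]; apply: cvgD.
    apply: cvgB; first exact: cPu.
    apply: (@continuous_comp _ _ _ fst (fun t => Pu (t, g0 t))); first exact: cvg_fst.
    exact: continuous_along cPu (carries_cont c0) _.
  by apply: (@continuous_comp _ _ _ fst J0); [exact: cvg_fst | exact: has_deriv_cont (dJ0 _)].
have dV t x : has_deriv (fun y => V (t, y)) x (u (t, x)).
  have := has_derivD (has_derivB (dPu t x) (has_deriv_cst (Pu (t, g0 t)) x)) (has_deriv_cst (J0 t) x).
  by rewrite subr0 addr0.
exists V, Pg; split=> //; split=> // t0 x0 e e0.
set U := u (t0, x0); set M0 := Pg (t0, x0).
have [L L0 HL] := carries_speed u (`|U| + 1) cf' HG.
(* The detours have length at most [d] at time [t0] and [d * (L + 1)] at time [s], whence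
   [L + 2]. *)
pose e2 := Num.min 1 (e / (4 * (L + 2))).
have L2 : 0 < 4 * (L + 2) by lra.
have e20 : 0 < e2 by rewrite lt_min ltr01 divr_gt0.
have e21 : e2 <= 1 by rewrite ge_min lexx.
have e2L : e2 * (L + 2) <= e / 4.
  have : e2 <= e / (4 * (L + 2)) by rewrite ge_min lexx orbT.
  by rewrite ler_pdivlMr // => h; move: h; only_lra.
(* The rate of [V - U * x] along a carrying curve. At [(t0, x0)] the terms with [f'] cancel and
   [M0 - f U] remains. *)
pose H (z : R * R) := u z * f' (u z) - f (u z) + Pg z - U * f' (u z).
have cH : continuous H.
  have c1 : continuous (fun z => f' (u z)) by move=> z; apply: continuous_comp; [exact: cu | exact: cf'].
  have c2 : continuous (fun z => f (u z)).
    by move=> z; apply: continuous_comp; [exact: cu | exact: has_deriv_cont (df _)].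
  move=> z; apply: cvgB; last by apply: cvgM; [exact: cvg_cst | exact: c1].
  apply: cvgD; last exact: cPg.
  by apply: cvgB; [apply: cvgM; [exact: cu | exact: c1] | exact: c2].
have eh0 : 0 < e / 2 by lra.
have /continuousP2/(_ _ eh0)[r1 r10 H1] := cH (t0, x0).
have /continuousP2/(_ _ e20)[r2 r20 H2] := cu (t0, x0).
pose rr := Num.min r1 r2; have rr0 : 0 < rr by rewrite lt_min r10.
have rr1 : rr <= r1 by rewrite ge_min lexx.
have rr2 : rr <= r2 by rewrite ge_min lexx orbT.
clearbody rr.
pose r := Num.min 1 (Num.min rr (rr / (L + 1))).
have L1 : 0 < L + 1 by lra.
exists r; first by rewrite !lt_min ltr01 rr0 divr_gt0.
move=> s; rewrite !lt_min => /and3P[s1 srr]; rewrite ltr_pdivlMr // => sL.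
have [->|st] := eqVneq s t0; first by rewrite !subrr mulr0 subr0 normr0 mulr0.
pose d := `|s - t0|; have d0 : 0 < d by rewrite normr_gt0 subr_eq0.
rewrite -/d in s1 srr sL *.
(* No carrying curve need pass through [(t0, x0)]. One is chosen for each [s], at a distance smaller
   than the time increment [d]. *)
have [_ _ _ /(_ t0 x0 d d0)[gam cgam hgam]] := lat.
have dL : d <= d * (L + 1) by rewrite ler_peMr ?(ltW d0) //; lra.
have u0 : `|u (t0, gam t0)| <= `|U| + 1.
  have : `|u (t0, gam t0) - U| <= e2.
    by apply: H2; rewrite ?subrr ?normr0 //; apply: (lt_trans hgam); apply: lt_le_trans rr2.
  by have := ler_norm U; have := ler_norm (- U); rewrite normrN; move: e21; only_lra.
have near v : (t0 <= v <= s) || (s <= v <= t0) -> `|v - t0| <= d /\ `|gam v - x0| <= d * (L + 1).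
  move=> hv; have vd : `|v - t0| <= d.
    by have := ler_norm (s - t0); have := ler_norm (- (s - t0)); rewrite normrN -/d; case/orP: hv; only_lra.
  split=> //; have := HL gam t0 v cgam u0 (le_trans vd (ltW s1)).
  have : L * `|v - t0| <= L * d by rewrite ler_wpM2l // ltW.
  by move: hgam; rewrite mulrDr mulr1 [d * L]mulrC; only_lra.
have [J _ dJ] := exists_antideriv (fc _ cgam).
have bal := @curve_balance R f f' u g Pu Pg g0 gam J0 J t0 s df cf' cu cg cPg dPu dPg lat c0 cgam dJ0 dJ.
have VJ : V (s, gam s) - V (t0, gam t0) = J s - J t0 by rewrite /V /=; move: bal; only_lra.
have B1 : `|(J s - U * gam s - (M0 - f U) * s) - (J t0 - U * gam t0 - (M0 - f U) * t0)| <= e / 2 * d.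
  apply: (@MVT_abs _ (fun v => J v - U * gam v - (M0 - f U) * v) (fun v => H (v, gam v) - (M0 - f U))) => v hv.
    apply: (has_deriv_eq (has_derivB (has_derivB (dJ v) (has_derivM (has_deriv_cst U v) (cgam v).1))
      (has_derivM (has_deriv_cst (M0 - f U) v) (has_deriv_id v)))).
    by rewrite /flux_along /H; ring.
  have [n1 n2] := near v hv.
  have <- : H (t0, x0) = M0 - f U by rewrite /H -/U -/M0; ring.
  by apply: H1; [lra | lra].
have osc v x y : (t0 <= v <= s) || (s <= v <= t0) -> `|x - x0| <= d * (L + 1) -> `|y - x0| <= d * (L + 1) ->
    `|(V (v, x) - U * x) - (V (v, y) - U * y)| <= e2 * `|x - y|.
  move=> hv hx hy; apply: (@MVT_abs _ (fun z => V (v, z) - U * z) (fun z => u (v, z) - U)) => z hz.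
    apply: (has_deriv_eq (has_derivB (dV v z) (has_derivM (has_deriv_cst U z) (has_deriv_id z)))).
    by rewrite mul0r add0r mulr1.
  have [n1 _] := near v hv.
  apply: H2; first by apply: (le_lt_trans n1); apply: lt_le_trans rr2.
  apply: (lt_le_trans _ rr2); apply: le_lt_trans sL.
  by case/orP: hz; move: hx hy; only_lra.
have zs : (t0 <= s <= s) || (s <= s <= t0) by rewrite !lexx andbT /= le_total.
have zt : (t0 <= t0 <= s) || (s <= t0 <= t0) by rewrite !lexx andbT /= le_total.
have x00 : `|x0 - x0| <= d * (L + 1) by rewrite subrr normr0; lra.
have B2 := osc s _ _ zs (near s zs).2 x00.
have B3 := osc t0 _ _ zt (near t0 zt).2 x00.
have B4 : e2 * `|gam s - x0| <= e2 * (d * (L + 1)).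
  by rewrite ler_wpM2l ?(ltW e20) //; exact: (near s zs).2.
have B5 : e2 * `|gam t0 - x0| <= e2 * d by rewrite ler_wpM2l ?(ltW e20) // ltW.
have B6 : e2 * (d * (L + 1)) + e2 * d <= e / 4 * d.
  have -> : e2 * (d * (L + 1)) + e2 * d = e2 * (L + 2) * d by ring.
  by rewrite ler_wpM2r // ltW.
have ed : 0 < e * d by rewrite mulr_gt0.
move: B1 B2 B3 B4 B5 B6 VJ ed; only_lra.
Qed.

(** * Integrals over the plane *)

(** The sigma-algebra is the product one, so open preimages have to be written as countable unions
    of boxes; those with rational centres and radii are enough. *)
Lemma continuous_measurable2 (R : realType) (F : R * R -> R) : continuous F ->
  measurable_fun [set: measurableTypeR R * measurableTypeR R] F.
Proof.
move=> cF; apply: (measurability _ (RGenOInfty.measurableE R)).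
move=> /= _ [_ [a ->]] <-; rewrite setTI.
pose box (q : rat * rat * rat) := ball (ratr q.1.1 : R) (ratr q.2) `*` ball (ratr q.1.2 : R) (ratr q.2).
pose B q := if `[< box q `<=` F @^-1` `]a, +oo[ >] then box q else set0.
have -> : F @^-1` `]a, +oo[ = \bigcup_q B q.
  apply/seteqP; split=> [[t x]|z [q _]]; last by rewrite /B; case: asboolP => // H /H.
  rewrite /= in_itv /= andbT => az.
  have e0 : 0 < (F (t, x) - a) / 2 by lra.
  have /continuousP2/(_ _ e0)[r r0 Hr] := cF (t, x).
  have r20 : 0 < r / 2 by lra.
  have [p /=] := rat_in_itvoo r20; rewrite in_itv /= => /andP[p0 pr].
  have tp : t < t + ratr p by rewrite ltrDl.
  have [q1] := rat_in_itvoo tp.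
  rewrite in_itv /= => /andP[a1 a2].
  have xp : x < x + ratr p by rewrite ltrDl.
  have [q2] := rat_in_itvoo xp.
  rewrite in_itv /= => /andP[b1 b2].
  exists (q1, q2, p) => //; rewrite /B; case: asboolP => [_|].
    by split; rewrite /= -ball_normE /= ltr_norml; lra.
  case=> -[s y] [/=]; rewrite -!ball_normE /= => h1 h2; rewrite in_itv /= andbT.
  have := Hr s y.
  have h3 : `|s - t| < r by move: h1 a1 a2 pr; only_lra.
  have h4 : `|y - x| < r by move: h2 b1 b2 pr; only_lra.
  by move=> /(_ h3 h4); move: az; only_lra.
apply: countable_bigcupT_measurable => [|q]; first exact: countableP.
rewrite /B; case: asboolP => // _.
by apply: measurableX; apply: open_measurable; exact: ball_open.
Qed.

(** The inequalities are not strict, so that boundary terms at [A] and [- A] vanish at once. *)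
Definition vanishes_off (R : realType) (A : R) (F : R * R -> R) : Prop :=
  forall t x, A <= `|t| \/ A <= `|x| -> F (t, x) = 0.

Lemma integrable_vanishing (R : realType) (F : R * R -> R) (A : R) :
  continuous F -> vanishes_off A F ->
  (@lebesgue_measure R \x @lebesgue_measure R)%E.-integrable setT (EFin \o F).
Proof.
move=> cF vF; have [C C0 HC] := bounded_box A cF.
pose D : set (measurableTypeR R * measurableTypeR R) := `[- A, A]%classic `*` `[- A, A]%classic.
have mD : measurable D by apply: measurableX.
apply: (@le_integrable _ _ _ _ _ measurableT _ (fun z => (C * \1_D z)%:E)).
- by apply/measurable_EFinP; exact: continuous_measurable2.
- move=> [t x] _ /=; rewrite lee_fin.
  have [zD|zD] := boolP ((t, x) \in D).
    rewrite indicE zD mulr1 (ger0_norm (ltW C0)).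
    move: zD; rewrite in_setE /D /= !in_itv /= -!ler_norml => -[h1 h2]; exact: HC.
  rewrite vF ?normr0 //.
  move: zD; rewrite notin_setE /D /= !in_itv /= -!ler_norml => h.
  have [h1|h1] := leP A `|t|; first by left.
  by right; rewrite leNgt; apply/negP => h2; apply: h; split; exact: ltW.
- apply: (@eq_integrable _ _ _ _ _ measurableT (fun z => (C%:E * (\1_D z)%:E)%E)) => //.
  apply: integrableZl => //; apply/integrableP; split; first exact/measurable_EFinP.
  rewrite (eq_integral (fun z => (\1_D z)%:E)); last first.
    by move=> z _; rewrite gee0_abs // lee_fin.
  rewrite integral_indic // setIT.
  have mI : measurable (`[- A, A]%classic : set (measurableTypeR R)) by [].
  have E := product_measure1E (@lebesgue_measure R) (@lebesgue_measure R) mI mI.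
  have [r Er] : exists r : R, @lebesgue_measure R `[- A, A]%classic = r%:E.
    by rewrite lebesgue_measure_itv /=; case: ifP => _; [exists (A - - A); rewrite EFinB | exists 0].
  have E2 := etrans E (congr1 (fun z => (z * z)%E) Er).
  suff : ((@lebesgue_measure R \x @lebesgue_measure R)%E D < +oo)%E by [].
  by rewrite /D E2 -EFinM ltry.
Qed.

Lemma integral_vanishing (R : realType) (phi H : R -> R) (A : R) : 0 < A ->
  continuous phi -> (forall x, A <= `|x| -> phi x = 0) ->
  (forall x, has_deriv H x (phi x)) ->
  (\int[lebesgue_measure]_x (phi x)%:E)%E = (H A - H (- A))%:E.
Proof.
move=> A0 cphi v dH.
have AA : - A < A by lra.
rewrite EFinB -(@continuous_FTC2 R phi H (- A) A AA) //.
- rewrite [RHS]integral_mkcond; apply: eq_integral => x _.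
  rewrite patchE; case: ifPn => // /negP xA; rewrite v // leNgt.
  by apply/negP; rewrite ltr_norml => h; apply: xA; rewrite in_setE /= in_itv /= !ltW //; lra.
- exact: continuous_subspaceT.
- have cH x : {for x, continuous H} by exact: has_deriv_cont (dH x).
  split.
  + by move=> x _; have [] := has_deriv_is_derive (dH x).
  + exact: cvg_at_right_filter (cH _).
  + exact: cvg_at_left_filter (cH _).
- by move=> x _; have [_ <-] := has_deriv_is_derive (dH x); rewrite derive1E.
Qed.

Lemma continuous_slice_t (R : realType) (F : R * R -> R) (x : R) :
  continuous F -> continuous (fun t => F (t, x)).
Proof. by move=> /continuous_swap cF; exact: (continuous_slice cF (t := x)). Qed.

Lemma plane_integral_xt (R : realType) (F H : R * R -> R) (A : R) : 0 < A ->
  continuous F -> vanishes_off A F ->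
  (forall t x, has_deriv (fun y => H (t, y)) x (F (t, x))) ->
  \int[(lebesgue_measure \x lebesgue_measure)%E]_z F z =
  \int[lebesgue_measure]_t (H (t, A) - H (t, - A)).
Proof.
move=> A0 cF vF dH; rewrite /Rintegral; congr fine.
rewrite -(integral12_prod_meas1 (integrable_vanishing cF vF)).
apply: eq_integral => t _; rewrite /fubini_F /=.
apply: (@integral_vanishing _ (fun x => F (t, x)) (fun x => H (t, x))) => //.
  exact: continuous_slice.
by move=> x Ax; apply: vF; right.
Qed.

Lemma plane_integral_tx (R : realType) (F H : R * R -> R) (A : R) : 0 < A ->
  continuous F -> vanishes_off A F ->
  (forall t x, has_deriv (fun s => H (s, x)) t (F (t, x))) ->
  \int[(lebesgue_measure \x lebesgue_measure)%E]_z F z =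
  \int[lebesgue_measure]_x (H (A, x) - H (- A, x)).
Proof.
move=> A0 cF vF dH; rewrite /Rintegral; congr fine.
rewrite -(integral21_prod_meas1 (integrable_vanishing cF vF)).
apply: eq_integral => x _; rewrite /fubini_G /=.
apply: (@integral_vanishing _ (fun t => F (t, x)) (fun t => H (t, x))) => //.
  exact: continuous_slice_t.
by move=> t At; apply: vF; left.
Qed.

Lemma plane_integral_dx0 (R : realType) (F H : R * R -> R) (A : R) : 0 < A ->
  continuous F -> vanishes_off A F -> vanishes_off A H ->
  (forall t x, has_deriv (fun y => H (t, y)) x (F (t, x))) ->
  \int[(lebesgue_measure \x lebesgue_measure)%E]_z F z = 0.
Proof.
move=> A0 cF vF vH dH; rewrite (plane_integral_xt A0 cF vF dH).
under eq_Rintegral => t _.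
  rewrite !vH ?subrr; first over.
  - by right; rewrite normrN ler_norm.
  - by right; rewrite ler_norm.
by rewrite Rintegral_cst // mul0r.
Qed.

Lemma plane_integral_dt0 (R : realType) (F H : R * R -> R) (A : R) : 0 < A ->
  continuous F -> vanishes_off A F -> vanishes_off A H ->
  (forall t x, has_deriv (fun s => H (s, x)) t (F (t, x))) ->
  \int[(lebesgue_measure \x lebesgue_measure)%E]_z F z = 0.
Proof.
move=> A0 cF vF vH dH; rewrite (plane_integral_tx A0 cF vF dH).
under eq_Rintegral => t _.
  rewrite !vH ?subrr; first over.
  - by left; rewrite normrN ler_norm.
  - by left; rewrite ler_norm.
by rewrite Rintegral_cst // mul0r.
Qed.

Lemma plane_integralD (R : realType) (F1 F2 : R * R -> R) (A : R) :
  continuous F1 -> continuous F2 -> vanishes_off A F1 -> vanishes_off A F2 ->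
  \int[(lebesgue_measure \x lebesgue_measure)%E]_z (F1 z + F2 z) =
  \int[(lebesgue_measure \x lebesgue_measure)%E]_z F1 z +
  \int[(lebesgue_measure \x lebesgue_measure)%E]_z F2 z.
Proof.
by move=> c1 c2 v1 v2; apply: RintegralD => //;
  [exact: integrable_vanishing c1 v1 | exact: integrable_vanishing c2 v2].
Qed.

Lemma plane_integralZ (R : realType) (F : R * R -> R) (c A : R) :
  continuous F -> vanishes_off A F ->
  \int[(lebesgue_measure \x lebesgue_measure)%E]_z (c * F z) =
  c * \int[(lebesgue_measure \x lebesgue_measure)%E]_z F z.
Proof. by move=> cF vF; apply: RintegralZl => //; exact: integrable_vanishing cF vF. Qed.

(** * Test functions *)

Lemma derivable_has_deriv (R : realType) (F : R -> R) (t : R) :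
  derivable F t 1 -> has_deriv F t (derive1 F t).
Proof. by move=> /derivableP h; apply: is_derive_has_deriv; rewrite derive1E. Qed.

Lemma has_deriv_derivable (R : realType) (F : R -> R) (t d : R) :
  has_deriv F t d -> derivable F t 1 /\ derive1 F t = d.
Proof. by move=> /has_deriv_is_derive[h1 h2]; rewrite derive1E. Qed.

(** The second difference over a square of side [h] is [h * h] times each mixed derivative at some
    point of the square; continuity concludes as the square shrinks. *)
Lemma schwarz (R : realType) (F Ft Fx Ftx Fxt : R * R -> R) :
  (forall t x, has_deriv (fun s => F (s, x)) t (Ft (t, x))) ->
  (forall t x, has_deriv (fun y => F (t, y)) x (Fx (t, x))) ->
  (forall t x, has_deriv (fun y => Ft (t, y)) x (Ftx (t, x))) ->
  (forall t x, has_deriv (fun s => Fx (s, x)) t (Fxt (t, x))) ->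
  continuous Ftx -> continuous Fxt -> Ftx = Fxt.
Proof.
move=> dt dx dtx dxt ctx cxt; apply/funext => -[t x].
apply/eqP; rewrite -subr_eq0 -normr_le0; apply/ler_addgt0Pr => e e0; rewrite add0r.
have e20 : 0 < e / 2 by lra.
have /continuousP2/(_ _ e20)[r1 r10 H1] := ctx (t, x).
have /continuousP2/(_ _ e20)[r2 r20 H2] := cxt (t, x).
pose h := Num.min r1 r2 / 2.
have h0 : 0 < h by rewrite divr_gt0 // lt_min r10.
have hh : h + h = Num.min r1 r2 by rewrite /h; field.
have h1 : h + h <= r1 by rewrite hh ge_min lexx.
have h2 : h + h <= r2 by rewrite hh ge_min lexx orbT.
have th : t <= t + h by lra.
have xh : x <= x + h by lra.
have [s1 s1t E1] := MVT_has_deriv th (fun s _ => has_derivB (dt s (x + h)) (dt s x)).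
have [y1 y1x E2] := MVT_has_deriv xh (fun y _ => dtx s1 y).
have [y2 y2x E3] := MVT_has_deriv xh (fun y _ => has_derivB (dx (t + h) y) (dx t y)).
have [s2 s2t E4] := MVT_has_deriv th (fun s _ => dxt s y2).
have a1 : `|Ftx (s1, y1) - Ftx (t, x)| <= e / 2 by apply: H1; move: s1t y1x h1 h0; only_lra.
have a2 : `|Fxt (s2, y2) - Fxt (t, x)| <= e / 2 by apply: H2; move: s2t y2x h2 h0; only_lra.
have EE : Ftx (s1, y1) = Fxt (s2, y2).
  have hn : h * h != 0 by rewrite mulf_neq0 // gt_eqF.
  apply: (mulIf hn).
  have k1 : x + h - x = h by ring.
  have k2 : t + h - t = h by ring.
  rewrite k1 k2 in E1 E2 E3 E4; rewrite E2 in E1; rewrite E4 in E3.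
  by move: E1 E3; only_lra.
by move: a1 a2; rewrite EE; only_lra.
Qed.

Lemma test_function_bound (R : realType) (phi : R * R -> R) : test_function phi ->
  exists2 A : R, 0 < A & forall t x, A < `|t| \/ A < `|x| -> phi (t, x) = 0.
Proof.
move=> [_ /compact_bounded[B [_ HB]]].
exists (`|B| + 1); first by rewrite ltr_wpDl.
move=> t x h; apply/eqP; apply: contrapT => /negP p0.
have : `|(t, x)| <= `|B| + 1.
  apply: HB; last by apply: subset_closure.
  by rewrite (le_lt_trans (ler_norm B)) // ltrDl.
by rewrite prod_normE /= ge_max => /andP[a b]; case: h => h; lra.
Qed.

(** The strict inequalities describe an open set, so vanishing there passes to the derivatives. *)
Lemma iter_partial_vanish (R : realType) (phi : R * R -> R) (A : R) (w : seq bool) :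
  (forall t x, A < `|t| \/ A < `|x| -> phi (t, x) = 0) ->
  forall t x, A < `|t| \/ A < `|x| -> iter_partial w phi (t, x) = 0.
Proof.
move=> v; elim: w => [|b w IH] t x h; first exact: v.
have zero (F : R -> R) (s r : R) : 0 < r -> (forall s', `|s' - s| < r -> F s' = 0) -> derive1 F s = 0.
  move=> r0 H; apply: (has_deriv_derivable _).2.
  apply: (has_deriv_near r0 _ (has_deriv_cst 0 s)) => s' hs; by rewrite H.
have push (a s : R) : A < `|a| -> `|s - a| < `|a| - A -> A < `|s|.
  move=> ha hs; have := ler_normB s (s - a); have -> : s - (s - a) = a by ring.
  by move: hs; lra.
case: b; rewrite /= /partial_t /partial_x /=; case: h => h.
- by apply: (zero _ _ (`|t| - A)); [lra | move=> s hs; apply: IH; left; exact: push hs].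
- by apply: (zero _ _ 1) => // s _; apply: IH; right.
- by apply: (zero _ _ 1) => // s _; apply: IH; left.
- by apply: (zero _ _ (`|x| - A)); [lra | move=> s hs; apply: IH; right; exact: push hs].
Qed.

Lemma smooth_partial (R : realType) (phi : R * R -> R) (w : seq bool) : smooth phi ->
  [/\ continuous (iter_partial w phi),
      forall t x, has_deriv (fun s => iter_partial w phi (s, x)) t (iter_partial (true :: w) phi (t, x)) &
      forall t x, has_deriv (fun y => iter_partial w phi (t, y)) x (iter_partial (false :: w) phi (t, x))].
Proof.
move=> /(_ w)[c dt dx]; split=> // t x; apply: derivable_has_deriv; [exact: dt (t, x) | exact: dx (t, x)].
Qed.

Lemma vanishes_offD (R : realType) (A : R) (a b : R * R -> R) :
  vanishes_off A a -> vanishes_off A b -> vanishes_off A (fun z => a z + b z).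
Proof. by move=> va vb t x h; rewrite (va t x h) (vb t x h) addr0. Qed.

Lemma vanishes_offM (R : realType) (A : R) {a b : R * R -> R} :
  vanishes_off A b -> vanishes_off A (fun z => a z * b z).
Proof. by move=> vb t x h; rewrite (vb t x h) mulr0. Qed.

Lemma continuousD2 (R : realType) (a b : R * R -> R) :
  continuous a -> continuous b -> continuous (fun z => a z + b z).
Proof. by move=> ca cb z; apply: cvgD; [exact: ca | exact: cb]. Qed.

Lemma continuousB2 (R : realType) (a b : R * R -> R) :
  continuous a -> continuous b -> continuous (fun z => a z - b z).
Proof. by move=> ca cb z; apply: cvgB; [exact: ca | exact: cb]. Qed.

Lemma continuousM2 (R : realType) (a b : R * R -> R) :
  continuous a -> continuous b -> continuous (fun z => a z * b z).
Proof. by move=> ca cb z; apply: cvgM; [exact: ca | exact: cb]. Qed.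

(* The difference of the two sides integrates d/dx (V pt + M phi) - d/dt (N px). *)
Lemma plane_integral_mixed (R : realType) (fu u g V N M phi pt px ptx : R * R -> R) (A : R) :
  continuous u -> continuous g -> continuous fu ->
  continuous V -> continuous N -> continuous M ->
  continuous phi -> continuous pt -> continuous px -> continuous ptx -> 0 < A ->
  vanishes_off A phi -> vanishes_off A pt -> vanishes_off A px -> vanishes_off A ptx ->
  (forall t x, has_deriv (fun y => V (t, y)) x (u (t, x))) ->
  (forall t x, has_deriv (fun s => N (s, x)) t (M (t, x) - fu (t, x))) ->
  (forall t x, has_deriv (fun y => M (t, y)) x (g (t, x))) ->
  (forall t x, has_deriv (fun y => phi (t, y)) x (px (t, x))) ->
  (forall t x, has_deriv (fun y => pt (t, y)) x (ptx (t, x))) ->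
  (forall t x, has_deriv (fun s => px (s, x)) t (ptx (t, x))) ->
  \int[(lebesgue_measure \x lebesgue_measure)%E]_z (u z * pt z) +
  \int[(lebesgue_measure \x lebesgue_measure)%E]_z (fu z * px z) +
  \int[(lebesgue_measure \x lebesgue_measure)%E]_z (g z * phi z) =
  \int[(lebesgue_measure \x lebesgue_measure)%E]_z ((N z - V z) * ptx z).
Proof.
move=> cu cg cfu cV cN cM c0 ct cx ctx A0 v0 vt vx vtx Vx Nt Mx dx0 dxt dtx.
pose F1 z := u z * pt z; pose F2 z := fu z * px z; pose F3 z := g z * phi z.
pose F0 z := (N z - V z) * ptx z.
pose Dx z := u z * pt z + V z * ptx z + (g z * phi z + M z * px z).
pose Dt z := (M z - fu z) * px z + N z * ptx z.
pose Dn z := -1 * Dt z.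
have c1 : continuous F1 := continuousM2 cu ct.
have c2 : continuous F2 := continuousM2 cfu cx.
have c3 : continuous F3 := continuousM2 cg c0.
have cF0 : continuous F0 := continuousM2 (continuousB2 cN cV) ctx.
have cDx : continuous Dx :=
  continuousD2 (continuousD2 c1 (continuousM2 cV ctx)) (continuousD2 c3 (continuousM2 cM cx)).
have cDt : continuous Dt :=
  continuousD2 (continuousM2 (continuousB2 cM cfu) cx) (continuousM2 cN ctx).
have cm1 : continuous (fun _ : R * R => -1 : R) by move=> z; exact: cvg_cst.
have cDn : continuous Dn := continuousM2 cm1 cDt.
have v1 : vanishes_off A F1 := vanishes_offM vt.
have v2 : vanishes_off A F2 := vanishes_offM vx.
have v3 : vanishes_off A F3 := vanishes_offM v0.
have vF0 : vanishes_off A F0 := vanishes_offM vtx.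
have vDx : vanishes_off A Dx :=
  vanishes_offD (vanishes_offD v1 (vanishes_offM vtx)) (vanishes_offD v3 (vanishes_offM vx)).
have vDt : vanishes_off A Dt := vanishes_offD (vanishes_offM vx) (vanishes_offM vtx).
have vDn : vanishes_off A Dn := vanishes_offM vDt.
pose Hx z := V z * pt z + M z * phi z.
have vHx : vanishes_off A Hx := vanishes_offD (vanishes_offM vt) (vanishes_offM v0).
have dHx t x : has_deriv (fun y => Hx (t, y)) x (Dx (t, x)).
  exact: (has_derivD (has_derivM (Vx t x) (dxt t x)) (has_derivM (Mx t x) (dx0 t x))).
have IDx := plane_integral_dx0 A0 cDx vDx vHx dHx.
pose Ht z := N z * px z.
have vHt : vanishes_off A Ht := vanishes_offM vx.
have dHt t x : has_deriv (fun s => Ht (s, x)) t (Dt (t, x)).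
  exact: (has_derivM (Nt t x) (dtx t x)).
have IDt := plane_integral_dt0 A0 cDt vDt vHt dHt.
have E : (fun z => F1 z + F2 z + F3 z) = (fun z => F0 z + (Dx z + Dn z)).
  by apply/funext => z; rewrite /F1 /F2 /F3 /F0 /Dn /Dx /Dt; ring.
have := congr1 (fun F => \int[(lebesgue_measure \x lebesgue_measure)%E]_z F z) E.
rewrite (plane_integralD (continuousD2 c1 c2) c3 (vanishes_offD v1 v2) v3) (plane_integralD c1 c2 v1 v2).
rewrite (plane_integralD cF0 (continuousD2 cDx cDn) vF0 (vanishes_offD vDx vDn)) (plane_integralD cDx cDn vDx vDn).
by rewrite (plane_integralZ (-1) cDt vDt) IDx IDt mulr0 !addr0.
Qed.

(** Used in both directions: with [N = V] the right-hand side is 0, and conversely a weak solution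
    makes [N - V] orthogonal to all mixed derivatives of test functions. *)
Lemma weak_form_mixed (R : realType) (f f' : R -> R) (u g V N M phi : R * R -> R) :
  (forall x, has_deriv f x (f' x)) -> continuous u -> continuous g ->
  continuous V -> continuous N -> continuous M ->
  (forall t x, has_deriv (fun y => V (t, y)) x (u (t, x))) ->
  (forall t x, has_deriv (fun s => N (s, x)) t (M (t, x) - f (u (t, x)))) ->
  (forall t x, has_deriv (fun y => M (t, y)) x (g (t, x))) ->
  test_function phi ->
  distr_of u (partial_t phi) + distr_of (f \o u) (partial_x phi) + distr_of g phi =
  \int[(lebesgue_measure \x lebesgue_measure)%E]_z
     ((N z - V z) * iter_partial [:: false; true] phi z).
Proof.
move=> df cu cg cV cN cM Vx Nt Mx tphi; have [sm _] := tphi.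
have [A A0 vphi] := test_function_bound tphi.
(* The 1 passes from vanishing beyond [A] in the strict sense to the non-strict convention of
   [vanishes_off]. *)
have vw w : vanishes_off (A + 1) (iter_partial w phi).
  by move=> t x h; apply: (iter_partial_vanish w vphi); case: h => h; [left | right]; lra.
have A10 : 0 < A + 1 by lra.
have [c0 dt0 dx0] := smooth_partial [::] sm.
have [ct _ dxt] := smooth_partial [:: true] sm.
have [cx dtx _] := smooth_partial [:: false] sm.
have [ctx _ _] := smooth_partial [:: false; true] sm.
have [cxt _ _] := smooth_partial [:: true; false] sm.
have sch := schwarz dt0 dx0 dxt dtx ctx cxt.
rewrite -sch in dtx.
have cfu : continuous (f \o u) by move=> z; apply: continuous_comp; [exact: cu | exact: has_deriv_cont (df _)].
exact: (plane_integral_mixed cu cg cfu cV cN cM c0 ct cx ctx A10 (vw [::]) (vw [:: true])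
  (vw [:: false]) (vw [:: false; true]) Vx Nt Mx dx0 dxt dtx).
Qed.

(** * Smooth bumps *)

(* The family k |-> x^(-k) exp(-1/x) is closed under differentiation up to linear combinations. *)
Definition flat_exp (R : realType) (k : nat) (x : R) : R :=
  if 0 < x then expR (- x^-1) * x^-1 ^+ k else 0.

(** With y = 1/x, exp(y) >= y^(k+2)/(k+2)!. Two powers more than [k] leave the factor [x ^+ 2],
    which makes the derivative at 0 vanish. *)
Lemma flat_exp_bound (R : realType) (k : nat) (x : R) :
  `|flat_exp k x| <= k.+2`!%:R * x ^+ 2.
Proof.
rewrite /flat_exp; case: ifPn => x0; last by rewrite normr0 mulr_ge0 ?sqr_ge0.
have y0 : 0 < x^-1 by rewrite invr_gt0.
rewrite ger0_norm ?mulr_ge0 ?exprn_ge0 ?expR_ge0 ?(ltW y0) // expRN -ler_pdivlMl;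
  last by rewrite invr_gt0 expR_gt0.
rewrite invrK; have := expR_ge1Dxn k.+1 (ltW y0); set E := expR _ => HE.
have f0 : 0 < k.+2`!%:R :> R by rewrite ltr0n fact_gt0.
have HE2 : x^-1 ^+ k.+2 / k.+2`!%:R <= E by lra.
apply: (@le_trans _ _ (x^-1 ^+ k.+2 / k.+2`!%:R * (k.+2`!%:R * x ^+ 2))).
  have x1 : x != 0 by rewrite gt_eqF.
  have f1 : k.+2`!%:R != 0 :> R by rewrite gt_eqF.
  suff -> : x^-1 ^+ k.+2 / k.+2`!%:R * (k.+2`!%:R * x ^+ 2) = x^-1 ^+ k by [].
  rewrite mulrA divfK // -addn2 exprD -mulrA -exprMn mulVf // expr1n mulr1 //.
by apply: ler_wpM2r => //; rewrite mulr_ge0 ?sqr_ge0 // ltW.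
Qed.

Lemma has_deriv_expr (R : realType) (F : R -> R) (t a : R) (n : nat) :
  has_deriv F t a -> has_deriv (fun s => F s ^+ n) t (n%:R * F t ^+ n.-1 * a).
Proof.
move=> dF; elim: n => [|n IH].
  by apply: has_deriv_eq (has_deriv_cst 1 t) _; rewrite !mul0r.
have E : (fun s => F s ^+ n.+1) = (fun s => F s * F s ^+ n) by apply/funext => s; rewrite exprS.
rewrite E; apply: has_deriv_eq (has_derivM dF IH) _ => /=.
by case: n {IH E} => [|n] /=; rewrite ?expr0 -?natr1 ?exprS; ring.
Qed.

Lemma has_deriv_inv (R : realType) (t : R) : t != 0 ->
  has_deriv (fun s : R => s^-1) t (- t^-1 ^+ 2).
Proof.
move=> t0; apply: is_derive_has_deriv.
apply: is_derive_eq; first exact: is_deriveV.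
by rewrite /GRing.scale /= mulr1 exprVn.
Qed.

Lemma has_deriv_flat_exp (R : realType) (k : nat) (x : R) :
  has_deriv (flat_exp k) x (flat_exp k.+2 x - k%:R * flat_exp k.+1 x).
Proof.
have [x0|x0|x0] := ltgtP x 0.
- have r0 : 0 < - x by lra.
  apply: (has_deriv_near r0 _ (has_deriv_eq (has_deriv_cst 0 x) _)); last first.
    by rewrite /flat_exp ltNge (ltW x0) mulr0 subr0.
  by move=> s hs; rewrite /flat_exp ifF //; apply/negbTE; rewrite -leNgt; move: hs; only_lra.
- apply: (has_deriv_near x0 (F := fun y => expR (- y^-1) * y^-1 ^+ k)).
    by move=> s hs; rewrite /flat_exp ifT //; move: hs; only_lra.
  have dV := has_deriv_inv (lt0r_neq0 x0).
  have dE : has_deriv expR (- x^-1) (expR (- x^-1)).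
    by apply: is_derive_has_deriv; exact: is_derive_expR.
  have dC := @has_deriv_comp _ expR (fun s => - s^-1) x _ _ dE (has_derivN dV).
  apply: has_deriv_eq (has_derivM dC (has_deriv_expr k dV)) _.
  rewrite /flat_exp x0; set y := x^-1; set E := expR _.
  by case: k => [|k] /=; rewrite ?exprS; ring.
- rewrite x0 => e e0; have f0 : 0 < k.+2`!%:R :> R by rewrite ltr0n fact_gt0.
  exists (e / k.+2`!%:R); first exact: divr_gt0.
  have z j : flat_exp j (0 : R) = 0 by rewrite /flat_exp ltxx.
  move=> s; rewrite !z mulr0 !subr0 mul0r subr0 => hs.
  apply: (le_trans (flat_exp_bound k s)).
  rewrite -real_normK ?num_real // expr2 mulrA ler_wpM2r //.
  by rewrite -ler_pdivlMl // mulrC ltW.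
Qed.

(* Existential derivatives make closure under sums and products a plain induction,
   with no explicit Leibniz formula. *)
Fixpoint diffn (R : realType) (n : nat) (F : R -> R) : Prop :=
  if n is m.+1 then exists2 F' : R -> R, (forall x, has_deriv F x (F' x)) & diffn m F'
  else True.

Lemma diffn_cst (R : realType) (c : R) (n : nat) : diffn n (fun=> c).
Proof. by elim: n c => //= n IH c; exists (fun=> 0) => // x; exact: has_deriv_cst. Qed.

Lemma diffnW (R : realType) (n : nat) (F : R -> R) : diffn n.+1 F -> diffn n F.
Proof. by elim: n F => // n IH F [F' dF /IH h]; exists F'. Qed.

Lemma diffnD (R : realType) (n : nat) (F G : R -> R) :
  diffn n F -> diffn n G -> diffn n (fun x => F x + G x).
Proof.
elim: n F G => //= n IH F G [F' dF hF] [G' dG hG].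
by exists (fun x => F' x + G' x); [move=> x; exact: has_derivD | exact: IH].
Qed.

Lemma diffnM (R : realType) (n : nat) (F G : R -> R) :
  diffn n F -> diffn n G -> diffn n (fun x => F x * G x).
Proof.
elim: n F G => // n IH F G hF hG; have [F' dF hF'] := hF; have [G' dG hG'] := hG.
exists (fun x => F' x * G x + F x * G' x); first by move=> x; exact: has_derivM.
by apply: diffnD; apply: IH => //; exact: diffnW.
Qed.

Lemma diffn_affine (R : realType) (n : nat) (F : R -> R) (a b : R) :
  diffn n F -> diffn n (fun x => F (a + b * x)).
Proof.
elim: n F => // n IH F [F' dF hF]; exists (fun x => F' (a + b * x) * b).
  by move=> x; exact: has_deriv_comp (dF _) (has_deriv_affine a b x).
by apply: diffnM; [exact: IH | exact: diffn_cst].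
Qed.

Lemma diffn_flat_exp (R : realType) (n k : nat) : diffn n (@flat_exp R k).
Proof.
elim: n k => // n IH k; exists (fun x => flat_exp k.+2 x + - k%:R * flat_exp k.+1 x).
  by move=> x; apply: has_deriv_eq (has_deriv_flat_exp k x) _; rewrite mulNr.
by apply: diffnD => //; apply: diffnM => //; exact: diffn_cst.
Qed.

Lemma diffn_derive1n (R : realType) (F : R -> R) (n : nat) : diffn n.+1 F ->
  forall x, has_deriv (derive1n n F) x (derive1n n.+1 F x).
Proof.
elim: n F => [|n IH] F [F' dF hF].
  by move=> x; rewrite /= (has_deriv_derivable (dF x)).2; exact: dF.
have E : derive1 F = F' by apply/funext => x; exact: (has_deriv_derivable (dF x)).2.
by move=> x; rewrite (derive1Sn F n) (derive1Sn F n.+1) E; exact: IH.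
Qed.

Lemma iter_partial_tensor (R : realType) (F G : R -> R) (w : seq bool) :
  (forall n, diffn n F) -> (forall n, diffn n G) ->
  iter_partial w (fun z => F z.1 * G z.2) =
  (fun z => derive1n (count id w) F z.1 * derive1n (count negb w) G z.2).
Proof.
move=> hF hG; elim: w => //= b w IH; rewrite IH; apply/funext => z.
have dF := diffn_derive1n (hF (count id w).+1) z.1.
have dG := diffn_derive1n (hG (count negb w).+1) z.2.
case: b; rewrite /partial_t /partial_x /=; apply: (has_deriv_derivable _).2.
- by apply: has_deriv_eq (has_derivM dF (has_deriv_cst _ _)) _; rewrite mulr0 addr0.
- by apply: has_deriv_eq (has_derivM (has_deriv_cst _ _) dG) _; rewrite mul0r add0r.
Qed.

Lemma smooth_tensor (R : realType) (F G : R -> R) :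
  (forall n, diffn n F) -> (forall n, diffn n G) -> smooth (fun z => F z.1 * G z.2).
Proof.
move=> hF hG w; rewrite iter_partial_tensor //.
have dF t := diffn_derive1n (hF (count id w).+1) t.
have dG x := diffn_derive1n (hG (count negb w).+1) x.
split=> [[t x]|[t x]|[t x]] /=.
- apply: (@continuousM2 R (fun z => derive1n (count id w) F z.1) (fun z => derive1n (count negb w) G z.2)).
    by move=> z; apply: continuous_comp; [exact: cvg_fst | exact: has_deriv_cont (dF _)].
  by move=> z; apply: continuous_comp; [exact: cvg_snd | exact: has_deriv_cont (dG _)].
- exact: (has_deriv_derivable (has_derivM (dF t) (has_deriv_cst _ t))).1.
- exact: (has_deriv_derivable (has_derivM (has_deriv_cst _ x) (dG x))).1.
Qed.

Lemma test_function_tensor (R : realType) (F G : R -> R) (A : R) :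
  (forall n, diffn n F) -> (forall n, diffn n G) ->
  (forall t, A < `|t| -> F t = 0) -> (forall x, A < `|x| -> G x = 0) ->
  test_function (fun z => F z.1 * G z.2).
Proof.
move=> hF hG vF vG; split; first exact: smooth_tensor.
have cA := @compact_box R A.
have clA : closed ([set z | `|z.1| <= A /\ `|z.2| <= A] : set (R * R)).
  by apply: compact_closed cA; exact: norm_hausdorff.
apply: (@subclosed_compact _ _ _ _ cA); first exact: closed_closure.
move=> z hz; apply: clA; apply: closure_subset hz => -[t x] /= nz.
split; rewrite leNgt; apply/negP => h.
  by move/negP: nz; apply; rewrite vF // mul0r.
by move/negP: nz; apply; rewrite vG // mulr0.
Qed.

(** The product of exp(-1/(c - x)) and exp(-1/(c + x)) on the interval from [- c] to [c], and 0
    elsewhere; the arguments have the shape expected by [diffn_affine]. *)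
Definition bump (R : realType) (c x : R) : R :=
  flat_exp 0 (c + -1 * x) * flat_exp 0 (c + 1 * x).

Lemma bump_ge0 (R : realType) (c x : R) : 0 <= bump c x.
Proof. by rewrite /bump /flat_exp mulr_ge0 //; case: ifP => // _; rewrite mulr_ge0 ?expR_ge0 ?expr0. Qed.

Lemma bump_vanish (R : realType) (c x : R) : c <= `|x| -> bump c x = 0.
Proof.
rewrite /bump /flat_exp ler_normr => h; case: ifPn => h1; last by rewrite mul0r.
by case: ifPn => h2; [exfalso; move: h h1 h2; lra | rewrite mulr0].
Qed.

Lemma bump0_gt0 (R : realType) (c : R) : 0 < c -> 0 < bump c 0.
Proof. by move=> c0; rewrite /bump /flat_exp !mulr0 addr0 c0 !mulr_gt0 ?expr0 ?expR_gt0. Qed.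

Lemma diffn_bump (R : realType) (c : R) (n : nat) : diffn n (bump c).
Proof. by apply: diffnM; apply: diffn_affine; exact: diffn_flat_exp. Qed.

(** A smooth step, constant on either side of the support of the bump. The step is strict because
    the bump is nonnegative and positive at 0. *)
Lemma exists_bump_primitive (R : realType) (c : R) : 0 < c ->
  exists B : R -> R, [/\ forall x, has_deriv B x (bump c x),
    forall x, c <= x -> B x = B c, forall x, x <= - c -> B x = B (- c) & B (- c) < B c].
Proof.
move=> c0; have cb : continuous (bump c).
  by move=> x; have [b' db _] := diffn_bump c 1; exact: has_deriv_cont (db x).
have [B _ dB] := exists_antideriv cb; exists B; split=> //.
- move=> x cx; apply/eqP; rewrite -subr_eq0; apply/eqP.
  have [y cy ->] := MVT_has_deriv cx (fun y _ => dB y).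
  by rewrite bump_vanish ?mul0r // ler_normr; apply/orP; left; move: cy; lra.
- move=> x cx; apply/eqP; rewrite eq_sym -subr_eq0; apply/eqP.
  have [y cy ->] := MVT_has_deriv cx (fun y _ => dB y).
  by rewrite bump_vanish ?mul0r // ler_normr; apply/orP; right; move: cy; lra.
have mono x y : x <= y -> B x <= B y.
  move=> xy; have [z _ E] := MVT_has_deriv xy (fun y _ => dB y).
  by rewrite -subr_ge0 E mulr_ge0 ?bump_ge0 // subr_ge0.
have b0 := bump0_gt0 c0; have b20 : 0 < bump c 0 / 2 by lra.
have [r r0 Hr] := dB 0 _ b20.
pose s := Num.min (r / 2) c.
have s0 : 0 < s by rewrite /s lt_min c0 divr_gt0.
have sc : s <= c by rewrite /s ge_min lexx orbT.
have sr : s <= r / 2 by rewrite /s ge_min lexx.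
clearbody s; have := Hr s; rewrite subr0 (gtr0_norm s0) => /(_ ltac:(lra)).
rewrite ler_norml => /andP[h _].
have := mono _ _ sc; have c0' : - c <= 0 by lra.
have := mono _ _ c0'; have : 0 < bump c 0 / 2 * s by rewrite mulr_gt0.
move: h; have -> : bump c 0 / 2 * s = bump c 0 * s / 2 by field.
by only_lra.
Qed.

Lemma diffn_translate (R : realType) (n : nat) (F : R -> R) (a : R) :
  diffn n F -> diffn n (fun x => F (x - a)).
Proof.
move=> /(diffn_affine (- a) 1); congr diffn; apply/funext => x; congr F; ring.
Qed.

Lemma has_deriv_translate (R : realType) (F : R -> R) (a t d : R) :
  has_deriv F (t - a) d -> has_deriv (fun s => F (s - a)) t d.
Proof.
move=> dF;
  apply: has_deriv_eq (@has_deriv_comp _ F (fun s => s - a) t _ _ dF (has_derivB (has_deriv_id t) (has_deriv_cst a t))) _.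
by rewrite subr0 mulr1.
Qed.

(** * Averages against product bumps, and passage between weak form and potential *)

Definition kernel2 (R : realType) (c a y : R) (z : R * R) : R :=
  bump c (z.1 - a) * bump c (z.2 - y).

Lemma continuous_bump_translate (R : realType) (c a : R) : continuous (fun x => bump c (x - a)).
Proof. by move=> x; have [b' db _] := diffn_translate a (diffn_bump c 1); exact: has_deriv_cont (db x). Qed.

Lemma continuous_kernel2 (R : realType) (c a y : R) : continuous (kernel2 c a y).
Proof.
apply: (@continuousM2 R (fun z => bump c (z.1 - a)) (fun z => bump c (z.2 - y))) => z.
  by apply: (@continuous_comp _ _ _ fst (fun t => bump c (t - a)));
    [exact: cvg_fst | exact: continuous_bump_translate].
by apply: (@continuous_comp _ _ _ snd (fun t => bump c (t - y)));
  [exact: cvg_snd | exact: continuous_bump_translate].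
Qed.

Lemma bump_translate_vanish (R : realType) (c a x A : R) :
  `|a| + c <= A -> A <= `|x| -> bump c (x - a) = 0.
Proof.
move=> h1 h2; apply: bump_vanish; have := ler_normB x a; have := ler_distD a x 0.
by rewrite !subr0; lra.
Qed.

Lemma kernel2_vanish (R : realType) (c a y A : R) :
  `|a| + c <= A -> `|y| + c <= A -> vanishes_off A (kernel2 c a y).
Proof.
move=> ha hy t x [h|h]; rewrite /kernel2 /=.
  by rewrite (bump_translate_vanish ha h) mul0r.
by rewrite (bump_translate_vanish hy h) mulr0.
Qed.

(** The mass does not depend on the centre, so it factors out of combinations of kernels at
    different points. *)
Lemma kernel2_integral (R : realType) (B : R -> R) (c a y : R) : 0 < c ->
  (forall x, has_deriv B x (bump c x)) ->
  (forall x, c <= x -> B x = B c) -> (forall x, x <= - c -> B x = B (- c)) ->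
  \int[(lebesgue_measure \x lebesgue_measure)%E]_z kernel2 c a y z = (B c - B (- c)) ^+ 2.
Proof.
move=> c0 dB Bp Bm; pose A := `|a| + `|y| + c.
have a0 := normr_ge0 a; have y0 := normr_ge0 y.
have A0 : 0 < A by rewrite /A; lra.
have hA : `|a| + c <= A by rewrite /A; lra.
have hY : `|y| + c <= A by rewrite /A; lra.
have ay := ler_norm a; have yy := ler_norm y; have an := lerNnormlW (lexx `|a|).
have yn := lerNnormlW (lexx `|y|).
have dH t x : has_deriv (fun x => bump c (t - a) * B (x - y)) x (kernel2 c a y (t, x)).
  apply: has_deriv_eq (has_derivM (has_deriv_cst (bump c (t - a)) x) (has_deriv_translate (dB _))) _.
  by rewrite mul0r add0r.
rewrite (plane_integral_xt (H := fun z => bump c (z.1 - a) * B (z.2 - y)) A0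
  (@continuous_kernel2 R c a y) (kernel2_vanish hA hY) dH) /=.
have E1 : B (A - y) = B c by apply: Bp; lra.
have E2 : B (- A - y) = B (- c) by apply: Bm; lra.
rewrite /Rintegral (@integral_vanishing _ _ (fun t => B (t - a) * (B c - B (- c))) A A0) /=.
- have -> : B (A - a) = B c by apply: Bp; lra.
  have -> : B (- A - a) = B (- c) by apply: Bm; lra.
  by ring.
- move=> t; rewrite E1 E2; apply: cvgB; (apply: cvgM; last exact: cvg_cst); exact: continuous_bump_translate.
- by move=> t tA; rewrite (bump_translate_vanish hA tA) !mul0r subr0.
- move=> t; apply: has_deriv_eq (has_derivM (has_deriv_translate (dB (t - a))) (has_deriv_cst _ t)) _.
  by rewrite E1 E2 mulr0 addr0 mulrBr.
Qed.

Lemma kernel2_ge (R : realType) (W : R * R -> R) (c a y m : R) : continuous W ->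
  (forall t x, `|t - a| < c -> `|x - y| < c -> m <= W (t, x)) ->
  m * \int[(lebesgue_measure \x lebesgue_measure)%E]_z kernel2 c a y z <=
  \int[(lebesgue_measure \x lebesgue_measure)%E]_z (W z * kernel2 c a y z).
Proof.
move=> cW hW; pose A := `|a| + `|y| + c.
have hA : `|a| + c <= A by rewrite /A -addrA lerD2l lerDr.
have hY : `|y| + c <= A by rewrite /A lerD2r lerDr.
have vK := kernel2_vanish hA hY; have cK := @continuous_kernel2 R c a y.
have cm : continuous (fun _ : R * R => - m) by move=> z; exact: cvg_cst.
rewrite -subr_ge0 -mulNr -(plane_integralZ _ cK vK) addrC.
rewrite -(plane_integralD (continuousM2 cm cK) (continuousM2 cW cK) (vanishes_offM vK) (vanishes_offM vK)).
apply: Rintegral_ge0 => -[t x] _; rewrite -mulrDl.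
have K0 : 0 <= kernel2 c a y (t, x) by rewrite mulr_ge0 ?bump_ge0.
have [ht|ht] := ltP `|t - a| c; last by rewrite /kernel2 /= (bump_vanish ht) mul0r mulr0.
have [hx|hx] := ltP `|x - y| c; last by rewrite /kernel2 /= (bump_vanish hx) !mulr0.
by apply: mulr_ge0 => //; rewrite addrC subr_ge0 hW.
Qed.

Lemma kernel2_near (R : realType) (W : R * R -> R) (c a y e : R) : continuous W ->
  (forall t x, `|t - a| < c -> `|x - y| < c -> `|W (t, x) - W (a, y)| <= e) ->
  `|\int[(lebesgue_measure \x lebesgue_measure)%E]_z (W z * kernel2 c a y z) -
    W (a, y) * \int[(lebesgue_measure \x lebesgue_measure)%E]_z kernel2 c a y z|
  <= e * \int[(lebesgue_measure \x lebesgue_measure)%E]_z kernel2 c a y z.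
Proof.
move=> cW hW; set J := \int[(lebesgue_measure \x lebesgue_measure)%E]_z kernel2 c a y z.
have h1 : (W (a, y) - e) * J <= \int[(lebesgue_measure \x lebesgue_measure)%E]_z (W z * kernel2 c a y z).
  by apply: kernel2_ge => // t x ht hx; move: (hW t x ht hx); only_lra.
have cN : continuous (fun z => - W z) by move=> z; apply: cvgN; exact: cW.
have h2 : (- W (a, y) - e) * J <= \int[(lebesgue_measure \x lebesgue_measure)%E]_z (- W z * kernel2 c a y z).
  by apply: kernel2_ge => // t x ht hx; move: (hW t x ht hx); only_lra.
pose A := `|a| + `|y| + c.
have hA : `|a| + c <= A by rewrite /A -addrA lerD2l lerDr.
have hY : `|y| + c <= A by rewrite /A lerD2r lerDr.
have vK := kernel2_vanish hA hY; have cK := @continuous_kernel2 R c a y.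
have E : (fun z => - W z * kernel2 c a y z) = (fun z => -1 * (W z * kernel2 c a y z)).
  by apply/funext => z; ring.
rewrite E (plane_integralZ _ (continuousM2 cW cK) (vanishes_offM vK)) in h2.
by move: h1 h2; clearbody J; rewrite ler_norml !mulrBl mulNr; clear; lra.
Qed.

Lemma four_point_bound (R : realType) (i1 i2 i3 i4 j1 j2 j3 j4 d : R) :
  `|i1 - j1| <= d -> `|i2 - j2| <= d -> `|i3 - j3| <= d -> `|i4 - j4| <= d ->
  i1 + -1 * i2 + (-1 * i3 + i4) = 0 -> `|j1 - j2 - (j3 - j4)| <= 4 * d.
Proof.
move=> h1 h2 h3 h4 h.
have -> : j1 - j2 - (j3 - j4) = (i2 - j2) - (i1 - j1) + ((i3 - j3) - (i4 - j4)).
  by apply/eqP; rewrite -subr_eq0 -h; apply/eqP; ring.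
have := ler_normD (i2 - j2 - (i1 - j1)) (i3 - j3 - (i4 - j4)).
have := ler_normB (i2 - j2) (i1 - j1); have := ler_normB (i3 - j3) (i4 - j4).
by move: h1 h2 h3 h4; clear; lra.
Qed.

Lemma translate_difference_vanish (R : realType) (B : R -> R) (a b c A t : R) :
  (forall x, c <= x -> B x = B c) -> (forall x, x <= - c -> B x = B (- c)) ->
  `|a| + c <= A -> `|b| + c <= A -> A < `|t| -> B (t - a) + -1 * B (t - b) = 0.
Proof.
move=> Bp Bm ha hb ht; have [t0|t0] := leP 0 t.
  rewrite (ger0_norm t0) in ht; have na := ler_norm a; have nb := ler_norm b.
  have ea : c <= t - a by move: ha ht na; clear; lra.
  have eb : c <= t - b by move: hb ht nb; clear; lra.
  by rewrite (Bp _ ea) (Bp _ eb) mulN1r subrr.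
rewrite (ltr0_norm t0) in ht.
have := ler_norm (- a); have := ler_norm (- b); rewrite !normrN => nb na.
have ea : t - a <= - c by move: ha ht na; clear; lra.
have eb : t - b <= - c by move: hb ht nb; clear; lra.
by rewrite (Bm _ ea) (Bm _ eb) mulN1r subrr.
Qed.

(** Kernels of small radius about the four corners average [W] to within [e / 4] of its corner
    values. A suitable test function has the alternating sum of these kernels as its mixed
    derivative, and their common positive mass cancels. *)
Lemma mixed_difference_zero (R : realType) (W : R * R -> R) : continuous W ->
  (forall phi, test_function phi ->
     \int[(lebesgue_measure \x lebesgue_measure)%E]_z
       (W z * iter_partial [:: false; true] phi z) = 0) ->
  forall t1 t2 x1 x2, W (t1, x1) - W (t1, x2) - (W (t2, x1) - W (t2, x2)) = 0.
Proof.
move=> cW hW t1 t2 x1 x2.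
apply/eqP; rewrite -normr_le0; apply/ler_addgt0Pr => e e0; rewrite add0r.
have e40 : 0 < e / 4 by lra.
have /continuousP2/(_ _ e40)[r1 r10 H1] := cW (t1, x1).
have /continuousP2/(_ _ e40)[r2 r20 H2] := cW (t1, x2).
have /continuousP2/(_ _ e40)[r3 r30 H3] := cW (t2, x1).
have /continuousP2/(_ _ e40)[r4 r40 H4] := cW (t2, x2).
have [c c0 [c1 c2 c3 c4]] : exists2 c : R, 0 < c & [/\ c <= r1, c <= r2, c <= r3 & c <= r4].
  exists (Num.min (Num.min r1 r2) (Num.min r3 r4)); first by rewrite !lt_min r10 r20 r30 r40.
  by rewrite !ge_min !lexx !orbT.
have [B [dB Bp Bm Blt]] := exists_bump_primitive c0.
have J0 : 0 < (B c - B (- c)) ^+ 2 by rewrite exprn_gt0 // subr_gt0.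
have I a y := @kernel2_integral R B c a y c0 dB Bp Bm.
have N1 := kernel2_near cW (fun t x h h' => H1 t x (lt_le_trans h c1) (lt_le_trans h' c1)).
have N2 := kernel2_near cW (fun t x h h' => H2 t x (lt_le_trans h c2) (lt_le_trans h' c2)).
have N3 := kernel2_near cW (fun t x h h' => H3 t x (lt_le_trans h c3) (lt_le_trans h' c3)).
have N4 := kernel2_near cW (fun t x h h' => H4 t x (lt_le_trans h c4) (lt_le_trans h' c4)).
rewrite !I in N1 N2 N3 N4.
(* Translates of [B] share the same constant values far to the left and far to the right, so their
   difference has compact support although [B] need not. Its derivative is a difference of two
   bumps. *)
pose al (a b t : R) := B (t - a) + -1 * B (t - b).
have dal a b t : has_deriv (al a b) t (bump c (t - a) - bump c (t - b)).
  apply: has_deriv_eq (has_derivD (has_deriv_translate (dB (t - a)))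
    (has_derivM (has_deriv_cst (-1) t) (has_deriv_translate (dB (t - b))))) _.
  by rewrite mul0r add0r mulN1r.
have sal a b n : diffn n (al a b).
  have hB : diffn n B by case: n => // n; exists (bump c) => //; exact: diffn_bump.
  by apply: diffnD; [|apply: diffnM; [exact: diffn_cst|]]; exact: diffn_translate.
pose A := `|t1| + `|t2| + `|x1| + `|x2| + c.
have [a1 a2 a3 a4] : [/\ `|t1| + c <= A, `|t2| + c <= A, `|x1| + c <= A & `|x2| + c <= A].
  have := normr_ge0 t1; have := normr_ge0 t2; have := normr_ge0 x1; have := normr_ge0 x2.
  by rewrite /A; clear; split; lra.
have tphi : test_function (fun z => al t1 t2 z.1 * al x1 x2 z.2).
  apply: (test_function_tensor (A := A) (sal t1 t2) (sal x1 x2)) => t.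
    exact: translate_difference_vanish Bp Bm a1 a2.
  exact: translate_difference_vanish Bp Bm a3 a4.
have := hW _ tphi; rewrite (iter_partial_tensor _ (sal t1 t2) (sal x1 x2)) /=.
have cK a y : continuous (kernel2 c a y) by exact: continuous_kernel2.
have vK a y : `|a| + c <= A -> `|y| + c <= A -> vanishes_off A (fun z => W z * kernel2 c a y z).
  by move=> ha hy; apply: vanishes_offM; exact: kernel2_vanish.
have E : (fun z => W z * (derive1 (al t1 t2) z.1 * derive1 (al x1 x2) z.2)) =
   (fun z => (W z * kernel2 c t1 x1 z + -1 * (W z * kernel2 c t1 x2 z)) +
     (-1 * (W z * kernel2 c t2 x1 z) + W z * kernel2 c t2 x2 z)).
  apply/funext => z; rewrite (has_deriv_derivable (dal _ _ _)).2 (has_deriv_derivable (dal _ _ _)).2.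
  by rewrite /kernel2; ring.
rewrite E.
have cm : continuous (fun _ : R * R => -1 : R) by move=> z; exact: cvg_cst.
have k1 := continuousM2 cW (cK t1 x1); have k2 := continuousM2 cW (cK t1 x2).
have k3 := continuousM2 cW (cK t2 x1); have k4 := continuousM2 cW (cK t2 x2).
have v1 := vK _ _ a1 a3; have v2 := vK _ _ a1 a4; have v3 := vK _ _ a2 a3; have v4 := vK _ _ a2 a4.
have m2 := continuousM2 cm k2; have m3 := continuousM2 cm k3.
have w2 := @vanishes_offM _ _ (fun=> -1) _ v2; have w3 := @vanishes_offM _ _ (fun=> -1) _ v3.
rewrite (plane_integralD (continuousD2 k1 m2) (continuousD2 m3 k4) (vanishes_offD v1 w2) (vanishes_offD w3 v4)).
rewrite (plane_integralD k1 m2 v1 w2) (plane_integralD m3 k4 w3 v4).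
rewrite (plane_integralZ _ k2 v2) (plane_integralZ _ k3 v3) => S0.
have := four_point_bound N1 N2 N3 N4 S0.
rewrite -!mulrBl normrM (gtr0_norm J0) mulrA ler_pM2r //.
by have -> : 4 * (e / 4) = e by field.
Qed.

Lemma potential_of_weak (R : realType) (f f' : R -> R) (u g : R * R -> R) :
  (forall x, has_deriv f x (f' x)) -> continuous u -> continuous g ->
  distributional_solution f u g -> exists V M, potential f u g V M.
Proof.
move=> df cu cg sol.
have cf : continuous f by move=> x; exact: has_deriv_cont (df x).
have [U [cU U0 dU]] := exists_primitive_x cu.
have [M [cM M0 dM]] := exists_primitive_x cg.
have cfu : continuous (f \o u) by move=> z; apply: continuous_comp; [exact: cu | exact: cf].
have [N [cN N0 dN]] := exists_primitive_t (continuousB2 cM cfu).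
have cn0 : continuous (fun t => N (t, 0)) by exact: continuous_slice_t.
(* Chosen so that [N - V] vanishes on the line [x = 0]. As [N] vanishes at time 0, the mixed
   difference from the origin gives [V (t, x) = N (t, x) + V (0, x)], and [V] inherits the time
   derivative of [N]. *)
pose V z := U z + N (z.1, 0).
have cV : continuous V.
  apply: (@continuousD2 R U (fun z => N (z.1, 0))) => // z.
  by apply: (@continuous_comp _ _ _ fst (fun t => N (t, 0))); [exact: cvg_fst | exact: cn0].
have Vx t x : has_deriv (fun y => V (t, y)) x (u (t, x)).
  by apply: has_deriv_eq (has_derivD (dU t x) (has_deriv_cst (N (t, 0)) x)) _; rewrite addr0.
have W0 phi : test_function phi ->
    \int[(lebesgue_measure \x lebesgue_measure)%E]_z
       ((N z - V z) * iter_partial [:: false; true] phi z) = 0.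
  move=> tphi; rewrite -(weak_form_mixed df cu cg cV cN cM Vx dN dM tphi).
  by have := sol _ tphi; rewrite /distr_dt /distr_dx -opprD => <-; exact: subrr.
have mix := mixed_difference_zero (continuousB2 cN cV) W0.
have EV t x : V (t, x) = N (t, x) + V (0, x).
  by have := mix t 0 x 0; rewrite /V /= !U0 !N0; lra.
exists V, M; split=> // t x.
have -> : (fun s => V (s, x)) = (fun s => N (s, x) + V (0, x)) by apply/funext => s; exact: EV.
by apply: has_deriv_eq (has_derivD (dN t x) (has_deriv_cst (V (0, x)) t)) _; rewrite addr0.
Qed.

Lemma weak_of_potential (R : realType) (f f' : R -> R) (u g V M : R * R -> R) :
  (forall x, has_deriv f x (f' x)) -> continuous u -> continuous g ->
  continuous V -> continuous M -> potential f u g V M -> distributional_solution f u g.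
Proof.
move=> df cu cg cV cM [Vx Vt Mx] phi tphi.
have := weak_form_mixed df cu cg cV cV cM Vx Vt Mx tphi.
have -> : \int[(lebesgue_measure \x lebesgue_measure)%E]_z
    ((V z - V z) * iter_partial [:: false; true] phi z) = 0.
  by rewrite /Rintegral integral0_eq // => z _; rewrite subrr mul0r.
by rewrite /distr_dt /distr_dx -opprD; exact: addr0_eq.
Qed.

(** * The equivalence *)

Lemma class_C2_deriv (R : realType) (f : R -> R) : class_C 2 f ->
  (forall x, has_deriv f x (derive1 f x)) /\ continuous (derive1 f).
Proof.
move=> [df _]; split=> x; first exact: derivable_has_deriv (df 0%N isT x).
exact: has_deriv_cont (derivable_has_deriv (df 1%N isT x)).
Qed.

Lemma bounded_fun_bound (R : realType) (T : Type) (g : T -> R) :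
  bounded_fun g -> exists G : R, forall z, `|g z| <= G.
Proof.
move=> [G [_ HG]]; exists (`|G| + 1) => z; apply: HG => //.
by rewrite (le_lt_trans (ler_norm G)) // ltrDl.
Qed.

Lemma carries_characteristic (R : realType) (f : R -> R) (u g : R * R -> R) (gam : R -> R) :
  continuous (derive1 f) -> continuous u -> carries (derive1 f) u g gam ->
  characteristic f u gam.
Proof.
move=> cf' cu car.
have E : derive1 gam = (fun t => derive1 f (u (t, gam t))).
  by apply/funext => t; exact: (has_deriv_derivable (car t).1).2.
split; last by move=> t; rewrite E.
split; first by case=> [|k] k1 t; [exact: (has_deriv_derivable (car t).1).1 | discriminate k1].
rewrite derive1n1 E => t; apply: continuous_comp; last exact: cf'.
exact: (@continuous_along R u gam cu (carries_cont car)).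
Qed.

Lemma characteristic_carries (R : realType) (f : R -> R) (u g : R * R -> R) (gam : R -> R) :
  characteristic f u gam ->
  (forall t : R, is_derive t 1 (fun s : R => u (s, gam s)) (g (t, gam t))) ->
  carries (derive1 f) u g gam.
Proof.
move=> [[dg _] Eg] du t; split; last exact: is_derive_has_deriv (du t).
by rewrite -Eg; exact: derivable_has_deriv (dg 0%N isT t).
Qed.

Lemma lipschitz_of_bounded_deriv (R : realType) (F dF : R -> R) (G : R) :
  (forall t, has_deriv F t (dF t)) -> (forall t, `|dF t| <= G) -> lipschitz F.
Proof.
move=> d b; apply: (@klipschitzW _ _ _ G).
  by apply: (@globally_properfilter _ _ (0, 0)).
move=> -[t s] _ /=.
exact: (MVT_abs (fun r _ => d r) (fun r _ => b r)).
Qed.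

(** The family consists of all carrying curves. One passes through each point, so their union is the
    whole plane. *)
Lemma curves_of_weak (R : realType) (u g : R * R -> R) (f : R -> R) (G : R) :
  (forall x, has_deriv f x (derive1 f x)) -> continuous (derive1 f) ->
  continuous u -> continuous g -> (forall z, `|g z| <= G) ->
  distributional_solution f u g -> solution_along_characteristics f u g.
Proof.
move=> df cf' cu cg bg sol; have [V [M pot]] := potential_of_weak df cu cg sol.
exists [set gam | carries (derive1 f) u g gam]; split=> [gam /=|O [[t0 x0] Oz] oO|gam car|gam car t].
- exact: carries_characteristic.
- have [gam [E dgam du]] := characteristic_through t0 x0 df cf' cu cg bg pot.
  by exists (t0, x0); split=> //; exists gam => //=; exists t0; rewrite ?E.
- exact: lipschitz_of_bounded_deriv (fun t => (car t).2) (fun t => bg _).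
- exact: has_deriv_is_derive (car t).2.
Qed.

Lemma weak_of_curves (R : realType) (u g : R * R -> R) (f : R -> R) (G : R) :
  (forall x, has_deriv f x (derive1 f x)) -> continuous (derive1 f) ->
  continuous u -> continuous g -> (forall z, `|g z| <= G) ->
  solution_along_characteristics f u g -> distributional_solution f u g.
Proof.
move=> df cf' cu cg bg [Gam [char dns _ du]].
have car gam : Gam gam -> carries (derive1 f) u g gam.
  by move=> Gg; apply: characteristic_carries; [exact: char | exact: du].
have lat : lattice_of_curves (carries (derive1 f) u g).
  split=> [gam|g1 g2|g1 g2|t0 x0 rho rho0]; [exact: carries_cont|exact: carries_min|exact: carries_max|].
  exact: carries_dense cf' cu bg car dns t0 x0 rho rho0.
have [V [M [pot cV cM]]] := potential_of_curves df cf' cu cg bg lat.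
exact: weak_of_potential df cu cg cV cM pot.
Qed.

Theorem theorem8p1 (R : realType) (u g : R * R -> R) (f : R -> R)
    (u_cont : continuous u) (g_cont : continuous g)
    (g_bounded : bounded_fun g) (f_C2 : class_C 2 f) :
  (solution_along_characteristics f u g -> distributional_solution f u g) /\
  (inflection_point f `<=` isolated (inflection_point f) ->
   distributional_solution f u g -> solution_along_characteristics f u g).
Proof.
have [df cf'] := class_C2_deriv f_C2; have [G bg] := bounded_fun_bound g_bounded.
by split=> [|_]; [exact: weak_of_curves bg | exact: curves_of_weak bg].
Qed.
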